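(* Let $(X,d)$ be a compact metric space, $f\colon X\to X$ a continuous map, $m\in\mathcal{M}(X)$ a Borel probability measure, and $\varphi\colon X\to\mathbb{R}$ a continuous function. Suppose that: [A.1] $(X,f)$ satisfies the one-way (W)-specification property; [A.2] $\displaystyle \lim_{\epsilon\to 0}\liminf_{n\to\infty}\inf_{x\in X}\Big(\frac1n\log m(B_n(x,\epsilon))+\frac1n\sum_{j=0}^{n-1}\varphi(f^j(x))\Big)\ge 0$; [A.3] the entropy map $\mu\mapsto h(\mu)$ is upper semicontinuous on $\mathcal{M}_f(X)$; [A.4] $\displaystyle \lim_{\epsilon\to 0}\limsup_{n\to\infty}\sup_{x\in X}\Big(\frac1n\log m(B_n(x,\epsilon))+\frac1n\sum_{j=0}^{n-1}\varphi(f^j(x))\Big)\le 0$. Then $(X,f)$ satisfies a level-2 large deviation principle with reference measure $m$ and rate function the free energy $\mathcal{F}_\varphi$.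
   Context: $\mathcal{M}(X)$ denotes the set of Borel probability measures on $X$ with the weak topology, $\mathcal{M}_f(X)$ the $f$-invariant ones, and $h(\mu)$ the metric (Kolmogorov–Sinai) entropy of $\mu\in\mathcal{M}_f(X)$. $B_n(x,\epsilon)=\{y\in X: d(f^j(x),f^j(y))\le\epsilon,\ 0\le j\le n-1\}$. $\mathcal{E}_n(x)=\frac1n\sum_{j=0}^{n-1}\delta_{f^j(x)}$. The non-wandering set $\Omega(f)$ is the set of $x\in X$ such that for every neighborhood $U$ of $x$ there is $n>0$ with $U\cap f^{-n}(U)\neq\emptyset$. One-way (W)-specification property: there exist compact sets $X_1,\dots,X_q\subset X$ such that (1) $f(X_i)\subset X_i$ for all $i$; (2) $\Omega(f)=\bigcup_{i=1}^q X_i$; (3) for every $\epsilon>0$ there is an integer $M\ge0$ such that for any $k\ge1$, any $x_1\in X_{i(1)},\dots,x_k\in X_{i(k)}$ with $i(1)\le\cdots\le i(k)$ and any $n_1,\dots,n_k\in\mathbb{N}$, there exist $y\in X$ and integers $0\le M_1,\dots,M_{k-1}\le M$ with $d(f^i(x_j),f^{i+\sum_{t=1}^{j-1}(n_t+M_t)}(y))\le\epsilon$ for $0\le i\le n_j-1$, $1\le j\le k$ (empty sum $=0$). Level-2 large deviation principle with reference measure $m$ and rate function $q$: $q\colon\mathcal{M}(X)\to[-\infty,0]$ is upper semicontinuous, and for every open $G\subset\mathcal{M}(X)$, $\liminf_{n\to\infty}\frac1n\log m(\{x:\mathcal{E}_n(x)\in G\})\ge\sup_{\mu\in G}q(\mu)$,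 and for every closed $F\subset\mathcal{M}(X)$, $\limsup_{n\to\infty}\frac1n\log m(\{x:\mathcal{E}_n(x)\in F\})\le\sup_{\mu\in F}q(\mu)$. Free energy: $\mathcal{F}_\varphi(\mu)=h(\mu)-\int\varphi\,d\mu$ if $\mu$ is $f$-invariant, and $\mathcal{F}_\varphi(\mu)=-\infty$ otherwise. *)

(* Defs.v *)
From HB Require Import structures.
From mathcomp Require Import all_boot all_order all_algebra.
From mathcomp Require Import all_classical all_reals all_analysis.
Set Implicit Arguments. Unset Strict Implicit. Unset Printing Implicit Defensive.
Import Order.TTheory GRing.Theory Num.Theory.
Import numFieldNormedType.Exports.
Local Open Scope classical_set_scope.
Local Open Scope ring_scope.

(* A (nonempty) metric space: metric structure of MathComp-Analysis
   (distance [mdist], balls are [mdist]-balls) together with a point,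
   which is needed to build the Borel measurable space. *)
#[short(type="pmetricType")]
HB.structure Definition PointedMetric (K : numDomainType) :=
  { M of Metric K M & isPointed M }.

Section Defs.
Context {R : realType} {X : pmetricType R}.

Definition borel := g_sigma_algebraType (@open X).

Notation PM := (probability borel R).

Definition integ (mu : PM) (g : X -> R) : \bar R :=
  (\int[mu]_x (g x)%:E)%E.

Definition weak_nbhs (mu : PM) (U : set PM) : Prop :=
  exists (k : nat) (g : 'I_k -> X -> R) (e : R),
    [/\ 0 < e, (forall i, continuous (g i)) &
        [set nu : PM | forall i, (`| integ nu (g i) - integ mu (g i) | < e%:E)%E]
          `<=` U].

Definition weak_open (G : set PM) : Prop := forall mu, G mu -> weak_nbhs mu G.
Definition weak_closed (F : set PM) : Prop := weak_open (~` F).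

Definition invariant (f : X -> X) (mu : PM) : Prop :=
  forall A : set borel, measurable A -> mu (f @^-1` A) = mu A.

Definition mpartition (k : nat) (xi : 'I_k -> set X) : Prop :=
  [/\ forall i, measurable (xi i : set borel),
      forall i j, i != j -> xi i `&` xi j = set0 &
      \bigcup_i xi i = setT].

Definition join_atom (f : X -> X) (k n : nat) (xi : 'I_k -> set X)
  (w : {ffun 'I_n -> 'I_k}) : set X :=
  [set x | forall i : 'I_n, xi (w i) (iter i f x)].

(* Shannon entropy H_mu(xi v ... v f^-(n-1) xi), with 0 log 0 = 0 *)
Definition Hjoin (f : X -> X) (mu : PM) (k : nat) (xi : 'I_k -> set X) (n : nat) : R :=
  - \sum_(w : {ffun 'I_n -> 'I_k})
      (fine (mu (join_atom f xi w)) * ln (fine (mu (join_atom f xi w)))).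

Definition hpart (f : X -> X) (mu : PM) (k : nat) (xi : 'I_k -> set X) : R :=
  limn (fun n => Hjoin f mu xi n.+1 / n.+1%:R).

Definition ks_entropy (f : X -> X) (mu : PM) : \bar R :=
  ereal_sup [set r | exists (k : nat) (xi : 'I_k -> set X),
                        mpartition xi /\ r = (hpart f mu xi)%:E].

Definition free_energy (f : X -> X) (phi : X -> R) (mu : PM) : \bar R :=
  if `[< invariant f mu >] then (ks_entropy f mu - integ mu phi)%E else (-oo)%E.

(* --- empirical measures E_n(x) = (1/n) sum_{j<n} delta_{f^j x} ---
   (mnormalize divides by the total mass n; for n = 0 it returns the
   default delta_x, irrelevant for the asymptotic statements) *)
Definition empirical (f : X -> X) (n : nat) (x : X) : PM :=
  mnormalize (msum (fun j => @dirac _ borel (iter j f x) R) n) (@dirac _ borel x R).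

Definition LDP2 (f : X -> X) (m : PM) (q : PM -> \bar R) : Prop :=
  [/\ forall mu, (q mu <= 0)%E,
      forall t : R, weak_open [set mu | (q mu < t%:E)%E],
      forall G, weak_open G ->
        (ereal_sup (q @` G) <=
         limn_einf (fun n : nat => (n%:R^-1)%:E * lne (m [set x | G (empirical f n x)])))%E &
      forall F, weak_closed F ->
        (limn_esup (fun n : nat => (n%:R^-1)%:E * lne (m [set x | F (empirical f n x)]))
          <= ereal_sup (q @` F))%E].

Definition nonwandering (f : X -> X) : set X :=
  [set x | forall U, nbhs x U -> exists n, (0 < n)%N /\ U `&` (iter n f @^-1` U) !=set0].

Definition W_specification (f : X -> X) : Prop :=
  exists (q : nat) (Xs : 'I_q -> set X),
  [/\ forall i, compact (Xs i),
      forall i, f @` Xs i `<=` Xs i,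
      nonwandering f = \bigcup_i Xs i &
      forall eps : R, 0 < eps -> exists M : nat,
        forall (k : nat) (ind : 'I_k -> 'I_q) (x : 'I_k -> X) (n : 'I_k -> nat),
          (0 < k)%N ->
          (forall a b : 'I_k, (a <= b)%N -> (ind a <= ind b)%N) ->
          (forall j, Xs (ind j) (x j)) ->
          (forall j, (0 < n j)%N) ->
          exists (y : X) (Ms : 'I_k -> nat),
            (forall t, (Ms t <= M)%N) /\
            forall (j : 'I_k) (i : nat), (i < n j)%N ->
              mdist (iter i f (x j))
                    (iter (i + \sum_(t < k | (t < j)%N) (n t + Ms t)) f y) <= eps].

Definition bowen (f : X -> X) (n : nat) (x : X) (eps : R) : set X :=
  [set y | forall j, (j < n)%N -> mdist (iter j f x) (iter j f y) <= eps].

Definition bowen_term (f : X -> X) (m : PM) (phi : X -> R) (n : nat) (eps : R)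
  (x : X) : \bar R :=
  ((n%:R^-1)%:E * lne (m (bowen f n x eps)) +
   (n%:R^-1 * \sum_(j < n) phi (iter j f x))%:E)%E.

Definition lower_bowen (f : X -> X) (m : PM) (phi : X -> R) (eps : R) : \bar R :=
  limn_einf (fun n => ereal_inf [set bowen_term f m phi n eps x | x in setT]).

Definition upper_bowen (f : X -> X) (m : PM) (phi : X -> R) (eps : R) : \bar R :=
  limn_esup (fun n => ereal_sup [set bowen_term f m phi n eps x | x in setT]).

Definition entropy_usc (f : X -> X) : Prop :=
  forall (mu : PM) (t : R), invariant f mu -> (ks_entropy f mu < t%:E)%E ->
    exists U, weak_nbhs mu U /\
      forall nu, U nu -> invariant f nu -> (ks_entropy f nu < t%:E)%E.

End Defs.

(* Main.v *)
(** Lower bound. For an invariant measure [mu], take code words describing orbit segments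
    of length [L], with the law given by [mu], and draw [K] of them independently.
    Chebyshev's inequality gives about [exp (K L h)] typical sequences along which the
    Birkhoff sums are close to their means. After sorting the segments by the
    pieces of the nonwandering set that they start in, one-way specification glues them
    into single orbits, and each point lies in only few of the corresponding Bowen balls,
    whose measures are bounded below by [A.2]. Independence of the blocks
    makes ergodicity of [mu], and the ergodic theorem, unnecessary. For the whole
    space as open set the bound says that the free energy is nonpositive.

    Upper bound. The measures are compact by the Riesz representation theorem applied to
    ultralimits of integrals, so it suffices to bound the decay near one measure. If
    the deviation sets had measure at least [exp (n t)] infinitely often, condition [m] on them:
    [A.4] bounds the conditional measure of small balls, hence the entropy of the
    conditioned measures from below, and Misiurewicz' argument transfers this bound to an
    invariant limit of their orbit averages. Upper semicontinuity of the entropy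
    concludes. *)

Require Import Defs.
From HB Require Import structures.
From mathcomp Require Import all_boot all_order all_algebra.
From mathcomp Require Import all_classical all_reals all_analysis.
From mathcomp Require Import measurable_realfun ring lra.
Import Order.TTheory GRing.Theory Num.Theory.
Import numFieldNormedType.Exports.
Local Open Scope classical_set_scope.
Local Open Scope ring_scope.
Set Implicit Arguments. Unset Strict Implicit. Unset Printing Implicit Defensive.

(** The entropy is a supremum over all finite Borel partitions, so in the lower bound the atoms
    cannot be chosen with null boundary, and a shadowing orbit need not carry the labels of the
    orbit it shadows. Compact inner approximations of the atoms leave only a set of small measure on
    which labels have to be supplied as side information; this information has small entropy per
    unit of time, and it bounds the overlap of the Bowen balls. In the upper bound the partition is
    free, and null boundaries are available. One-way specification accepts only segments with
    nondecreasing piece indices, whereas typical sequences are unordered. Sorting does no harm: a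
    sum over blocks does not depend on their order, and the sorting permutation is a function of the
    indices, which belong to the side information. The gap lengths offer at most (M+1)^K
    possibilities, and a large L makes ln(M+1)/L negligible. The weak topology is handled through
    integrals of continuous functions; ultrafilters supply limits without metrizability of the space
    of measures. *)

(** * Entropy of finite distributions *)

Section finite_entropy.
Context {R : realType}.
Implicit Types (x c : R) (S T : finType).

Definition nlnx x : R := - (x * ln x).

Lemma nlnx0 : nlnx 0 = 0. Proof. by rewrite /nlnx mul0r oppr0. Qed.

Lemma ln_le_sub1 x : 0 < x -> ln x <= x - 1.
Proof.
move=> x0; have -> : x = 1 + (x - 1) by ring.
rewrite [X in _ <= X](_ : _ = x - 1); last by ring.
by apply: le_ln1Dx; lra.
Qed.

(** The right side is the tangent at [c] of the concave function -x ln x. Gibbs' inequality,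
    concavity and semicontinuity below are this bound at a suitable [c]. *)
Lemma nlnx_le_tangent x c : 0 <= x -> 0 < c -> nlnx x <= - (x * ln c) + (c - x).
Proof.
rewrite le_eqVlt => /predU1P[<- c0|x0 c0].
  by rewrite nlnx0 mul0r oppr0 add0r addr0 ltW.
have := ln_le_sub1 (divr_gt0 c0 x0).
rewrite ln_div ?posrE// => /(ler_wpM2l (ltW x0)).
have -> : x * (c / x - 1) = c - x by field; rewrite gt_eqF.
by rewrite /nlnx; lra.
Qed.

Lemma nlnx_ge0 x : 0 <= x -> x <= 1 -> 0 <= nlnx x.
Proof.
by move=> x0 x1; rewrite /nlnx -mulrN mulr_ge0// oppr_ge0 ln_le0.
Qed.

Lemma nlnx_usc c e : 0 <= c -> 0 < e ->
  exists2 k, 0 < k & forall x, 0 <= x -> `|x - c| <= k -> nlnx x <= nlnx c + e.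
Proof.
rewrite le_eqVlt => /predU1P[<-|c0] e0.
  (* The slope is infinite at 0, so the tangent at [e / 2] is used: its value at 0 is [e / 2], which
     leaves [e / 2] for the linear term. *)
  have e20 : 0 < e / 2 by lra.
  have B0 : 0 < `|ln (e / 2)| + 1 by rewrite ltr_wpDl.
  exists (e / 2 / (`|ln (e / 2)| + 1)); first exact: divr_gt0.
  move=> x x0; rewrite subr0 ger0_norm// ler_pdivlMr// => xk.
  rewrite nlnx0 (le_trans (nlnx_le_tangent x0 e20))//.
  have : - (x * ln (e / 2)) <= x * `|ln (e / 2)|.
    by rewrite -mulrN ler_wpM2l// -normrN ler_norm.
  by lra.
have B0 : 0 < `|ln c + 1| + 1 by rewrite ltr_wpDl.
exists (e / (`|ln c + 1| + 1)); first exact: divr_gt0.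
move=> x x0; rewrite ler_pdivlMr// => xc.
rewrite (le_trans (nlnx_le_tangent x0 c0))//.
have : (c - x) * (ln c + 1) <= `|x - c| * `|ln c + 1|.
  by rewrite -(distrC c) -normrM ler_norm.
have := normr_ge0 (x - c).
by rewrite /nlnx; lra.
Qed.

Definition fent T (p : T -> R) : R := \sum_t nlnx (p t).

(** Sum of the tangent bounds with [c := q t]. Absolute continuity is required because [ln 0] takes
    the default value 0. *)
Lemma gibbs T (p q : T -> R) :
  (forall t, 0 <= p t) -> (forall t, 0 <= q t) -> (forall t, 0 < p t -> 0 < q t) ->
  \sum_t q t <= \sum_t p t -> fent p <= - \sum_t p t * ln (q t).
Proof.
move=> p0 q0 pq sqp; rewrite /fent.
have: \sum_t nlnx (p t) <= \sum_t (- (p t * ln (q t)) + (q t - p t)).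
  apply: ler_sum => t _; have := p0 t; rewrite le_eqVlt => /predU1P[<-|pt0].
    by rewrite nlnx0 mul0r oppr0 add0r addr0.
  by apply: nlnx_le_tangent => //; exact: pq.
by rewrite big_split/= !sumrN sumrB; lra.
Qed.

Lemma fent_ge0 T (p : T -> R) : (forall t, 0 <= p t) -> \sum_t p t = 1 -> 0 <= fent p.
Proof.
move=> p0 p1; apply: sumr_ge0 => t _; apply: nlnx_ge0 => //.
by rewrite -p1 (bigD1 t)//= lerDl sumr_ge0.
Qed.

Lemma fent_le_card T (p : T -> R) : (forall t, 0 <= p t) -> \sum_t p t = 1 ->
  fent p <= ln #|T|%:R.
Proof.
move=> p0 p1.
have T0 : (0 < #|T|)%N.
  rewrite lt0n; apply/eqP => T0; move: p1; rewrite big1 => [/eqP|t].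
    by rewrite eq_sym oner_eq0.
  by have := fintype0 t => /(_ T0).
have T0' : 0 < #|T|%:R :> R by rewrite ltr0n.
have := @gibbs _ p (fun=> #|T|%:R^-1) p0.
rewrite -mulr_suml p1 mul1r lnV ?posrE// opprK; apply.
- by move=> ?; rewrite invr_ge0 ltW.
- by move=> ? _; rewrite invr_gt0.
- by rewrite sumr_const -[_^-1 *+ _]mulr_natr mulVf// gt_eqF.
Qed.

Definition marg T S (pi : T -> S) (p : T -> R) (s : S) : R :=
  \sum_(t | pi t == s) p t.

Lemma sum_marg T S (pi : T -> S) (p : T -> R) (F : S -> R) :
  \sum_s marg pi p s * F s = \sum_t p t * F (pi t).
Proof.
rewrite [RHS](partition_big pi predT)//=; apply: eq_bigr => s _.
by rewrite mulr_suml; apply: eq_bigr => t /eqP ->.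
Qed.

Lemma marg_ge0 T S (pi : T -> S) (p : T -> R) s :
  (forall t, 0 <= p t) -> 0 <= marg pi p s.
Proof. by move=> p0; apply: sumr_ge0. Qed.

Lemma le_marg T S (pi : T -> S) (p : T -> R) t :
  (forall t, 0 <= p t) -> p t <= marg pi p (pi t).
Proof. by move=> p0; rewrite /marg (bigD1 t)//= lerDl sumr_ge0. Qed.

Lemma marg_sum1 T S (pi : T -> S) (p : T -> R) : \sum_s marg pi p s = \sum_t p t.
Proof.
have := sum_marg pi p (fun=> 1).
by under eq_bigr do rewrite mulr1; under [in RHS]eq_bigr do rewrite mulr1.
Qed.

(** Merging outcomes raises each probability, hence lowers its information [- ln]. *)
Lemma fent_marg T S (pi : T -> S) (p : T -> R) : (forall t, 0 <= p t) ->
  fent (marg pi p) <= fent p.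
Proof.
move=> p0; rewrite /fent /nlnx !sumrN lerN2 sum_marg; apply: ler_sum => t _.
have := p0 t; rewrite le_eqVlt => /predU1P[<-|pt0]; first by rewrite !mul0r.
have pm := le_marg pi t p0.
by rewrite ler_pM2l// ler_ln ?posrE// (lt_le_trans pt0).
Qed.

(** Gibbs' inequality against the product of the two marginals, whose logarithm splits. *)
Lemma fent_pair S T (p : S * T -> R) : (forall t, 0 <= p t) -> \sum_t p t = 1 ->
  fent p <= fent (marg fst p) + fent (marg snd p).
Proof.
move=> p0 p1.
have m1p t : 0 < p t -> 0 < marg fst p t.1.
  by move=> pt; rewrite (lt_le_trans pt)// le_marg.
have m2p t : 0 < p t -> 0 < marg snd p t.2.
  by move=> pt; rewrite (lt_le_trans pt)// le_marg.
have := @gibbs _ p (fun t => marg fst p t.1 * marg snd p t.2) p0.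
move=> /(_ _ _ _)/le_trans; apply.
- by move=> t; rewrite mulr_ge0// marg_ge0.
- by move=> t pt; rewrite mulr_gt0 ?m1p ?m2p.
- rewrite -(pair_big xpredT xpredT (fun s t => marg fst p s * marg snd p t))/=.
  under eq_bigr do rewrite -mulr_sumr marg_sum1 p1 mulr1.
  by rewrite marg_sum1.
- rewrite /fent /nlnx !sumrN !sum_marg -opprD -big_split/= lerN2.
  apply: ler_sum => t _; have := p0 t; rewrite le_eqVlt => /predU1P[<-|pt].
    by rewrite !mul0r addr0.
  by rewrite lnM ?posrE ?m1p ?m2p// mulrDr.
Qed.

(** Tangent bounds at the mixture [c]: averaging them with the weights [w] cancels the linear part
    and leaves [nlnx c]. *)
Lemma fent_concave T n (w : 'I_n -> R) (p : 'I_n -> T -> R) :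
  (forall i, 0 <= w i) -> \sum_i w i = 1 -> (forall i t, 0 <= p i t) ->
  \sum_i w i * fent (p i) <= fent (fun t => \sum_i w i * p i t).
Proof.
move=> w0 w1 p0; rewrite /fent; under eq_bigr do rewrite mulr_sumr.
rewrite exchange_big/=; apply: ler_sum => t _; set c := \sum_i w i * p i t.
have c0 : 0 <= c by apply: sumr_ge0 => i _; rewrite mulr_ge0.
have := c0; rewrite le_eqVlt => /predU1P[c00|c1].
  rewrite -c00 nlnx0 big1// => i _.
  have /psumr_eq0P/(_ i isT)/eqP : c = 0 by [].
  rewrite mulf_eq0 => /(_ (fun j _ => mulr_ge0 (w0 j) (p0 j t)))/orP[/eqP->|/eqP->].
    by rewrite mul0r.
  by rewrite nlnx0 mulr0.
have: \sum_i w i * nlnx (p i t) <= \sum_i w i * (- (p i t * ln c) + (c - p i t)).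
  by apply: ler_sum => i _; rewrite ler_wpM2l// nlnx_le_tangent.
have -> : \sum_i w i * (- (p i t * ln c) + (c - p i t)) = nlnx c.
  transitivity (- ln c * \sum_i w i * p i t + c * \sum_i w i - \sum_i w i * p i t).
    rewrite !mulr_sumr -big_split -sumrB/=; apply: eq_bigr => i _; ring.
  by rewrite w1 -/c /nlnx; ring.
by [].
Qed.

(** Uniformity in [p] lets [k] be fixed before atoms are approximated from inside. The outcome [t0]
    costs at most [e / 2] by the tangent at 1; the others share the other half. *)
Lemma fent_small T (t0 : T) e : 0 < e ->
  exists2 k, 0 < k & forall p : T -> R, (forall t, 0 <= p t) -> \sum_t p t = 1 ->
    1 - k <= p t0 -> fent p <= e.
Proof.
move=> e0; have d0 : 0 < e / 2 / #|T|%:R.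
  by rewrite divr_gt0 ?divr_gt0// ltr0n; apply/card_gt0P; exists t0.
have [k k0 kP] := nlnx_usc (lexx 0) d0.
exists (Num.min k (e / 2)); first by rewrite lt_min k0 divr_gt0.
move=> p p0 p1 pt0.
have k1 : Num.min k (e / 2) <= k by rewrite ge_min lexx.
have k2 : Num.min k (e / 2) <= e / 2 by rewrite ge_min lexx orbT.
rewrite /fent (bigD1 t0)//=.
have : nlnx (p t0) <= e / 2.
  have := nlnx_le_tangent (p0 t0) ltr01; rewrite ln1; lra.
suff : \sum_(t | t != t0) nlnx (p t) <= e / 2 by lra.
have : \sum_(t | t != t0) nlnx (p t) <= \sum_(t | t != t0) e / 2 / #|T|%:R.
  apply: ler_sum => t tt0.
  suff : nlnx (p t) <= nlnx 0 + e / 2 / #|T|%:R by rewrite nlnx0 add0r.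
  apply: kP => //; rewrite subr0 ger0_norm//.
  have : p t0 + p t <= 1.
    by rewrite -p1 (bigD1 t0)//= (bigD1 t)//= addrA lerDl sumr_ge0.
  by lra.
move=> /le_trans; apply.
have E : e / 2 = e / 2 / #|T|%:R * #|T|%:R.
  by rewrite divfK// pnatr_eq0 -lt0n; apply/card_gt0P; exists t0.
rewrite sumr_const -[X in X <= _]mulr_natr [X in _ <= X]E ler_wpM2l ?(ltW d0)//.
rewrite ler_nat max_card//.
Qed.

End finite_entropy.

(** * Independent draws: the weak law of large numbers *)

Section weak_law.
Context {R : realType} (T : finType) (p : T -> R).
Hypotheses (p0 : forall t, 0 <= p t) (p1 : \sum_t p t = 1).

Definition prodw K (s : {ffun 'I_K -> T}) : R := \prod_(j < K) p (s j).

Lemma prodw_ge0 K (s : {ffun 'I_K -> T}) : 0 <= prodw s.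
Proof. by apply: prodr_ge0. Qed.

Lemma sum_prodw K (h : 'I_K -> T -> R) :
  \sum_s prodw s * \prod_(j < K) h j (s j) = \prod_(j < K) \sum_t p t * h j t.
Proof.
rewrite bigA_distr_bigA/=; apply: eq_bigr => s _.
by rewrite /prodw -big_split.
Qed.

Lemma sum_prodw1 K : \sum_(s : {ffun 'I_K -> T}) prodw s = 1.
Proof.
rewrite /prodw -(bigA_distr_bigA (fun _ t => p t))/= big1// => j _.
Qed.

(** Written as a product over all coordinates, a function of one coordinate comes within reach of
    [sum_prodw]. *)
Let exp1 (G : T -> R) K (j : 'I_K) (s : {ffun 'I_K -> T}) :
  G (s j) = \prod_i (if i == j then G (s i) else 1).
Proof.
rewrite (bigD1 j)//= eqxx big1 ?mulr1// => i /negbTE -> //.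
Qed.

(** Independence kills the cross terms, since [G] is centred. *)
Lemma sum_prodw_sqr K (G : T -> R) : \sum_t p t * G t = 0 ->
  \sum_(s : {ffun 'I_K -> T}) prodw s * (\sum_j G (s j)) ^+ 2
  = K%:R * \sum_t p t * G t ^+ 2.
Proof.
move=> G0.
transitivity (\sum_(j < K) \sum_(l < K) \sum_(s : {ffun 'I_K -> T})
    prodw s * (G (s j) * G (s l))).
  under [RHS]eq_bigr do rewrite exchange_big/=.
  rewrite [RHS]exchange_big/=; apply: eq_bigr => s _.
  rewrite expr2 mulr_suml mulr_sumr; apply: eq_bigr => j _.
  by rewrite !mulr_sumr.
rewrite -[in RHS](card_ord K) -sum1_card natr_sum mulr_suml.
apply: eq_bigr => j _; rewrite mul1r (bigD1 j)//= [X in _ + X]big1 ?addr0; last first.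
  move=> l lj.
  transitivity (\sum_(s : {ffun 'I_K -> T}) prodw s *
     \prod_i ((if i == j then G (s i) else 1) * (if i == l then G (s i) else 1))).
    by apply: eq_bigr => s _; rewrite big_split/= -!exp1.
  rewrite (sum_prodw (fun i t => (if i == j then G t else 1) * (if i == l then G t else 1))).
  rewrite (bigD1 j)//= eqxx eq_sym (negbTE lj).
  by under eq_bigr do rewrite mulr1; rewrite G0 mul0r.
transitivity (\sum_(s : {ffun 'I_K -> T}) prodw s *
     \prod_i (if i == j then G (s i) ^+ 2 else 1)).
  by apply: eq_bigr => s _; rewrite -(exp1 (fun t => G t ^+ 2)) expr2.
rewrite (sum_prodw (fun i t => if i == j then G t ^+ 2 else 1)).
rewrite (bigD1 j)//= eqxx [X in _ * X]big1 ?mulr1// => i /negbTE ->.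
by under eq_bigr do rewrite mulr1.
Qed.

(** Chebyshev's inequality for finitely many observables at once: [V] adds up their variances, so
    the union bound is included. *)
Lemma weak_law (I : finType) (F : I -> T -> R) (e : R) : 0 < e ->
  exists K0, forall K, (K0 <= K)%N -> (0 < K)%N ->
  1 / 2 <= \sum_(s : {ffun 'I_K -> T} |
     [forall i, `|\sum_j F i (s j) - K%:R * \sum_t p t * F i t| <= K%:R * e]) prodw s.
Proof.
move=> e0.
pose a i := \sum_t p t * F i t; pose G i t := F i t - a i.
pose V := \sum_i \sum_t p t * G i t ^+ 2.
have V0 : 0 <= V.
  by apply: sumr_ge0 => i _; apply: sumr_ge0 => t _; rewrite mulr_ge0// sqr_ge0.
have G0 i : \sum_t p t * G i t = 0.
  under eq_bigr do rewrite mulrBr.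
  by rewrite sumrB -/(a i) -mulr_suml p1 mul1r subrr.
(* The exceptional mass is at most V / (K e^2), which is at most 1/2 beyond this threshold. *)
exists (Num.truncn (2 * V / e ^+ 2)).+1 => K K0 Kp.
have Kp' : 0 < K%:R :> R by rewrite ltr0n.
have Ke : 0 < K%:R * e by rewrite mulr_gt0.
have GE i (s : {ffun 'I_K -> T}) :
    \sum_j F i (s j) - K%:R * \sum_t p t * F i t = \sum_j G i (s j).
  by rewrite /G sumrB sumr_const card_ord mulr_natl.
pose good (s : {ffun 'I_K -> T}) := [forall i, `|\sum_j G i (s j)| <= K%:R * e].
have -> : \sum_(s : {ffun 'I_K -> T} |
     [forall i, `|\sum_j F i (s j) - K%:R * \sum_t p t * F i t| <= K%:R * e]) prodw s
   = \sum_(s | good s) prodw s.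
  by apply: eq_bigl => s; apply: eq_forallb => i; rewrite GE.
suff : \sum_(s | ~~ good s) prodw s <= 1 / 2.
  by have := sum_prodw1 K; rewrite (bigID good)/=; lra.
have H : \sum_(s | ~~ good s) prodw s <=
    \sum_(s : {ffun 'I_K -> T}) \sum_i prodw s * (\sum_j G i (s j)) ^+ 2 / (K%:R * e) ^+ 2.
  rewrite [leRHS](bigID good)/= ler_wpDl//.
    apply: sumr_ge0 => s _; apply: sumr_ge0 => i _.
    by apply: divr_ge0; rewrite ?sqr_ge0// mulr_ge0 ?sqr_ge0 ?prodw_ge0.
  apply: ler_sum => s; rewrite negb_forall => /existsP[i].
  rewrite -ltNge => lt; rewrite (bigD1 i)//= ler_wpDr//.
    apply: sumr_ge0 => l _.
    by apply: divr_ge0; rewrite ?sqr_ge0// mulr_ge0 ?sqr_ge0 ?prodw_ge0.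
  rewrite -mulrA ler_peMr ?prodw_ge0// ler_pdivlMr ?exprn_gt0// mul1r.
  rewrite -[leRHS]real_normK ?num_real// ler_sqr ?nnegrE ?normr_ge0 ?(ltW Ke)//.
  exact: ltW.
apply: (le_trans H); rewrite exchange_big/=.
under eq_bigr do rewrite -mulr_suml sum_prodw_sqr//.
rewrite -mulr_suml -mulr_sumr -/V.
have : 2 * V / e ^+ 2 < K%:R.
  have := truncnS_gt (2 * V / e ^+ 2); move=> /lt_le_trans; apply.
  by rewrite ler_nat.
rewrite ltr_pdivrMr ?exprn_gt0// => VK.
rewrite ler_pdivrMr ?exprn_gt0// exprMn expr2.
have : K%:R * (2 * V) < K%:R * (K%:R * e ^+ 2) by rewrite ltr_pM2l.
by lra.
Qed.

Lemma prodw_expR K (s : {ffun 'I_K -> T}) : (forall j, 0 < p (s j)) ->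
  prodw s = expR (- \sum_j - ln (p (s j))).
Proof.
by move=> ps; rewrite sumrN opprK expR_sum; apply: eq_bigr => j _; rewrite lnK ?posrE.
Qed.

End weak_law.

(** * Typical sequences *)

Section typical.
Context {R : realType} (T Th I : finType) (p : T -> R) (th : T -> Th) (F : I -> T -> R).
Hypotheses (p0 : forall t, 0 <= p t) (p1 : \sum_t p t = 1).

(** The weak law is applied also to [- ln p] and to [- ln] of the law of [th], whose means are the
    two entropies H and H'. Typical sequences have probability at most exp(-K(H - e)) and total mass
    at least 1/2, so they are many; their images have probability at least exp(-K(H' + e)) each, so
    they are few. *)
Lemma typical_sequences (e : R) : 0 < e -> exists K0, forall K, (K0 <= K)%N -> (0 < K)%N ->
  exists S : {set {ffun 'I_K -> T}},
  [/\ forall s, s \in S -> forall j, 0 < p (s j),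
      forall s, s \in S -> forall i,
        `|\sum_j F i (s j) - K%:R * \sum_t p t * F i t| <= K%:R * e,
      expR (K%:R * (fent p - e)) / 2 <= #|S|%:R &
      #|[set [ffun j => th (s j)] | s : {ffun 'I_K -> T} in S]|%:R
        <= expR (K%:R * (fent (marg th p) + e))].
Proof.
move=> e0; pose pth := marg th p.
pose F' (i : option (option I)) t := match i with
  | None => - ln (p t) | Some None => - ln (pth (th t)) | Some (Some i) => F i t end.
have [K0 K0P] := weak_law p0 p1 F' e0.
have pth0 x : 0 <= pth x by exact: marg_ge0.
exists K0 => K KK0 Kp; have := K0P K KK0 Kp.
set good := (X in \sum_(s | X s) _) => good12.
(* Null sequences carry no mass and are dropped: on them [ln] would return its default value. *)
pose S := [set s | good s & 0 < prodw p s].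
have Sp s : s \in S -> forall j, 0 < p (s j).
  rewrite inE => /andP[_ s0] j; rewrite lt_neqAle p0 andbT.
  apply/eqP => pj; move: s0; rewrite /prodw (bigD1 j)//= -pj mul0r ltxx //.
have Sg s : s \in S -> forall i,
    `|\sum_j F' i (s j) - K%:R * \sum_t p t * F' i t| <= K%:R * e.
  by rewrite inE => /andP[/forallP].
have mF0 : \sum_t p t * F' None t = fent p.
  by rewrite /fent; apply: eq_bigr => t _; rewrite /= /nlnx mulrN.
have mF1 : \sum_t p t * F' (Some None) t = fent pth.
  rewrite -(sum_marg th p (fun x => - ln (pth x))).
  by apply: eq_bigr => t _; rewrite /= /nlnx mulrN.
exists S; split => //.
- by move=> s sS i; apply: (Sg s sS (Some (Some i))).
- have: \sum_(s in S) prodw p s <= \sum_(s in S) expR (- (K%:R * (fent p - e))).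
    apply: ler_sum => s sS; rewrite prodw_expR ?ler_expR ?lerN2; last exact: Sp.
    have := Sg s sS None; rewrite mF0 ler_norml/= => /andP[+ _]; lra.
  have -> : \sum_(s in S) prodw p s = \sum_(s | good s) prodw p s.
    rewrite [RHS](bigID (fun s => 0 < prodw p s))/= [X in _ + X]big1 ?addr0.
      by apply: eq_bigl => s; rewrite inE.
    by move=> s /andP[_]; rewrite -leNgt => ps; apply/eqP; rewrite eq_le ps prodw_ge0.
  rewrite sumr_const -[X in _ <= X -> _]mulr_natl expRN => /(le_trans good12).
  by rewrite ler_pdivlMr ?expR_gt0//; lra.
- pose E := [set [ffun j => th (s j)] | s : {ffun 'I_K -> T} in S].
  have : \sum_(u in E) expR (- (K%:R * (fent pth + e))) <= \sum_(u in E) prodw pth u.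
    apply: ler_sum => _ /imsetP[s sS ->].
    rewrite prodw_expR; last first.
      by move=> j; rewrite ffunE (lt_le_trans (Sp s sS j))// le_marg.
    rewrite ler_expR lerN2; under eq_bigr do rewrite ffunE.
    have := Sg s sS (Some None); rewrite mF1 ler_norml/= => /andP[_]; lra.
  have : \sum_(u in E) prodw pth u <= 1.
    have pth1 : \sum_t pth t = 1 by rewrite marg_sum1.
    rewrite -(sum_prodw1 pth1 K) [leRHS](bigID (mem E))/= lerDl sumr_ge0// => u _.
    exact: prodw_ge0.
  move=> E1 /le_trans/(_ E1); rewrite sumr_const -[X in X <= _ -> _]mulr_natl expRN.
  by rewrite ler_pdivrMr ?expR_gt0// mul1r.
Qed.

End typical.

(** * Subadditive sequences *)

Section fekete.
Context {R : realType} (a : nat -> R).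
Hypotheses (a0 : forall n, 0 <= a n) (aD : forall m n, a (m + n)%N <= a m + a n).

Let aM m k r : a (k * m + r)%N <= k%:R * a m + a r.
Proof.
elim: k => [|k IH]; first by rewrite mul0n add0n mul0r add0r.
by rewrite mulSn -addnA (le_trans (aD _ _))// -natr1 mulrDl mul1r; lra.
Qed.

(** The limit is the infimum of the averages, whence the second part. Averages start at index 1, as
    in [hpart]. *)
Lemma fekete : exists2 l : R, a n.+1 / n.+1%:R @[n --> \oo] --> l &
  forall n, (0 < n)%N -> l * n%:R <= a n.
Proof.
pose A := [set a n.+1 / n.+1%:R | n in [set: nat]].
have Alb : has_inf A.
  split; first by exists (a 1 / 1), 0%N.
  by exists 0 => _ [n _ <-]; rewrite divr_ge0.
have lP n : inf A <= a n.+1 / n.+1%:R by apply: ge_inf; [exact: Alb.2|exists n].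
exists (inf A); last first.
  by move=> [//|n] _; rewrite -ler_pdivlMr ?ltr0n.
apply/cvgrPdist_le => e e0.
have [_ [m _ <-] lm] := inf_adherent (divr_gt0 e0 (@ltr0n R 2)) Alb.
(* Remainders of the division by [m.+1] contribute at most [B], whatever the quotient. *)
pose B := \sum_(r < m.+1) a r.
have B0 : 0 <= B by apply: sumr_ge0.
have BP r : (r < m.+1)%N -> a r <= B.
  by move=> rm; rewrite /B (bigD1 (Ordinal rm))//= lerDl sumr_ge0.
exists (Num.truncn (B / (e / 2))).+1 => // n /= nB.
have nB' : B / (e / 2) <= n.+1%:R.
  by rewrite ltW// (lt_trans (truncnS_gt _))// ltr_nat ltnS.
have n0 : 0 < n.+1%:R :> R by rewrite ltr0n.
rewrite distrC ger0_norm ?subr_ge0// lerBlDl ler_pdivrMr//.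
rewrite (divn_eq n.+1 m.+1).
set k := (n.+1 %/ m.+1)%N; set r := (n.+1 %% m.+1)%N.
have nkr : n.+1%:R = k%:R * m.+1%:R + r%:R :> R.
  by rewrite -natrM -natrD -divn_eq.
rewrite (le_trans (aM _ _ _))// -divn_eq.
have ar : a r <= B by rewrite BP// ltn_mod.
have m0 : 0 < m.+1%:R :> R by rewrite ltr0n.
rewrite ler_pdivrMr in nB'; last by rewrite divr_gt0.
have h1 : k%:R * a m.+1 <= (inf A + e / 2) * (k%:R * m.+1%:R).
  rewrite mulrCA ler_wpM2l// -ler_pdivrMr//; exact: ltW.
have l0 : 0 <= inf A by apply: lb_le_inf; [exact: Alb.1|move=> _ [i _ <-]; rewrite divr_ge0].
have : (inf A + e / 2) * (k%:R * m.+1%:R) <= (inf A + e / 2) * n.+1%:R.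
  by rewrite ler_wpM2l// ?nkr ?lerDl//; lra.
by lra.
Qed.

End fekete.

(** * Finite measurable partitions as label maps *)

Section labels.
Context {R : realType} d {T : measurableType d}.
Implicit Types (P : probability T R) (I J : finType).

(* Finite measurable partitions are represented by their label maps [l : T -> I];
   the atoms are the fibres, some of which may be empty. *)
Definition mlabel I (l : T -> I) := forall i, measurable (l @^-1` [set i]).

Definition law P I (l : T -> I) (i : I) : R := fine (P (l @^-1` [set i])).

Definition ent P I (l : T -> I) : R := fent (law P l).

Lemma law_ge0 P I (l : T -> I) i : 0 <= law P l i.
Proof. by rewrite fine_ge0. Qed.

Lemma mlabel_set I (l : T -> I) (Q : pred I) : mlabel l -> measurable [set x | Q (l x)].
Proof.
move=> ml; rewrite (_ : mkset _ = \bigcup_(i in [set i | Q i]) l @^-1` [set i]).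
  by apply: fin_bigcup_measurable => //; exact: finite_finset.
apply/seteqP; split=> [x Qx|x [i Qi /= ->]//]; by exists (l x).
Qed.

Lemma law_set P I (l : T -> I) (Q : pred I) : mlabel l ->
  fine (P [set x | Q (l x)]) = \sum_(i | Q i) law P l i.
Proof.
move=> ml; rewrite (_ : mkset _ = \bigcup_(i in [set` Q]) l @^-1` [set i]); last first.
  by apply/seteqP; split=> [x Qx|x [i Qi /= ->]//]; exists (l x).
rewrite measure_fin_bigcup//; last first.
  by apply/trivIsetP => i j _ _ ij; apply/seteqP; split => // x [/= xi xj]; move: ij; rewrite -xi -xj eqxx.
have := @bigfs _ _ +%E _ (index_enum I) Q (fun i => P (l @^-1` [set i])).
rewrite index_enum_uniq => /(_ isT) <- => [|i _]; last by rewrite mem_index_enum.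
by rewrite /law sum_fine// => i _; exact: fin_num_measure.
Qed.

Lemma law_sum1 P I (l : T -> I) : mlabel l -> \sum_i law P l i = 1.
Proof.
move=> ml; rewrite -(law_set P xpredT ml) (_ : mkset _ = setT) ?probability_setT//.
by apply/seteqP.
Qed.

Lemma mlabel_comp I J (l : T -> I) (pi : I -> J) : mlabel l -> mlabel (pi \o l).
Proof.
move=> ml j; have := mlabel_set (fun i => pi i == j) ml.
by congr measurable; apply/seteqP; split => x /= /eqP.
Qed.

Lemma law_comp P I J (l : T -> I) (pi : I -> J) : mlabel l ->
  law P (pi \o l) = marg pi (law P l).
Proof.
move=> ml; apply/funext => j; rewrite /marg -(law_set P (fun i => pi i == j) ml).
by congr (fine (P _)); apply/seteqP; split => x /= /eqP.
Qed.

Lemma mlabel_pair I J (l : T -> I) (l' : T -> J) : mlabel l -> mlabel l' ->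
  mlabel (fun x => (l x, l' x)).
Proof.
move=> ml ml' [i j]; rewrite (_ : _ @^-1` _ = l @^-1` [set i] `&` l' @^-1` [set j]).
  exact: measurableI.
by apply/seteqP; split => x /= [-> ->].
Qed.

Lemma mlabel_ffun I J (l : I -> T -> J) : (forall i, mlabel (l i)) ->
  mlabel (fun x => [ffun i => l i x]).
Proof.
move=> ml w.
rewrite (_ : _ @^-1` _ = \bigcap_(i in [set: I]) l i @^-1` [set w i]).
  by apply: fin_bigcap_measurable => // i _; exact: ml.
apply/seteqP; split => [x /= <- i _ /=|x xw /=]; first by rewrite ffunE.
by apply/ffunP => i; rewrite ffunE; exact: xw.
Qed.

Let factor I J (l : T -> I) (l' : T -> J) :
  (forall x y, l' x = l' y -> l x = l y) -> exists pi, l = pi \o l'.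
Proof.
move=> h; have /choice[pi piP] : forall j, exists i, forall x, l' x = j -> l x = i.
  move=> j; have [[x xj]|nj] := pselect (exists x, l' x = j).
    by exists (l x) => y yj; apply: h; rewrite yj.
  by exists (l point) => x xj; case: nj; exists x.
by exists pi; apply/funext => x /=; exact: piP.
Qed.

Lemma mlabel_factor I J (l : T -> I) (l' : T -> J) : mlabel l' ->
  (forall x y, l' x = l' y -> l x = l y) -> mlabel l.
Proof. by move=> ml /factor[pi ->]; exact: mlabel_comp. Qed.

(** Stating the dependence pointwise avoids exhibiting the map between the label sets, which
    [factor] extends arbitrarily off the range of [l']. *)
Lemma ent_factor P I J (l : T -> I) (l' : T -> J) : mlabel l' ->
  (forall x y, l' x = l' y -> l x = l y) -> ent P l <= ent P l'.
Proof.
move=> ml /factor[pi ->]; rewrite /ent law_comp//.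
by apply: fent_marg; exact: law_ge0.
Qed.

Lemma ent_pair P I J (l : T -> I) (l' : T -> J) : mlabel l -> mlabel l' ->
  ent P (fun x => (l x, l' x)) <= ent P l + ent P l'.
Proof.
move=> ml ml'; have mll := mlabel_pair ml ml'; rewrite /ent.
have := fent_pair (law_ge0 P _) (law_sum1 P mll).
by rewrite -!law_comp.
Qed.

Lemma ent_ge0 P I (l : T -> I) : mlabel l -> 0 <= ent P l.
Proof. by move=> ml; apply: fent_ge0 => [i|]; [exact: law_ge0|exact: law_sum1]. Qed.

Lemma ent_le_card P I (l : T -> I) : mlabel l -> ent P l <= ln #|I|%:R.
Proof. by move=> ml; apply: fent_le_card => [i|]; [exact: law_ge0|exact: law_sum1]. Qed.

End labels.

(** * Words along orbits and Misiurewicz' inequality *)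

Section words.
Context {R : realType} d {T : measurableType d} (f : T -> T).
Hypothesis mf : measurable_fun [set: T] f.
Variables (P : probability T R) (I : finType) (l : T -> I).
Hypothesis ml : mlabel l.

(** The starting time [s] is recorded because Misiurewicz' inequality concerns measures that may
    fail to be invariant, for which words at different times have different laws. *)
Definition word (s n : nat) (x : T) : {ffun 'I_n -> I} :=
  [ffun i : 'I_n => l (iter (s + i)%N f x)].

Let E s n := ent P (word s n).

Lemma measurable_iter n A : measurable A -> measurable (iter n f @^-1` A).
Proof.
move=> mA; elim: n A mA => // n IH A mA.
rewrite (_ : _ @^-1` _ = iter n f @^-1` (f @^-1` A))//.
by apply: IH; rewrite -[_ @^-1` _]setTI; exact: mf.
Qed.

Lemma mlabel_word s n : mlabel (word s n).
Proof. by apply: mlabel_ffun => i j; exact: (measurable_iter _ (ml j)). Qed.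

Lemma ent_word_mono s a b : (a <= b)%N -> E s a <= E s b.
Proof.
move=> ab; apply: ent_factor; first exact: mlabel_word.
move=> x y /ffunP xy; apply/ffunP => i; rewrite !ffunE.
by have := xy (widen_ord ab i); rewrite !ffunE.
Qed.

Lemma ent_wordD s a b : E s (a + b)%N <= E s a + E (s + a)%N b.
Proof.
have := ent_pair P (@mlabel_word s a) (@mlabel_word (s + a)%N b).
apply: le_trans.
apply: ent_factor; first by apply: mlabel_pair; exact: mlabel_word.
move=> x y [/ffunP xy1 /ffunP xy2]; apply/ffunP => i; rewrite !ffunE.
have [ia|ai] := ltnP i a; first by have := xy1 (Ordinal ia); rewrite !ffunE.
have iab : (i - a < b)%N by rewrite ltn_subLR.
by have := xy2 (Ordinal iab); rewrite !ffunE/= -addnA subnKC.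
Qed.

Lemma ent_word_le s n : E s n <= n%:R * ln #|I|%:R.
Proof.
rewrite (le_trans (ent_le_card P (@mlabel_word s n)))// card_ffun card_ord natrX lnXn//.
  by rewrite mulr_natl.
by rewrite ltr0n; apply/card_gt0P; exists (l point).
Qed.

(* Summing [F s <= E s q + F (s + q)] over all starting points s, with
   [F s := E s (n - s)], telescopes: no residue classes modulo q are needed. *)
Lemma misiurewicz q n :
  q%:R * E 0 n <= q%:R ^+ 2 * ln #|I|%:R + \sum_(j < n) E j q.
Proof.
pose F s := if (s < n)%N then E s (n - s) else 0.
have E0 s k : 0 <= E s k by apply: ent_ge0; exact: mlabel_word.
have lnI : 0 <= ln #|I|%:R :> R.
  by rewrite ln_ge0// ler1n; apply/card_gt0P; exists (l point).
have F0 s : 0 <= F s by rewrite /F; case: ifP.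
have FE s : (s < n)%N -> F s <= E s q + F (s + q)%N.
  move=> sn; rewrite /F sn; case: ltnP => [sqn|nsq].
    have -> : (n - s = q + (n - (s + q)))%N by rewrite subnDA subnKC// leq_subRL 1?ltnW.
    exact: ent_wordD.
  by rewrite addr0 ent_word_mono// leq_subLR.
(* Skipping the first [s] letters costs at most [s] times the maximal entropy of one letter. *)
have Fs s : (s < q)%N -> E 0 n <= q%:R * ln #|I|%:R + F s.
  move=> sq; rewrite /F; case: ltnP => [sn|ns].
    rewrite -{1}(subnKC (ltnW sn)) (le_trans (ent_wordD _ _ _))// add0n lerD2r.
    by rewrite (le_trans (ent_word_le _ _))// ler_wpM2r// ler_nat ltnW.
  rewrite addr0 (le_trans (ent_word_le _ _))// ler_wpM2r// ler_nat.
  by rewrite (leq_trans ns)// ltnW.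
have sumF : \sum_(s < q) F s <= \sum_(j < n) E j q.
  have h : \sum_(0 <= s < n) F s <= \sum_(0 <= s < n) E s q + \sum_(0 <= s < n) F (s + q)%N.
    rewrite -big_split/= big_nat [leRHS]big_nat; apply: ler_sum => s /andP[_ sn].
    exact: FE.
  (* The sum over the first n + q indices is cut in two ways: at n, from where [F] is 0, and at q,
     from where the shifted sum appears. *)
  have e1 : \sum_(0 <= s < n + q) F s = \sum_(0 <= s < n) F s.
    rewrite (@big_cat_nat _ _ _ n) ?leq_addr//=.
    by rewrite [X in _ + X]big_nat [X in _ + X]big1 ?addr0// => s /andP[ns _]; rewrite /F ltnNge ns.
  have e2 : \sum_(0 <= s < n + q) F s = \sum_(0 <= s < q) F s + \sum_(0 <= s < n) F (s + q)%N.
    rewrite (@big_cat_nat _ _ _ q) ?leq_addl//=; congr (_ + _).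
    by rewrite -{1}[q]add0n big_addn addnK.
  move: h e1 e2; rewrite -(big_mkord xpredT F) -(big_mkord xpredT (fun j => E j q)).
  move: (bigop _ _ _) => u; lra.
have : \sum_(s < q) E 0 n <= \sum_(s < q) (q%:R * ln #|I|%:R + F s).
  by apply: ler_sum => s _; exact: Fs.
rewrite big_split/= !sumr_const card_ord -[E 0 n *+ q]mulr_natl -[_ * _ *+ q]mulr_natl; lra.
Qed.

Section invariant_law.
Hypothesis invP : forall A, measurable A -> P (f @^-1` A) = P A.

Lemma invariant_iter n A : measurable A -> P (iter n f @^-1` A) = P A.
Proof.
move=> mA; elim: n A mA => // n IH A mA.
rewrite (_ : _ @^-1` _ = iter n f @^-1` (f @^-1` A))// IH ?invP//.
by rewrite -[_ @^-1` _]setTI; exact: mf.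
Qed.

Lemma law_word s n : law P (word s n) = law P (word 0 n).
Proof.
have e : word s n = word 0 n \o iter s f.
  by apply/funext => x; apply/ffunP => i; rewrite !ffunE/= add0n addnC iterD.
by apply/funext => w; rewrite /law -(invariant_iter s (@mlabel_word 0 n w)) e.
Qed.

(** Invariance moves the second block back to time 0, which makes the entropies of words
    subadditive. *)
Lemma ent_rate : exists2 h : R, E 0 n.+1 / n.+1%:R @[n --> \oo] --> h &
  forall n, (0 < n)%N -> h * n%:R <= E 0 n.
Proof.
apply: fekete => [n|m n]; first by apply: ent_ge0; exact: mlabel_word.
rewrite (le_trans (ent_wordD _ _ _))// lerD2l add0n /E /ent law_word//.
Qed.

End invariant_law.
End words.

(** * Integrals of bounded functions as real numbers *)

Section bounded_integral.
Context {R : realType} d {T : measurableType d}.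
Implicit Types (P : probability T R) (g h : T -> R).

(** Such functions are integrable for every probability measure, so [RI] obeys the usual rules on
    them with no finiteness condition. *)
Definition bmeas g := measurable_fun [set: T] g /\ exists B : R, forall x, `|g x| <= B.

Definition RI P g : R := fine (\int[P]_x (g x)%:E)%E.

Lemma bmeas_integrable P g : bmeas g -> P.-integrable [set: T] (EFin \o g).
Proof.
move=> [mg [B gB]]; apply: measurable_bounded_integrable => //.
- by rewrite (le_lt_trans (probability_le1 P measurableT))// ltry.
- exists B; split; first exact: num_real.
by move=> M BM x _; exact: le_trans (gB x) (ltW BM).
Qed.

Lemma bmeas_fin P g : bmeas g -> (\int[P]_x (g x)%:E)%E = (RI P g)%:E.
Proof.
move=> bg; rewrite fineK//; apply: integrable_fin_num => //.
exact: bmeas_integrable.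
Qed.

Lemma bmeas_cst c : bmeas (fun=> c).
Proof. by split; [exact: measurable_cst|exists `|c| => x]. Qed.

Lemma bmeasD g h : bmeas g -> bmeas h -> bmeas (fun x => g x + h x).
Proof.
move=> [mg [B gB]] [mh [C hC]]; split; first exact: measurable_funD.
by exists (B + C) => x; rewrite (le_trans (ler_normD _ _))// lerD.
Qed.

Lemma bmeasZ c g : bmeas g -> bmeas (fun x => c * g x).
Proof.
move=> [mg [B gB]]; split; first by apply: measurable_funM => //; exact: measurable_cst.
by exists (`|c| * B) => x; rewrite normrM ler_wpM2l.
Qed.

Lemma bmeas_sum (I : Type) (r : seq I) (g : I -> T -> R) : (forall i, bmeas (g i)) ->
  bmeas (fun x => \sum_(i <- r) g i x).
Proof.
move=> bg; elim: r => [|i r IH].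
  by under eq_fun do rewrite big_nil; exact: bmeas_cst.
by under eq_fun do rewrite big_cons; exact: bmeasD.
Qed.

Lemma RI_cst P c : RI P (fun=> c) = c.
Proof.
rewrite /RI (integral_cst P measurableT c%:E).
transitivity (fine (c%:E * 1)); last by rewrite mule1.
by congr (fine (_ * _)); exact: probability_setT.
Qed.

Lemma RID P g h : bmeas g -> bmeas h -> RI P (fun x => g x + h x) = RI P g + RI P h.
Proof. by move=> bg bh; apply: RintegralD => //; exact: bmeas_integrable. Qed.

Lemma RIZ P c g : bmeas g -> RI P (fun x => c * g x) = c * RI P g.
Proof. by move=> bg; apply: RintegralZl => //; exact: bmeas_integrable. Qed.

Lemma RI_le P g h : bmeas g -> bmeas h -> (forall x, g x <= h x) -> RI P g <= RI P h.
Proof.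
move=> bg bh gh; rewrite -lee_fin -!bmeas_fin//; apply: le_integral => //.
- exact: bmeas_integrable.
- exact: bmeas_integrable.
- by move=> x _; rewrite lee_fin.
Qed.

Lemma RI_sum P (I : Type) (r : seq I) (g : I -> T -> R) : (forall i, bmeas (g i)) ->
  RI P (fun x => \sum_(i <- r) g i x) = \sum_(i <- r) RI P (g i).
Proof.
move=> bg; elim: r => [|i r IH].
  by under eq_fun do rewrite big_nil; rewrite big_nil RI_cst.
under eq_fun do rewrite big_cons; rewrite RID ?IH ?big_cons//.
exact: bmeas_sum.
Qed.

Lemma RI_dist P g h e : bmeas g -> bmeas h -> (forall x, `|g x - h x| <= e) ->
  `|RI P g - RI P h| <= e.
Proof.
move=> bg bh gh.
have le u v : bmeas u -> bmeas v -> (forall x, `|u x - v x| <= e) -> RI P u <= RI P v + e.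
  move=> bu bv uv; rewrite -[e in _ + e](RI_cst P) -RID//; last exact: bmeas_cst.
  apply: RI_le => //; first by apply: bmeasD => //; exact: bmeas_cst.
  by move=> x; rewrite -lerBlDl (le_trans (ler_norm _)).
have := le _ _ bg bh gh.
have : RI P h <= RI P g + e by apply: le => // x; rewrite distrC.
by rewrite ler_norml; lra.
Qed.

Lemma RI_indic P A : measurable A -> RI P \1_A = fine (P A).
Proof. by move=> mA; rewrite /RI integral_indic// setIT. Qed.

Lemma bmeas_indic A : measurable A -> bmeas (\1_A).
Proof.
move=> mA; split; first exact: measurable_indic.
exists 1 => x; rewrite indicE; case: (_ \in _); by rewrite ?normr0 ?normr1.
Qed.

Lemma label_sum (I : finType) (l : T -> I) (c : I -> R) x :
  c (l x) = \sum_i c i * \1_(l @^-1` [set i]) x.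
Proof.
rewrite (bigD1 (l x))//= indicE mem_set// mulr1 big1 ?addr0// => i il.
by rewrite indicE memNset ?mulr0// => /= lx; move: il; rewrite lx eqxx.
Qed.

Lemma bmeas_label (I : finType) (l : T -> I) (c : I -> R) : mlabel l ->
  bmeas (fun x => c (l x)).
Proof.
move=> ml; under eq_fun do rewrite label_sum.
by apply: bmeas_sum => i; apply: bmeasZ; exact: bmeas_indic.
Qed.

Lemma RI_label P (I : finType) (l : T -> I) (c : I -> R) : mlabel l ->
  RI P (fun x => c (l x)) = \sum_i law P l i * c i.
Proof.
move=> ml; rewrite (eq_fun (label_sum l c)) RI_sum => [|i]; last first.
  by apply: bmeasZ; exact: bmeas_indic.
apply: eq_bigr => i _; rewrite RIZ ?RI_indic//; first by rewrite mulrC.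
exact: bmeas_indic.
Qed.

(** Dominated convergence with bound 1; at each point the sequence is eventually constant, as
    happens for [urys] at a closed set. *)
Lemma RI_cvg_indic P A (v : nat -> T -> R) : measurable A ->
  (forall n, bmeas (v n)) -> (forall n x, 0 <= v n x <= 1) ->
  (forall n x, A x -> v n x = 1) ->
  (forall x, ~ A x -> exists N, forall n, (N <= n)%N -> v n x = 0) ->
  RI P (v n) @[n --> \oo] --> fine (P A).
Proof.
move=> mA bv v01 v1 v0.
have : (\int[P]_x (v n x)%:E)%E @[n --> \oo] --> (\int[P]_x (\1_A x)%:E)%E.
  apply: (@dominated_cvg _ _ _ P _ _ (fun n x => (v n x)%:E) _ (cst 1%E)) => //.
  - by move=> n; apply/measurable_EFinP; exact: (bv n).1.
  - move=> x _; apply: cvg_near_cst; rewrite indicE.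
    have [Ax|nAx] := pselect (A x).
      by apply: nearW => n; rewrite mem_set// v1.
    have [N vN] := v0 _ nAx; exists N => // n /= /vN ->.
    by rewrite memNset.
  - exact: (bmeas_integrable P (bmeas_cst 1)).
  - move=> n x _; rewrite abse_EFin lee_fin ger0_norm; by have /andP[] := v01 n x.
under eq_cvg do rewrite bmeas_fin//.
rewrite bmeas_fin ?RI_indic//; last exact: bmeas_indic.
by move/fine_cvgP => [].
Qed.

Lemma mnormalizeE (nu : {measure set T -> \bar R}) P (c : R) A : nu setT = c%:E -> 0 < c ->
  mnormalize nu P A = (nu A * (c^-1)%:E)%E.
Proof. by rewrite /mnormalize => -> c0; rewrite eqe gt_eqF. Qed.

End bounded_integral.

(** * Continuous functions and distances in a metric space *)

Section metric_borel.
Context {R : realType} {X : pmetricType R}.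
Notation B := (@borel R X).
Notation PM := (probability B R).
Implicit Types (C D : set X) (x y : X).

Lemma open_borel (A : set X) : open A -> measurable (A : set B).
Proof. by move=> oA; exact: sub_sigma_algebra. Qed.

Lemma closed_borel (A : set X) : closed A -> measurable (A : set B).
Proof.
move=> cA; rewrite -[A]setCK; apply: measurableC; apply: open_borel.
exact: closed_openC.
Qed.

Lemma continuous_borel (f : X -> X) : continuous f ->
  measurable_fun [set: B] (f : B -> B).
Proof.
move=> cf; apply: (@measurability _ _ B B setT f (@open X : set (set B)) erefl) => // _ [A oA <-]; rewrite setTI.
by apply: open_borel; move/continuousP: cf; exact.
Qed.

Lemma continuous_mfun (g : X -> R) : continuous g -> measurable_fun [set: B] (g : B -> R).
Proof.
move=> cg; apply: (measurability _ (RGenOpens.measurableE R)) => // _ [A oA <-].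
rewrite setTI; apply: open_borel; move/continuousP: cg => cg; case: oA => x [y ->]; apply: cg; exact: interval_open.

Qed.

Lemma mball_nbhs (x : X) (r : R) : 0 < r -> nbhs x [set y | mdist x y < r].
Proof. by move=> r0; rewrite -ballEmdist; exact: nbhsx_ballx. Qed.

Lemma nbhs_mball (x : X) (A : set X) : nbhs x A ->
  exists2 r : R, 0 < r & forall y, mdist x y < r -> A y.
Proof.
rewrite -nbhs_ballE => -[r /= r0 rA]; exists r => // y xy; apply: rA.
by rewrite ballEmdist.
Qed.

Lemma continuous_dist (g : X -> R) :
  (forall x e, 0 < e -> exists2 r : R, 0 < r &
     forall y, mdist x y < r -> `|g x - g y| <= e) -> continuous g.
Proof.
move=> h x; apply/cvgrPdist_le => e e0; have [r r0 rP] := h x e e0.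
by apply: filterS (mball_nbhs x r0) => y /= /rP.
Qed.

Lemma continuous_distP (g : X -> R) x e : continuous g -> 0 < e ->
  exists2 r : R, 0 < r & forall y, mdist x y < r -> `|g x - g y| <= e.
Proof.
move=> cg e0; have := cg x => /cvgrPdist_le/(_ e e0).
by move=> /nbhs_mball.
Qed.

Lemma unif_continuous_compact (g : X -> R) (e : R) : compact [set: X] ->
  continuous g -> 0 < e ->
  exists2 r : R, 0 < r & forall x y, mdist x y <= r -> `|g x - g y| <= e.
Proof.
move=> /compact_near_coveringP cX cg e0.
(* Compactness as a near covering: each point has a neighbourhood on which all small radii work,
   hence one radius works everywhere. *)
have [] := cX R 0^'+ (fun r x => forall y, mdist x y <= r -> `|g x - g y| <= e) _.
  move=> x _; have e20 : 0 < e / 2 by lra.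
  have [r r0 rP] := continuous_distP x cg e20.
  have r20 : 0 < r / 2 by lra.
  exists ([set y | mdist x y < r / 2], [set d | d < r / 2]) => /=.
    by split; [exact: mball_nbhs|exact: nbhs_right_lt].
  move=> [y d]/= [xy dr] z yz.
  have h1 := rP y; have h2 := rP z.
  have : `|g x - g y| <= e / 2 by apply: h1; lra.
  have : `|g x - g z| <= e / 2.
    by apply: h2; have := metric_triangle x y z; lra.
  by rewrite !ler_norml; lra.
move=> d /= d0 dP; exists (d / 2); first by lra.
move=> x y xy; apply: (dP (d / 2)) => //=; last by lra.
by rewrite sub0r normrN gtr0_norm; lra.
Qed.

Lemma continuous_bounded (g : X -> R) : compact [set: X] -> continuous g ->
  exists M : R, forall x, `|g x| <= M.
Proof.
move=> cX cg.
have := @continuous_compact _ _ g setT (continuous_subspaceT cg) cX.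
move=> /compact_bounded[M [_ MP]]; exists (M + 1) => x.
by apply: (MP (M + 1)); [lra|exists x].
Qed.

Lemma continuous_bmeas (g : X -> R) : compact [set: X] -> continuous g -> bmeas (g : B -> R).
Proof.
by move=> cX cg; split; [exact: continuous_mfun|exact: continuous_bounded].
Qed.

(* Adjoining 1 caps the distance and makes it meaningful for the empty set. *)
Definition cdist (C : set X) (x : X) : R := inf ([set mdist x c | c in C] `|` [set 1]).

Lemma cdist_has_inf C x : has_inf ([set mdist x c | c in C] `|` [set 1 : R]).
Proof.
split; first by exists 1; right.
by exists 0 => _ [[c _ <-]|->]//; exact: mdist_ge0.
Qed.

Lemma cdist_ge0 C x : 0 <= cdist C x.
Proof.
by apply: lb_le_inf => [|_ [[c _ <-]|->]//]; [exists 1; right|exact: mdist_ge0].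
Qed.

Lemma cdist_le C x c : C c -> cdist C x <= mdist x c.
Proof. by move=> Cc; apply: ge_inf; [exact: (cdist_has_inf C x).2|left; exists c]. Qed.

Lemma cdist0 C x : C x -> cdist C x = 0.
Proof.
move=> Cx; apply/eqP; rewrite eq_le cdist_ge0 andbT.
by rewrite (le_trans (cdist_le x Cx))// mdistxx.
Qed.

Lemma cdist_lip C x y : cdist C x <= cdist C y + mdist x y.
Proof.
rewrite -lerBlDr; apply: lb_le_inf => [|_ [[c Cc <-]|->]]; first by exists 1; right.
  rewrite lerBlDr (le_trans (cdist_le x Cc))// addrC; exact: metric_triangle.
rewrite lerBlDr ler_wpDr ?mdist_ge0//; apply: ge_inf; first exact: (cdist_has_inf C x).2.
by right.
Qed.

Lemma cdist_gt0 C x : closed C -> ~ C x -> 0 < cdist C x.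
Proof.
move=> cC nCx; have : nbhs x (~` C) by apply: open_nbhs_nbhs; split => //; exact: closed_openC.
move=> /nbhs_mball[r r0 rP]; apply: (@lt_le_trans _ _ (Num.min r 1)).
  by rewrite lt_min r0 ltr01.
apply: lb_le_inf => [|_ [[c Cc <-]|->]]; first by exists 1; right.
  rewrite ge_min; apply/orP; left; rewrite leNgt; apply/negP => /rP.
  exact.
by rewrite ge_min lexx orbT.
Qed.

Lemma cdist_continuous C : continuous (cdist C).
Proof.
apply: continuous_dist => x e e0; exists e => // y xy.
have := cdist_lip C x y; have := cdist_lip C y x; rewrite (metric_sym y x).
by rewrite ler_norml; lra.
Qed.

(** Continuous functions decreasing to the indicator of a closed [C]; at each point outside it they
    vanish from some rank on. *)
Definition urys (C : set X) (n : nat) (x : X) : R := Num.max 0 (1 - n%:R * cdist C x).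

Lemma urys_continuous C n : continuous (urys C n).
Proof.
move=> x; apply: (@continuous_max _ _ (cst 0) (fun x => 1 - n%:R * cdist C x)).
  exact: cst_continuous.
apply: cvgB; first exact: cvg_cst.
by apply: cvgM; [exact: cvg_cst|exact: cdist_continuous].
Qed.

Lemma urys_ge0 C n x : 0 <= urys C n x. Proof. by rewrite le_max lexx. Qed.

Lemma urys_le1 C n x : urys C n x <= 1.
Proof. by rewrite ge_max ler01/= gerBl mulr_ge0// cdist_ge0. Qed.

Lemma urys1 C n x : C x -> urys C n x = 1.
Proof. by move=> Cx; rewrite /urys cdist0// mulr0 subr0 max_r. Qed.

Lemma urys_mono C m n x : (m <= n)%N -> urys C n x <= urys C m x.
Proof.
move=> mn; rewrite ge_max urys_ge0/= le_max; apply/orP; right.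
by rewrite lerB// ler_wpM2r ?cdist_ge0// ler_nat.
Qed.

Lemma urys0 C x : closed C -> ~ C x -> exists N, forall n, (N <= n)%N -> urys C n x = 0.
Proof.
move=> cC nCx; have c0 := cdist_gt0 cC nCx.
exists (Num.truncn (cdist C x)^-1).+1 => n Nn; apply: max_l.
rewrite subr_le0 -ler_pdivrMr// div1r ltW// (lt_le_trans (truncnS_gt _))//.
by rewrite ler_nat.
Qed.

(** The quotient [g] of distances is continuous, 1 on [C] and 0 on [D]; its uniform continuity with
    tolerance 1/2 provides [r]. The cap in [cdist] takes care of empty sets. *)
Lemma closed_separated (C D : set X) : compact [set: X] -> closed C -> closed D ->
  C `&` D = set0 -> exists2 r : R, 0 < r & forall x y, C x -> D y -> r < mdist x y.
Proof.
move=> cX cC cD CD.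
pose s x := cdist C x + cdist D x.
have s0 x : 0 < s x.
  have := cdist_ge0 C x; have := cdist_ge0 D x.
  have [Cx|nCx] := pselect (C x); last by have := cdist_gt0 cC nCx; rewrite /s; lra.
  have nDx : ~ D x by move=> Dx; have : (C `&` D) x by []; rewrite CD.
  by have := cdist_gt0 cD nDx; rewrite /s; lra.
pose g x := cdist D x / s x.
have cg : continuous g.
  move=> x; apply: cvgM; first exact: cdist_continuous.
  apply: cvgV; first by rewrite gt_eqF.
  by apply: cvgD; exact: cdist_continuous.
have [r r0 rP] := unif_continuous_compact cX cg (divr_gt0 ltr01 (@ltr0n R 2)).
exists r => // x y Cx Dy; rewrite ltNge; apply/negP => /rP.
rewrite /g /s (cdist0 Cx) (cdist0 Dy) add0r addr0 mul0r subr0 divff ?normr1; first by lra.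
have := s0 x; rewrite /s (cdist0 Cx) add0r => h; by rewrite gt_eqF.
Qed.

End metric_borel.

(** * Borel measures: invariance, regularity, the nonwandering set *)

Section borel_measures.
Context {R : realType} {X : pmetricType R}.
Notation B := (@borel R X).
Notation PM := (probability B R).
Implicit Types (C D A : set X) (x y : X) (mu nu : PM) (g : X -> R) (f : X -> X).
Hypothesis cX : compact [set: X].

Lemma continuous_iter f n : continuous f -> continuous (iter n f).
Proof.
move=> cf; elim: n => [|n IH] x; first exact: cvg_id.
by apply: (@continuous_comp _ _ _ (iter n f) f); [exact: IH|exact: cf].
Qed.

Lemma continuous_compf g f : continuous g -> continuous f -> continuous (fun x => g (f x)).
Proof. by move=> cg cf x; apply: (@continuous_comp _ _ _ f g); [exact: cf|exact: cg]. Qed.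

Definition bsum f (g : X -> R) (n : nat) (x : X) : R := \sum_(j < n) g (iter j f x).

Lemma bsum_continuous f g n : continuous f -> continuous g -> continuous (bsum f g n).
Proof.
move=> cf cg; elim: n => [|n IH].
  rewrite (_ : bsum f g 0 = cst 0); first exact: cst_continuous.
  by apply/funext => x; rewrite /bsum big_ord0.
rewrite (_ : bsum f g n.+1 = bsum f g n \+ (fun x => g (iter n f x))); last first.
  by apply/funext => x; rewrite /bsum big_ord_recr.
move=> x; apply: cvgD; first exact: IH.
by apply: continuous_compf => //; exact: continuous_iter.
Qed.

Lemma RI_urys mu C : closed C -> RI mu (urys C n) @[n --> \oo] --> fine (mu C).
Proof.
move=> cC; apply: (RI_cvg_indic (closed_borel cC)) => [n|n x|n x Cx|x nCx].
- exact: (continuous_bmeas cX (@urys_continuous _ _ C n)).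
- by rewrite urys_ge0 urys_le1.
- exact: urys1.
- exact: urys0.
Qed.

Lemma RI_comp_invariant mu f g : continuous f -> continuous g -> Defs.invariant f mu ->
  RI mu (fun x => g (f x)) = RI mu g.
Proof.
move=> cf cg inv; rewrite /RI; congr fine.
have mf := continuous_borel cf.
have bgf := continuous_bmeas cX (continuous_compf cg cf).
have := @integral_pushforward _ _ B B R f mf mu setT (EFin \o g).
rewrite preimage_setT => <- //; last 2 first.
- by apply/measurable_EFinP; exact: continuous_mfun.
- exact: (bmeas_integrable mu bgf).
apply: eq_measure_integral => A mA _.
exact: inv.
Qed.

(** Closed sets are stable under intersection and generate the Borel sets, and their measures are
    limits of integrals of [urys]; hence integrals of continuous functions determine the measure. *)
Lemma invariant_of_RI mu f : continuous f ->
  (forall g, continuous g -> RI mu (fun x => g (f x)) = RI mu g) -> Defs.invariant f mu.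
Proof.
move=> cf h A mA; have mf := continuous_borel cf.
have := @measure_unique _ R B (@closed X) (fun=> setT) _ _ _ _ (pushforward mu (f : B -> B)) mu.
apply => //.
- apply/seteqP; split; apply: smallest_sub.
  + exact: smallest_sigma_algebra.
  + move=> U oU; rewrite -[U]setCK -setTD; apply: (@sigma_algebraCD _ _ _) => //.
    by apply: sub_sigma_algebra; exact: open_closedC.
  + exact: smallest_sigma_algebra.
  + by move=> C cC; exact: closed_borel.
- by move=> C D cC cD; exact: closedI.
- by apply/seteqP; split => // x _; exists 0%N.
- move=> C cC; have := @RI_urys mu C cC => c1.
  have : RI mu (fun x => urys C n (f x)) @[n --> \oo] --> fine (mu (f @^-1` C)).
    apply: RI_cvg_indic => [|n|n x|n x Cx|x nCx].
    + by rewrite -[_ @^-1` _]setTI; apply: mf => //; exact: closed_borel.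
    + by apply: continuous_bmeas => //; apply: continuous_compf => //; exact: urys_continuous.
    + by rewrite urys_ge0 urys_le1.
    + exact: urys1.
    + exact: urys0.
  have -> : (fun n => RI mu (fun x => urys C n (f x))) = (fun n => RI mu (urys C n)).
    by apply/funext => n; apply: h; exact: urys_continuous.
  move=> c2; have e : fine (mu (f @^-1` C)) = fine (mu C).
    by rewrite -(cvg_lim (@Rhausdorff R) c1) -(cvg_lim (@Rhausdorff R) c2).
  have mC := closed_borel cC.
  have mfC : measurable (f @^-1` C : set B) by rewrite -[_ @^-1` _]setTI; exact: mf.
  rewrite /pushforward/=.
  by rewrite -(fineK (fin_num_measure mu _ mC)) -e fineK ?fin_num_measure.
- move=> _; rewrite /= /pushforward preimage_setT.
  by rewrite (le_lt_trans (probability_le1 mu measurableT))// ltry.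
Qed.


Lemma measure_cap_lt mu (F : nat -> set B) (c : \bar R) :
  (forall n, measurable (F n)) -> (forall m n, (m <= n)%N -> F n `<=` F m) ->
  (mu (\bigcap_n F n) < c)%E -> exists n, (mu (F n) < c)%E.
Proof.
move=> mF dF lt.
have : mu \o F @ \oo --> mu (\bigcap_n F n).
  apply: nonincreasing_cvg_mu => //.
  - by rewrite (le_lt_trans (probability_le1 mu (mF 0%N)))// ltry.
  - exact: bigcapT_measurable.
  - by move=> m n mn; apply/subsetPset; exact: dF.
move=> /(_ [set y | (y < c)%E]) []; last by move=> N _ /(_ N (leqnn N)) h; exists N.
by apply: open_nbhs_nbhs; split => //; exact: open_ereal_lt_ereal.
Qed.

Lemma open_inner_closed mu A (e : R) : open A -> 0 < e ->
  exists C, [/\ closed C, C `<=` A & (mu (A `\` C) <= e%:E)%E].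
Proof.
move=> oA e0; have cA := open_closedC oA.
pose C n := [set x | n.+1%:R^-1 <= cdist (~` A) x].
have cC n : closed (C n).
  apply: (preimage_closed (f := cdist (~` A)) (D := [set r | n.+1%:R^-1 <= r])).
    by move=> x _; exact: cdist_continuous.
  exact: closed_ge.
have [|||n ltn] := @measure_cap_lt mu (fun n => A `\` C n) e%:E.
- by move=> n; apply: measurableD; [exact: open_borel|exact: closed_borel].
- move=> m n mn x [Ax nC]; split => // Cm; apply: nC; apply: le_trans Cm.
  by rewrite lef_pV2 ?posrE// ler_nat ltnS.
- rewrite (_ : \bigcap_n _ = set0) ?measure0//; apply/seteqP; split => // x h.
  have [Ax _] := h 0%N I.
  have d0 : 0 < cdist (~` A) x by apply: cdist_gt0 => //; exact.
  have [_] := h (Num.truncn (cdist (~` A) x)^-1) I; apply; rewrite /C/=.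
  by rewrite invf_ple ?posrE// ltW// truncnS_gt.
- exists (C n); split => // [x Cx|]; last exact: ltW.
  apply: contrapT => nAx; move: Cx; rewrite /C/= cdist0// => h.
  by have := @invr_gt0 R n.+1%:R; rewrite ltr0n ltNge h.
Qed.

(** The sets with this property form a sigma-algebra containing the open sets. For a countable union
    the inner closed sets are cut to a finite union, since an infinite one need not be closed. *)
Lemma borel_regular mu (A : set B) : measurable A -> forall e : R, 0 < e ->
  exists (C U : set X), [/\ closed C, open U, C `<=` A, A `<=` U & (mu (U `\` C) <= e%:E)%E].
Proof.
pose G := [set A : set B | measurable A /\ forall e : R, 0 < e -> exists (C U : set X),
  [/\ closed C, open U, C `<=` A, A `<=` U & (mu (U `\` C) <= e%:E)%E]].
suff : measurable `<=` G by move=> h /h[].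
apply: smallest_sub; last first.
  move=> U oU; split; first exact: open_borel.
  move=> e e0; have [C [cC CU le]] := open_inner_closed mu oU e0.
  by exists C, U; split.
split.
- split => // e e0; exists set0, set0; split => //; [exact: closed0|exact: open0|].
  by rewrite setD0 measure0 lee_fin ltW.
- move=> A' [mA hA]; split; first by rewrite setTD; exact: measurableC.
  move=> e e0; have [C [U [cC oU CA AU le]]] := hA e e0.
  exists (~` U), (~` C); split; [exact: open_closedC|exact: closed_openC| | |].
  + by move=> x nUx; split => // /AU.
  + by move=> x [_ nA] /CA.
  + by rewrite setDE setCK setIC -setDE.
move=> F FG; split; first by apply: bigcupT_measurable => n; exact: (FG n).1.
move=> e e0.
have /choice[CU CUP] n : exists CU : set X * set X,
   [/\ closed CU.1, open CU.2, CU.1 `<=` F n, F n `<=` CU.2 &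
     (mu (CU.2 `\` CU.1) <= (e / 2 / (2 ^ n.+1)%:R)%:E)%E].
  have [|C [U h]] := (FG n).2 (e / 2 / (2 ^ n.+1)%:R); last by exists (C, U).
  by rewrite !divr_gt0// ltr0n expn_gt0.
pose V := \bigcup_n (CU n).2.
have mC n : measurable ((CU n).1 : set B) by apply: closed_borel; have [] := CUP n.
have mU n : measurable ((CU n).2 : set B) by apply: open_borel; have [] := CUP n.
have mV : measurable (V : set B) by exact: bigcupT_measurable.
pose W N : set B := V `\` \bigcup_(i in `I_N) (CU i).1.
have [|||N ltN] := @measure_cap_lt mu W e%:E.
- by move=> N; apply: measurableD => //; exact: fin_bigcup_measurable.
- move=> m n mn x [Vx nx]; split => // -[i/= im Cx]; apply: nx; exists i => //=.
  exact: leq_trans mn.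
- apply: (@le_lt_trans _ _ (e / 2)%:E); last by rewrite lte_fin; lra.
  apply: (le_trans _ (epsilon_trick0 xpredT _)); last by lra.
  apply: (@le_trans _ _ (\big[+%E/0%R]_(0 <= i <oo) mu ((CU i).2 `\` (CU i).1))%E).
    apply: measure_sigma_subadditive.
    + by move=> n; exact: measurableD.
    + apply: bigcapT_measurable => N; apply: measurableD => //.
      exact: fin_bigcup_measurable.
    + move=> x h; have [[n _ Ux] _] := h 0%N I; exists n => //; split => // Cx.
      have [_] := h n.+1 I; apply; exists n => //=.
  by apply: lee_nneseries => // n _; have [] := CUP n.
- exists (\bigcup_(i in `I_N) (CU i).1), V; split.
  + by apply: closed_bigcup => // i _; have [] := CUP i.
  + by apply: bigcup_open => i _; have [] := CUP i.
  + by move=> x [i _ Cx]; exists i => //; have [_ _ h _ _] := CUP i; exact: h.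
  + by move=> x [i _ Fx]; exists i => //; have [_ _ _ h _] := CUP i; exact: h.
  + exact: ltW.
Qed.

Lemma integ_RI mu g : continuous g -> integ mu g = (RI mu g)%:E.
Proof. by move=> cg; apply: bmeas_fin; exact: continuous_bmeas. Qed.

Lemma weak_nbhs_RI mu (U : set PM) : weak_nbhs mu U ->
  exists (k : nat) (g : 'I_k -> X -> R) (e : R), [/\ 0 < e, forall i, continuous (g i) &
    forall nu, (forall i, `|RI nu (g i) - RI mu (g i)| < e) -> U nu].
Proof.
move=> [k [g [e [e0 cg h]]]]; exists k, g, e; split => // nu nuP; apply: h => i.
by rewrite !integ_RI// -EFinB abse_EFin lte_fin.
Qed.

Lemma RI_weak_nbhs mu (U : set PM) k (g : 'I_k -> X -> R) (e : R) : 0 < e ->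
  (forall i, continuous (g i)) ->
  (forall nu, (forall i, `|RI nu (g i) - RI mu (g i)| < e) -> U nu) -> weak_nbhs mu U.
Proof.
move=> e0 cg h; exists k, g, e; split => // nu nuP; apply: h => i.
by have := nuP i; rewrite !integ_RI// -EFinB abse_EFin lte_fin.
Qed.

Lemma RI_empirical f g n x : continuous g -> (0 < n)%N ->
  RI (empirical f n x) g = n%:R^-1 * bsum f g n x.
Proof.
move=> cg n0; have [M MP] := continuous_bounded cX cg.
have n0' : 0 < n%:R :> R by rewrite ltr0n.
have bg : bmeas (g : B -> R) by exact: continuous_bmeas.
(* The rules for integrals against sums of measures ask for a nonnegative function, so [g] is
   shifted by its bound. *)
pose h y := g y + M.
have h0 y : 0 <= h y by have := MP y; rewrite ler_norml /h; lra.
have bh : bmeas (h : B -> R) by apply: bmeasD => //; exact: bmeas_cst.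
have mh : measurable_fun [set: B] (EFin \o (h : B -> R)).
  by apply/measurable_EFinP; exact: bh.1.
suff hE : RI (empirical f n x) h = n%:R^-1 * bsum f h n x.
  move: hE; rewrite RID//; last exact: bmeas_cst.
  rewrite RI_cst /bsum /h big_split/= sumr_const card_ord mulrDr -[M *+ n]mulr_natl.
  by rewrite mulKf ?gt_eqF// => /addIr.
have k0 : 0 <= n%:R^-1 :> R by rewrite invr_ge0 ltW.
have E : (\int[empirical f n x]_y (h y)%:E = \int[mscale (NngNum k0) (msum (fun j => @dirac _ B (iter j f x) R) n)]_y (h y)%:E)%E.
  apply: eq_measure_integral => A mA _.
  have sT : msum (fun j => @dirac _ B (iter j f x) R) n [set: B] = n%:R%:E.
    rewrite /= /msum (eq_bigr (fun=> 1%E)) => [|i _]; last exact: diracT.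
    by rewrite sumEFin sumr_const card_ord.
  by rewrite [RHS]muleC; exact: (mnormalizeE _ _ sT n0').
rewrite /RI E ge0_integral_mscale//; last by move=> y _; rewrite lee_fin.
rewrite ge0_integral_measure_sum//; last by move=> y _; rewrite lee_fin.
rewrite (eq_bigr (fun j : 'I_n => (h (iter j f x))%:E)) => [|j _].
  by rewrite sumEFin.
rewrite integral_dirac//= -[RHS]mul1e; congr (_ * _)%E; exact: diracT.
Qed.

Lemma open_empirical f n (G : set PM) : continuous f -> (0 < n)%N -> weak_open G ->
  open [set x | G (empirical f n x)].
Proof.
move=> cf n0 oG; rewrite openE => x Gx.
have [k [g [e [e0 cg gP]]]] := weak_nbhs_RI (oG _ Gx).
have : \forall y \near x, forall i,
    `|n%:R^-1 * bsum f (g i) n x - n%:R^-1 * bsum f (g i) n y| < e.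
  apply: filter_forall => i.
  have c : continuous (fun x => n%:R^-1 * bsum f (g i) n x).
    by move=> y; apply: cvgM; [exact: cvg_cst|exact: bsum_continuous].
  by have := c x => /cvgrPdist_lt/(_ e e0).
by apply: filterS => y yP /=; apply: gP => i; rewrite !RI_empirical// distrC.
Qed.

Lemma closed_empirical f n (F : set PM) : continuous f -> (0 < n)%N -> weak_closed F ->
  closed [set x | F (empirical f n x)].
Proof.
move=> cf n0 cF; have := open_closedC (open_empirical cf n0 cF).
by congr closed; apply/seteqP; split => x /=; [exact: contrapT|move=> ? ?].
Qed.

Lemma RI_bsum mu f g n : continuous f -> continuous g -> Defs.invariant f mu ->
  RI mu (bsum f g n) = n%:R * RI mu g.
Proof.
move=> cf cg inv.
rewrite /bsum (RI_sum mu (index_enum 'I_n) (g := fun j x => g (iter j f x))).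
  rewrite (eq_bigr (fun=> RI mu g)) => [|j _].
    by rewrite sumr_const card_ord mulr_natl.
  elim: (nat_of_ord j) => // i IH; rewrite -[RHS]IH.
  rewrite -(@RI_comp_invariant mu f (fun x => g (iter i f x)))//.
    by congr RI; apply/funext => x; rewrite iterSr.
  by apply: continuous_compf => //; exact: continuous_iter.
by move=> i; apply: continuous_bmeas => //; apply: continuous_compf => //; exact: continuous_iter.
Qed.

Lemma nonwandering_closed f : closed (nonwandering f).
Proof.
rewrite -[nonwandering f]setCK; apply: open_closedC; rewrite openE => x /= nx.
move/existsNP: nx => [U /not_implyP[xU nU]].
by apply: filterS (nbhs_interior xU) => y /= yU /(_ U yU) /nU.
Qed.

(** The preimages of [V] are pairwise disjoint and of equal measure, so a positive value would make
    their union exceed mass 1. *)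
Lemma wandering_null mu f (V : set X) : continuous f -> Defs.invariant f mu -> open V ->
  (forall n, (0 < n)%N -> V `&` (iter n f @^-1` V) = set0) -> mu V = 0%E.
Proof.
move=> cf inv oV wV; have mf := continuous_borel cf; have mV := open_borel oV.
pose F n : set B := iter n f @^-1` V.
have mF n : measurable (F n) by exact: (measurable_iter mf).
have muF n : mu (F n) = mu V by exact: (invariant_iter mf inv).
have dF m n x : (m < n)%N -> F m x -> F n x -> False.
  move=> mn Fm Fn; have : (V `&` (iter (n - m) f @^-1` V)) (iter m f x).
    by split => //=; rewrite -iterD subnK// ltnW.
  by rewrite wV ?subn_gt0.
have tF : trivIset setT F.
  apply/trivIsetP => i j _ _; rewrite neq_ltn => ij; apply/seteqP; split => // x [Fi Fj].
  by case/orP: ij => ij; [exact: (dF i j x)|exact: (dF j i x)].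
have le1 : (mu (\bigcup_n F n) <= 1)%E.
  by apply: probability_le1; exact: bigcupT_measurable.
have vfin : mu V = (fine (mu V))%:E by rewrite fineK// fin_num_measure.
rewrite vfin; congr EFin; apply/eqP; rewrite eq_le fine_ge0// andbT leNgt.
apply/negP => v0; set v := fine (mu V) in v0 vfin.
have {}le1 : (\big[+%E/0]_(0 <= i <oo | i \in [set: nat]) v%:E <= 1)%E.
  apply: le_trans le1; rewrite measure_bigcup//.
  apply: lee_nneseries => [i _|i _]; first by rewrite lee_fin ltW.
  by rewrite le_eqVlt; apply/orP; left; apply/eqP; rewrite -vfin; exact/esym/muF.
have := le_trans (nneseries_lim_ge (Num.truncn v^-1).+1 _) le1.
rewrite (eq_bigl xpredT) => [|i]; last by rewrite in_setT.
rewrite sumEFin big_const_nat subn0 iter_addr addr0.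
move=> /(_ (fun _ _ _ => ltW v0)); rewrite lee_fin -[v *+ _]mulr_natl -ler_pdivlMr// div1r.
by rewrite leNgt truncnS_gt.
Qed.

(** Specification only concerns points of the pieces, which make up the nonwandering set. Its
    complement is covered by null wandering sets, and a compact inner approximation reduces the
    cover to a finite one. *)
Lemma nonwandering_full mu f : continuous f -> Defs.invariant f mu ->
  mu (~` nonwandering f) = 0%E.
Proof.
move=> cf inv; set W := ~` nonwandering f.
have oW : open W by apply: closed_openC; exact: nonwandering_closed.
have /choice[V VP] x : exists V : set X, W x -> [/\ open V, V x & mu V = 0%E].
  have [Wx|] := pselect (W x); last by exists setT.
  move/existsNP: Wx => [U /not_implyP[xU nU]]; exists (interior U) => _.
  split; [exact: open_interior|exact: xU|].
  apply: (wandering_null cf inv); first exact: open_interior.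
  move=> n n0; apply/seteqP; split => // y [Uy Uny]; apply: nU; exists n; split => //.
  by exists y; split; [exact: (interior_subset Uy)|exact: (interior_subset Uny)].
apply/eqP; rewrite eq_le measure_ge0 andbT; apply/lee_addgt0Pr => e e0; rewrite add0e.
have [C [cC CW le]] := open_inner_closed mu oW e0.
suff C0 : mu C = 0%E.
  have mC := closed_borel cC; have mW := open_borel oW.
  have h : (mu (C `|` (W `\` C)) <= mu C + mu (W `\` C))%E.
    by apply: measureU2 => //; exact: measurableD.
  by rewrite -(setDUK CW) (le_trans h)// C0 add0e.
have : compact C by exact: (subclosed_compact cC cX).
rewrite compact_cover => /(_ X W V)[i /VP[]//|x Cx|D DW CD].
  by exists x; [exact: CW|have [] := VP x (CW x Cx)].
apply/eqP; rewrite eq_le measure_ge0 andbT.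
have CD' : C `<=` \bigcup_(i in _) V i := CD.
apply: (le_trans (@content_sub_fsum _ _ _ mu _ _ C V _ _ _ CD')) => //.
- by move=> i /DW; rewrite inE => /VP[oV _ _]; exact: open_borel.
- exact: closed_borel.
- by rewrite fsbig1// => i /DW; rewrite inE => /VP[_ _ V0]; exact: V0.
Qed.
End borel_measures.

(** * Riesz representation *)

Section riesz.
Context {R : realType} {X : pmetricType R}.
Notation B := (@borel R X).
Notation PM := (probability B R).
Implicit Types (C D A : set X) (x y : X) (g h : X -> R).
Hypothesis cX : compact [set: X].

Record pos_functional (L : (X -> R) -> R) : Prop := PosFunctional {
  pfD : forall g h, continuous g -> continuous h ->
    L (fun x => g x + h x) = L g + L h ;
  pfZ : forall c g, continuous g -> L (fun x => c * g x) = c * L g ;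
  pf_ge0 : forall g, continuous g -> (forall x, 0 <= g x) -> 0 <= L g ;
  pf1 : L (fun=> 1) = 1 }.

Variable L : (X -> R) -> R.
Hypothesis pfL : pos_functional L.

Let LB g h : continuous g -> continuous h -> L (fun x => g x - h x) = L g - L h.
Proof.
move=> cg ch; rewrite -[- L h]mulN1r -(pfZ pfL)// -(pfD pfL)//.
  by congr L; apply/funext => x; rewrite mulN1r.
by move=> x; apply: cvgM; [exact: cvg_cst|exact: ch].
Qed.

Let Lle g h : continuous g -> continuous h -> (forall x, g x <= h x) -> L g <= L h.
Proof.
move=> cg ch gh; rewrite -subr_ge0 -LB//; apply: (pf_ge0 pfL).
  by move=> x; apply: cvgB; [exact: ch|exact: cg].
by move=> x; rewrite subr_ge0.
Qed.

Let cM g h : continuous g -> continuous h -> continuous (fun x => g x * h x).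
Proof. by move=> cg ch x; apply: cvgM; [exact: cg|exact: ch]. Qed.

Let cB g h : continuous g -> continuous h -> continuous (fun x => g x - h x).
Proof. by move=> cg ch x; apply: cvgB; [exact: cg|exact: ch]. Qed.

Let cst_cont c : continuous (fun _ : X => c : R).
Proof. by move=> x; exact: cvg_cst. Qed.

Let Lcst c : L (fun=> c) = c.
Proof.
rewrite -[RHS]mulr1 -(pf1 pfL) -(pfZ pfL)//.
by congr L; apply/funext => x; rewrite mulr1.
Qed.

Let Lsum n (g : nat -> X -> R) : (forall i, continuous (g i)) ->
  continuous (fun x => \sum_(i < n) g i x) /\
  L (fun x => \sum_(i < n) g i x) = \sum_(i < n) L (g i).
Proof.
move=> cg; elim: n => [|n [IHc IH]].
  under eq_fun do rewrite big_ord0; rewrite big_ord0; split => //.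
under eq_fun do rewrite big_ord_recr/=; rewrite big_ord_recr/= (pfD pfL)// IH.
by split => // x; apply: cvgD; [exact: IHc|exact: cg].
Qed.

(* Increasing sequences of continuous functions play the role of open covers: the outer
   measure of [A] is the infimum of the admissible [s]. *)
Record mcover A (s : R) (g : nat -> X -> R) : Prop := MCover {
  mc_cont : forall n, continuous (g n) ;
  mc_ge0 : forall n x, 0 <= g n x ;
  mc_mono : forall m n x, (m <= n)%N -> g m x <= g n x ;
  mc_cov : forall x, A x -> exists n, 1 <= g n x ;
  mc_le : forall n, L (g n) <= s }.

Let cov A := [set s : R | exists g : nat -> X -> R, mcover A s g].

Let om A : R := inf (cov A).

Let cov_has_inf A : has_inf (cov A).
Proof.
split.
  exists 1, (fun=> fun=> 1); split => // [x _|n]; first by exists 0%N.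
  by rewrite Lcst.
exists 0 => s [g [cg g0 _ _ gs]]; rewrite (le_trans _ (gs 0%N))//.
by apply: (pf_ge0 pfL).
Qed.

Let om_ge0 A : 0 <= om A.
Proof.
apply: lb_le_inf; first exact: (cov_has_inf A).1.
by move=> s [g [cg g0 _ _ gs]]; rewrite (le_trans _ (gs 0%N))//; apply: (pf_ge0 pfL).
Qed.

Let om_le A s (g : nat -> X -> R) : mcover A s g -> om A <= s.
Proof. by move=> c; apply: ge_inf; [exact: (cov_has_inf A).2|exists g]. Qed.

Let om_closed C h : continuous h -> (forall x, 0 <= h x) -> (forall x, C x -> 1 <= h x) ->
  om C <= L h.
Proof. by move=> ch h0 h1; apply: (@om_le _ _ (fun=> h)); split => // x /h1; exists 0%N. Qed.

Let om0 : om set0 = 0.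
Proof.
apply/eqP; rewrite eq_le om_ge0 andbT -[leRHS]Lcst.
by apply: om_closed => // x.
Qed.

Let om_mono A D : A `<=` D -> om A <= om D.
Proof.
move=> AD; apply: lb_le_inf; first exact: (cov_has_inf D).1.
move=> s [g [cg g0 gm gc gs]]; apply: (@om_le _ _ g); split => // x /AD; exact: gc.
Qed.

(** Nearly optimal covers with errors e/2^(n+1) are combined diagonally: the n-th function adds the
    n-th terms of the first n+1 covers, which keeps the sequence increasing. *)
Let om_sub (F : nat -> set X) : ((om (\bigcup_n F n))%:E <= \big[+%E/0%R]_(0 <= i <oo) (om (F i))%:E)%E.
Proof.
apply/lee_addgt0Pr => e e0.
have /choice[g gP] n : exists g : nat -> X -> R, mcover (F n) (om (F n) + e / (2 ^ n.+1)%:R) g.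
  have en : 0 < e / (2 ^ n.+1)%:R by rewrite divr_gt0// ltr0n expn_gt0.
  have [s [g [cg g0 gm gc gs]] lt] := inf_adherent en (cov_has_inf (F n)).
  by exists g; split => // k; rewrite (le_trans (gs k))// ltW.
pose G n x := \sum_(m < n.+1) g m n x.
set S := (X in (_ <= X)%E).
have cG n : continuous (G n) := (Lsum n.+1 (fun m => @mc_cont _ _ _ (gP m) n)).1.
have LG n : ((L (G n))%:E <= S)%E.
  rewrite (Lsum n.+1 (fun m => @mc_cont _ _ _ (gP m) n)).2.
  apply: (@le_trans _ _ (\sum_(0 <= i < n.+1) ((om (F i))%:E + (e / (2 ^ i.+1)%:R)%:E))%E).
    rewrite big_mkord -sumEFin; apply: lee_sum => i _.
    by rewrite -EFinD lee_fin; exact: (mc_le (gP i)).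
  apply: (@le_trans _ _ (\big[+%E/0%R]_(0 <= i <oo) ((om (F i))%:E + (e / (2 ^ i.+1)%:R)%:E))%E).
    by apply: nneseries_lim_ge => i _ _; rewrite -EFinD lee_fin addr_ge0// divr_ge0// ltW.
  by apply: epsilon_trick => [n'|]; [rewrite lee_fin|exact: ltW].
have : S != -oo%E.
  by have := LG 0%N; case: (S).
move: LG; case: (S) => [s| |] // LG _; last by rewrite leey.
rewrite lee_fin; apply: (@om_le _ _ G); split => //.
- by move=> n x; apply: sumr_ge0 => i _; exact: (mc_ge0 (gP i)).
- move=> m n x mn; rewrite /G -!(big_mkord xpredT (fun i => g i _ x)).
  rewrite [leRHS](@big_cat_nat _ _ _ m.+1)//=; apply: ler_wpDr.
    by apply: sumr_ge0 => i _; exact: (mc_ge0 (gP i)).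
  by apply: ler_sum => i _; exact: (mc_mono (gP i)).
- move=> x [m _ Fx]; have [n gn] := mc_cov (gP m) Fx.
  exists (maxn m n); apply: (le_trans gn).
  have mm : (m < (maxn m n).+1)%N by rewrite ltnS leq_maxl.
  rewrite /G (bigD1 (Ordinal mm))//=; apply: ler_wpDr.
    by apply: sumr_ge0 => i _; exact: (mc_ge0 (gP i)).
  by apply: (mc_mono (gP m)); rewrite leq_maxr.
Qed.

(** Caratheodory's condition for closed sets. A cover [g] of [A] is split by [urys C n]: the parts
    [G n] increase and cover the points off [C]. Once [L (G n)] is within e/2 of its supremum, the
    complementary part with this [n] fixed covers the rest at the remaining cost. *)
Let om_closed_split C A : closed C -> om (A `&` C) + om (A `&` ~` C) <= om A.
Proof.
move=> cC; apply: lb_le_inf; first exact: (cov_has_inf A).1.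
move=> s [g [cg g0 gm gc gs]]; apply/ler_addgt0Pr => e e0.
have cu n := @urys_continuous R X C n.
have u0 n x := urys_ge0 C n x; have u1 n x := urys_le1 C n x.
pose G n x := g n x * (1 - urys C n x).
have cG n : continuous (G n) by apply: cM => //; apply: cB.
pose b := sup (range (fun n => L (G n))).
have Gs n : L (G n) <= s.
  apply: le_trans (gs n); apply: Lle => // x.
  by rewrite ler_piMr// gerBl.
have bsup : has_sup (range (fun n => L (G n))).
  by split; [exists (L (G 0%N)), 0%N|exists s => _ [n _ <-]].
have Gb n : L (G n) <= b by apply: sup_upper_bound => //; exists n.
have omb : om (A `&` ~` C) <= b.
  apply: (@om_le _ _ G); split => //.
  - by move=> n x; rewrite mulr_ge0// subr_ge0.
  - by move=> m n x mn; rewrite ler_pM ?subr_ge0 ?gm// lerB// urys_mono.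
  - move=> x [Ax nCx]; have [n gn] := gc x Ax; have [N uN] := urys0 cC nCx.
    exists (maxn n N); rewrite /G uN ?leq_maxr// subr0 mulr1 (le_trans gn)//.
    by rewrite gm// leq_maxl.
have e20 : 0 < e / 2 by lra.
have [_ [n _ <-] bn] := sup_adherent e20 bsup.
suff : om (A `&` C) <= s - L (G n) by rewrite -/b in bn; lra.
apply: (@om_le _ _ (fun k x => g k x * urys C n x)); split.
- by move=> k; exact: cM.
- by move=> k x; rewrite mulr_ge0.
- by move=> k k' x kk; rewrite ler_wpM2r// gm.
- move=> x [Ax Cx]; have [k gk] := gc x Ax; exists k.
  by rewrite urys1// mulr1.
- move=> k; rewrite lerBrDr -(pfD pfL)//; last exact: cM.
  apply: le_trans (gs (maxn k n)); apply: Lle => //.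
    by move=> x; apply: cvgD; [exact: cM|exact: cG].
  move=> x; rewrite /G.
  have h1 : g k x * urys C n x <= g (maxn k n) x * urys C n x.
    by rewrite ler_wpM2r// gm// leq_maxl.
  have h2 : g n x * (1 - urys C n x) <= g (maxn k n) x * (1 - urys C n x).
    by rewrite ler_wpM2r ?subr_ge0// gm// leq_maxr.
  lra.
Qed.

(** Dini's argument: by compactness, one function of an increasing cover is at least [1 - e]
    everywhere. *)
Let omT : om setT = 1.
Proof.
apply/eqP; rewrite eq_le; apply/andP; split.
  by rewrite -[leRHS]Lcst; apply: om_closed.
apply: lb_le_inf; first exact: (cov_has_inf setT).1.
move=> s [g [cg g0 gm gc gs]]; apply/ler_addgt0Pr => e e0.
move/compact_near_coveringP : cX => nc.
have [] := nc nat \oo (fun n x => 1 - e <= g n x) _.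
  move=> x _; have [n gn] := gc x I.
  have [r r0 rP] := continuous_distP x (cg n) e0.
  exists ([set y | mdist x y < r], [set k | (n <= k)%N]) => /=.
    by split; [exact: mball_nbhs|exists n].
  move=> [y k]/= [xy nk]; have := rP y xy; have := gm n k y nk.
  by rewrite ler_norml; lra.
move=> N _ /(_ N (leqnn N)) h.
have : 1 - e <= L (g N) by rewrite -[leLHS]Lcst; apply: Lle => // x; exact: h.
by have := gs N; lra.
Qed.

Let omE A : \bar R := (om A)%:E.

Theorem riesz_representation : exists nu : PM, forall g, continuous g -> RI nu g = L g.
Proof.
have oge0 A : (0 <= omE A)%E by rewrite lee_fin.
have omono : {homo omE : A D / A `<=` D >-> (A <= D)%E}.
  by move=> A D AD; rewrite lee_fin om_mono.
have o0 : omE set0 = 0%E by rewrite /omE om0.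
pose mu : {outer_measure set X -> \bar R} :=
  HB.pack omE (isOuterMeasure.Build R X omE o0 oge0 omono om_sub).
have sub : (measurable : set (set B)) `<=` mu.-caratheodory.
  apply: smallest_sub.
    split; first exact: caratheodory_measurable_set0.
    - by move=> A cA; rewrite setTD; exact: caratheodory_measurable_setC.
    - by move=> F cF; exact: caratheodory_measurable_bigcup.
  move=> U oU; rewrite -[U]setCK; apply: caratheodory_measurable_setC.
  apply: le_caratheodory_measurable => A; rewrite -EFinD lee_fin.
  by apply: om_closed_split; exact: open_closedC.
have sa : semi_sigma_additive (omE : set B -> \bar R).
  move=> F mF tF mUF.
  apply: (@caratheodory_measure_sigma_additive R X mu F) => //.
  - by move=> i; exact: sub.
  - exact: sub.
pose nu0 : {measure set B -> \bar R} :=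
  HB.pack (omE : set B -> \bar R) (isMeasure.Build _ B R omE o0 oge0 sa).
have nu1 : nu0 setT = 1%E by rewrite /= /omE omT.
pose nu : PM := HB.pack (omE : set B -> \bar R) (isMeasure.Build _ B R omE o0 oge0 sa)
   (Measure_isProbability.Build _ B R nu0 nu1).
have nuE A : nu A = (om A)%:E by [].
exists nu.
(* Layer cake: [g] is cut into [n] layers [h k] of height 1/n. As [n * h k] is at least 1 on [C k],
   the measure of [C k] is at most [n * L (h k)], while [g] is at most 1/n plus the mean of the
   indicators of the sets [C k]. *)
have key g : continuous g -> (forall x, 0 <= g x <= 1) -> RI nu g <= L g.
  move=> cg g01; apply/ler_addgt0Pr => e e0.
  pose n := (Num.truncn e^-1).+1.
  have n0 : 0 < n%:R :> R by rewrite ltr0n.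
  have ne : n%:R^-1 <= e by rewrite invf_ple ?posrE// ltW// truncnS_gt.
  pose C k := [set x | k.+1%:R / n%:R <= g x].
  have cC k : closed (C k).
    apply: (preimage_closed (f := g) (D := [set r | k.+1%:R / n%:R <= r])).
      by move=> x _; exact: cg.
    exact: closed_ge.
  pose h k x := Num.min (g x) (k.+1%:R / n%:R) - Num.min (g x) (k%:R / n%:R).
  have ch k : continuous (h k).
    by apply: cB => x; (apply: (@continuous_min _ _ g (cst _)); [exact: cg|exact: cvg_cst]).
  have h0 k x : 0 <= h k x.
    rewrite subr_ge0 le_min ge_min lexx/= ge_min; apply/orP; right.
    by rewrite ler_pM2r ?invr_gt0// ler_nat.
  have hC k x : C k x -> n%:R^-1 <= h k x.
    rewrite /C/= => kg; rewrite /h (min_r kg) min_r; last first.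
      by apply: le_trans kg; rewrite ler_pM2r ?invr_gt0// ler_nat.
    by rewrite -mulrBl -natrB// subSnn mul1r.
  have muC k : fine (nu (C k)) <= n%:R * L (h k).
    rewrite nuE/= -(pfZ pfL)//; apply: om_closed.
    - by apply: cM => //.
    - by move=> x; rewrite mulr_ge0// ltW.
    - by move=> x /hC; rewrite mulrC -ler_pdivrMr// div1r.
  have gle x : g x <= n%:R^-1 + \sum_(k < n) n%:R^-1 * \1_(C k) x.
    have [g0 g1] := andP (g01 x).
    pose j := Num.truncn (n%:R * g x).
    have jg : j%:R <= n%:R * g x by rewrite truncn_le// mulr_ge0// ltW.
    have jn : (j <= n)%N.
      by rewrite -(ler_nat R) (le_trans jg)// ler_piMr// ltW.
    have : \sum_(0 <= k < j) (n%:R^-1 : R) <= \sum_(0 <= k < n) (n%:R^-1 : R) * \1_(C k) x.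
      rewrite [leRHS](@big_cat_nat _ _ _ j)//=.
      rewrite ler_wpDr//.
        by apply: sumr_ge0 => k _; rewrite mulr_ge0 ?invr_ge0 ?(ltW n0)// indicE.
      rewrite big_nat [leRHS]big_nat; apply: ler_sum => k /andP[_ kj].
      rewrite indicE mem_set ?mulr1// /C/= ler_pdivrMr// mulrC.
      by apply: le_trans jg; rewrite ler_nat.
    rewrite big_const_nat subn0 iter_addr addr0 -[_ *+ j]mulr_natl big_mkord => le.
    have : g x <= n%:R^-1 + j%:R / n%:R.
      rewrite (_ : _ + _ = (j%:R + 1) / n%:R); last by rewrite mulrDl mul1r addrC.
      by rewrite ler_pdivlMr// mulrC ltW// natr1 truncnS_gt.
    by lra.
  have mC k : measurable (C k : set B) by exact: closed_borel (cC k).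
  have bC k : bmeas (\1_(C k) : B -> R) by exact: (bmeas_indic (mC k)).
  have b1 k : bmeas (fun x : B => (n%:R^-1 : R) * \1_(C k) x) by exact: (bmeasZ n%:R^-1 (bC k)).
  have bs : bmeas (fun x : B => \sum_(k < n) (n%:R^-1 : R) * \1_(C k) x).
    exact: (@bmeas_sum R _ B 'I_n _ (fun k x => (n%:R^-1 : R) * \1_(C k) x)).
  apply: (@le_trans _ _ (RI nu (fun x => n%:R^-1 + \sum_(k < n) (n%:R^-1 : R) * \1_(C k) x))).
    apply: RI_le => //; first exact: continuous_bmeas.
    by apply: bmeasD => //; exact: bmeas_cst.
  rewrite RID//; last exact: bmeas_cst.
  rewrite RI_cst (@RI_sum R _ B nu 'I_n _ (fun k x => (n%:R^-1 : R) * \1_(C k) x))//.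
  have : \sum_(k < n) RI nu (fun x => (n%:R^-1 : R) * \1_(C k) x) <= \sum_(k < n) L (h k).
    apply: ler_sum => k _; rewrite (RIZ nu _ (bC k)) (RI_indic nu (mC k)).
    by rewrite mulrC ler_pdivrMr// mulrC.
  rewrite -(Lsum n ch).2 (_ : (fun x => \sum_(i < n) h i x) = g); first by lra.
  apply/funext => x; rewrite -(big_mkord xpredT (fun i => h i x)) telescope_sumr//.
  have [g0 g1] := andP (g01 x).
  by rewrite divff ?gt_eqF// min_l// mul0r min_r// subr0.
(* Applied to [1 - g], the inequality reverses. *)
have keyE g : continuous g -> (forall x, 0 <= g x <= 1) -> RI nu g = L g.
  move=> cg g01; apply/eqP; rewrite eq_le key//=.
  have c1 : continuous (fun x => 1 - g x) by exact: cB.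
  have := key _ c1; rewrite LB// Lcst.
  have -> : RI nu (fun x => 1 - g x) = 1 - RI nu g.
    have -> : (fun x => 1 - g x) = (fun x => 1 + (-1) * g x).
      by apply/funext => x; rewrite mulN1r.
    have bg : bmeas (g : B -> R) by exact: continuous_bmeas.
    rewrite RID; [|exact: bmeas_cst|exact: bmeasZ].
    by rewrite RI_cst RIZ// mulN1r.
  move=> /(_ _)/wrap[]; last by lra.
  by move=> x; have := g01 x; lra.
move=> g cg; have [M MP] := continuous_bounded cX cg.
have M0 : 0 <= M by rewrite (le_trans _ (MP point)).
(* Any [g] is an affine image of a function with values in [0, 1]; the added 1 keeps the denominator
   positive when [M] is 0. *)
pose h x := (g x + M) / (2 * M + 1).
have D0 : 0 < 2 * M + 1 by lra.
have ch : continuous h.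
  by move=> x; apply: cvgM; [apply: cvgD; [exact: cg|exact: cvg_cst]|exact: cvg_cst].
have h01 x : 0 <= h x <= 1.
  have := MP x; rewrite ler_norml => /andP[l1 l2].
  by rewrite divr_ge0 ?ler_pdivrMr//; lra.
have gE : g = (fun x => (2 * M + 1) * h x + - M).
  by apply/funext => x; rewrite /h; field; rewrite gt_eqF.
have bh : bmeas (h : B -> R) by exact: continuous_bmeas.
rewrite gE RID; [|exact: bmeasZ|exact: bmeas_cst].
rewrite RIZ// RI_cst keyE// (pfD pfL)//; last exact: cM.
by rewrite (pfZ pfL)// Lcst.
Qed.

End riesz.

(** * Ultralimits of measures *)

Section ultralimits.
Context {R : realType}.

Lemma ultra_cvg_bounded (T : Type) (U : set_system T) (u : T -> R) (M : R) :
  UltraFilter U -> (forall t, `|u t| <= M) -> exists l : R, u t @[t --> U] --> l.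
Proof.
move=> UU uM; have cI := @segment_compact R (- M) M.
have PF : ProperFilter (u @ U) by exact: fmap_proper_filter.
have FI : (u @ U) `[- M, M]%classic.
  apply: (@filterE _ U _ (u @^-1` `[- M, M]%classic)) => t /=.
  by rewrite in_itv/= -ler_norml.
have [l [_ cl]] := cI _ PF FI; exists l; apply/cvgrPdist_lt => e e0.
have [//|nU] := in_ultra_setVsetC [set t | `|l - u t| < e] UU.
have [] := cl (u @` (~` [set t | `|l - u t| < e])) (ball l e).
- by apply: (@filterS _ U _ (~` [set t | `|l - u t| < e])) nU => t nt; exists t.
- exact: nbhsx_ballx.
- by move=> _ [[t nt <-] /= lt]; case: nt; move: lt; rewrite -ball_normE.
Qed.

Context {X : pmetricType R}.
Notation B := (@borel R X).
Notation PM := (probability B R).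
Hypothesis cX : compact [set: X].

Lemma pos_functional_le (L : (X -> R) -> R) g (M : R) : pos_functional L ->
  continuous g -> (forall x, `|g x| <= M) -> `|L g| <= M.
Proof.
move=> pL cg gM.
have Lc c : L (fun=> c) = c.
  rewrite -[RHS]mulr1 -(pf1 pL) -(pfZ pL).
    by congr L; apply/funext => x; rewrite mulr1.
  by move=> x; exact: cvg_cst.
have cc c : continuous (fun _ : X => c : R) by move=> x; exact: cvg_cst.
have cN : continuous (fun x => -1 * g x) by move=> x; apply: cvgM; [exact: cvg_cst|exact: cg].
have h1 : 0 <= L (fun x => g x + M).
  apply: (pf_ge0 pL) => [x|x]; first by apply: cvgD; [exact: cg|exact: cvg_cst].
  by have := gM x; rewrite ler_norml; lra.
have h2 : 0 <= L (fun x => -1 * g x + M).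
  apply: (pf_ge0 pL) => [x|x]; first by apply: cvgD; [exact: cN|exact: cvg_cst].
  by have := gM x; rewrite ler_norml; lra.
rewrite (pfD pL) ?Lc// in h1; rewrite (pfD pL) ?Lc ?(pfZ pL)// in h2.
by rewrite ler_norml; lra.
Qed.

Lemma pos_functional_RI (mu : PM) : pos_functional (RI mu).
Proof.
split => [g h cg ch|c g cg|g cg g0|].
- by apply: RID; exact: continuous_bmeas.
- by apply: RIZ; exact: continuous_bmeas.
- rewrite -[leLHS](RI_cst mu 0); apply: RI_le => //; first exact: bmeas_cst.
  exact: continuous_bmeas.
- exact: RI_cst.
Qed.

(** Weak compactness in filter form: pointwise ultralimits of positive functionals are positive, and
    Riesz representation applies. The index type is free, to serve both for sequences of orbit
    averages and for an ultrafilter on the measures themselves. *)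
Lemma ultra_measure (T : Type) (U : set_system T) (L : T -> (X -> R) -> R) :
  UltraFilter U -> (forall t, pos_functional (L t)) ->
  exists nu : PM, forall g, continuous g -> L t g @[t --> U] --> RI nu g.
Proof.
move=> UU pL.
have /choice[l lP] (g : X -> R) : exists l : R, continuous g -> L t g @[t --> U] --> l.
  have [cg|] := pselect (continuous g); last by exists 0.
  have [M MP] := continuous_bounded cX cg.
  have [l h] := @ultra_cvg_bounded _ U (L^~ g) M UU (fun t => pos_functional_le (pL t) cg MP).
  by exists l.
have luniq g a : continuous g -> L t g @[t --> U] --> a -> l g = a.
  move=> cg ca; have := lP g cg => cl.
  by rewrite -(cvg_lim (@Rhausdorff R) cl) -(cvg_lim (@Rhausdorff R) ca).
have [|nu nuP] := @riesz_representation R X cX l; last first.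
  by exists nu => g cg; rewrite nuP//; exact: lP.
have cc c : continuous (fun _ : X => c : R) by move=> x; exact: cvg_cst.
split => [g h cg ch|c g cg|g cg g0|].
- apply: luniq; first by move=> x; apply: cvgD; [exact: cg|exact: ch].
  rewrite (_ : (fun t => _) = (fun t => L t g + L t h)).
    by apply: cvgD; exact: lP.
  by apply/funext => t; rewrite (pfD (pL t)).
- apply: luniq; first by move=> x; apply: cvgM; [exact: cvg_cst|exact: cg].
  rewrite (_ : (fun t => _) = (fun t => c * L t g)).
    by apply: cvgM; [exact: cvg_cst|exact: lP].
  by apply/funext => t; rewrite (pfZ (pL t)).
- have := lP g cg => cl; rewrite -(cvg_lim (@Rhausdorff R) cl).
  apply: limr_ge; first by apply/cvg_ex; exists (l g).
  by apply: nearW => t; exact: (pf_ge0 (pL t)).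
- apply: luniq => //.
  rewrite (_ : (fun t => _) = (fun t => 1)); first exact: cvg_cst.
  by apply/funext => t; rewrite (pf1 (pL t)).
Qed.

End ultralimits.

(** * Upper and lower limits of extended real sequences *)

Section limsup.
Context {R : realType}.
Implicit Types (u : nat -> \bar R) (c : \bar R).
Local Open Scope ereal_scope.

Lemma limn_esup_le u c N : (forall n, (N <= n)%N -> u n <= c) -> limn_esup u <= c.
Proof.
move=> h; rewrite limn_esup_lim (cvg_lim _ (@cvg_esups_inf _ u))//.
apply: (@le_trans _ _ (esups u N)); first by apply: ereal_inf_lbound; exists N.
by apply: ge_ereal_sup => _ [n /= Nn <-]; exact: h.
Qed.

Lemma limn_esup_lt u c : limn_esup u < c -> exists N, forall n, (N <= n)%N -> u n < c.
Proof.
rewrite limn_esup_lim (cvg_lim _ (@cvg_esups_inf _ u))// => /ereal_inf_lt[_ [N _ <-] lt].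
exists N => n Nn; apply: le_lt_trans lt; apply: ereal_sup_ubound.
by exists n.
Qed.

Lemma limn_einf_ge u c N : (forall n, (N <= n)%N -> c <= u n) -> c <= limn_einf u.
Proof.
move=> h; rewrite limn_einf_lim (cvg_lim _ (@cvg_einfs_sup _ u))//.
apply: (@le_trans _ _ (einfs u N)); last by apply: ereal_sup_ubound; exists N.
by apply: le_ereal_inf_tmp => _ [n /= Nn <-]; exact: h.
Qed.

Lemma limn_einf_gt u c : c < limn_einf u -> exists N, forall n, (N <= n)%N -> c < u n.
Proof.
rewrite limn_einf_lim (cvg_lim _ (@cvg_einfs_sup _ u))// => /ereal_sup_gt[_ [N _ <-] lt].
exists N => n Nn; apply: (lt_le_trans lt); apply: ereal_inf_lbound.
by exists n.
Qed.

End limsup.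

(** * Sorting and gluing of orbit segments *)

Lemma sorting_perm K q (a : 'I_K -> 'I_q) : exists2 sg : 'I_K -> 'I_K, injective sg &
  forall i j : 'I_K, (i <= j)%N -> (a (sg i) <= a (sg j))%N.
Proof.
pose r i j := (a i <= a j)%N; pose s := sort r (enum 'I_K).
have ss : size s = K by rewrite size_sort size_enum_ord.
exists (fun i => nth i s i) => [i j|i j ij].
  rewrite (set_nth_default i (s := s) j) ?ss// => /eqP.
  by rewrite nth_uniq ?ss ?sort_uniq ?enum_uniq// => /eqP/val_inj.
rewrite (set_nth_default i (s := s) j) ?ss//.
apply: (@sorted_leq_nth _ r _ _ i s) => //; rewrite ?inE ?ss//.
- by move=> y x z; exact: leq_trans.
- by move=> x; rewrite /r.
- by apply: sort_sorted => x y; rewrite /r leq_total.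
Qed.

Section block_sums.
Context {R : realType}.

(** Of the [n] times, [K * L] lie in blocks and cost [e] each; the others, in gaps or after the last
    block, cost at most [M] each. *)
Lemma block_sums (c : nat -> R) (d : nat -> nat -> R) (L : nat) (Ms : nat -> nat)
    (K n : nat) (M e : R) :
  let pos j := (\sum_(t < j) (L + Ms t))%N in
  (forall i, `|c i| <= M) -> (pos K <= n)%N ->
  (forall j i, (j < K)%N -> (i < L)%N -> `|c (i + pos j)%N - d j i| <= e) ->
  `|\sum_(i < n) c i - \sum_(j < K) \sum_(i < L) d j i|
    <= K%:R * L%:R * e + (n%:R - K%:R * L%:R) * M.
Proof.
move=> pos cM pn cd.
have seg a k : `|\sum_(i < k) c (a + i)%N| <= k%:R * M.
  rewrite (le_trans (ler_norm_sum _ _ _))//.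
  rewrite -[k in k%:R](card_ord k) -sum1_card natr_sum mulr_suml.
  by apply: ler_sum => i _; rewrite mul1r.
have split a k : \sum_(i < a + k) c i = \sum_(i < a) c i + \sum_(i < k) c (a + i)%N.
  by rewrite big_split_ord.
have H j : (j <= K)%N -> `|\sum_(i < pos j) c i - \sum_(t < j) \sum_(i < L) d t i|
    <= j%:R * L%:R * e + ((pos j)%:R - j%:R * L%:R) * M.
  elim: j => [|j IH] jK.
    by rewrite /pos !big_ord0 subr0 normr0 !mul0r subr0 mul0r addr0.
  have {}IH := IH (ltnW jK).
  have pS : pos j.+1 = (pos j + L + Ms j)%N by rewrite /pos big_ord_recr/= addnA.
  rewrite pS split split big_ord_recr/=.
  have h1 : `|\sum_(i < L) c (pos j + i)%N - \sum_(i < L) d j i| <= L%:R * e.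
    rewrite -sumrB (le_trans (ler_norm_sum _ _ _))//.
    rewrite -[L in L%:R](card_ord L) -sum1_card natr_sum mulr_suml.
    by apply: ler_sum => i _; rewrite mul1r addnC cd.
  have h2 := seg (pos j + L)%N (Ms j).
  set S1 := \sum_(i < pos j) c i in IH *; set S2 := \sum_(i < L) c _ in h1 *.
  set S3 := \sum_(i < Ms j) c _ in h2 *; set D1 := \sum_(t < j) _ in IH *.
  set D2 := \sum_(i < L) d j i in h1 *.
  have -> : S1 + S2 + S3 - (D1 + D2) = (S1 - D1) + (S2 - D2) + S3 by ring.
  rewrite (le_trans (ler_normD _ _))//.
  have := ler_normD (S1 - D1) (S2 - D2); rewrite !natrD -natr1; lra.
have Sn : \sum_(i < n) c i = \sum_(i < pos K) c i + \sum_(i < n - pos K) c (pos K + i)%N.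
  by rewrite -split subnKC.
have := H K (leqnn K); rewrite Sn.
have := seg (pos K) (n - pos K)%N; rewrite natrB//.
set S1 := \sum_(i < pos K) c i; set S2 := \sum_(i < _) c _; set D1 := \sum_(j < K) _.
have -> : S1 + S2 - D1 = (S1 - D1) + S2 by ring.
have := ler_normD (S1 - D1) S2; lra.
Qed.

End block_sums.

(** * Further labels: quantised functions *)

Section more_labels.
Context {R : realType} d {T : measurableType d}.

Lemma mlabel_bool (A : set T) : measurable A -> mlabel (fun x => `[< A x >]).
Proof.
move=> mA [].
  by rewrite (_ : _ @^-1` _ = A)//; apply/seteqP; split => x /= /asboolP.
rewrite (_ : _ @^-1` _ = ~` A); first exact: measurableC.
by apply/seteqP; split => x /=; [move/negbT/asboolPn|move/asboolPn/negbTE].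
Qed.

(** Quantisation with unit step: for values in [0, Q] the thresholds passed determine [u x] up to
    1. *)
Definition levels Q (u : T -> R) (x : T) : {ffun 'I_Q -> bool} :=
  [ffun k : 'I_Q => k.+1%:R <= u x].

Lemma mlabel_levels Q (u : T -> R) : measurable_fun [set: T] u -> mlabel (levels Q u).
Proof.
move=> mu; apply: mlabel_ffun => k.
have := @mlabel_bool [set x | k.+1%:R <= u x] _.
rewrite (_ : (fun x => `[< [set x | k.+1%:R <= u x] x >]) = (fun x => k.+1%:R <= u x)).
  apply; rewrite -[X in measurable X]setTI.
  have -> : [set x | k.+1%:R <= u x] = u @^-1` `[k.+1%:R, +oo[%classic.
    by apply/seteqP; split => x /=; rewrite in_itv/= andbT.
  exact: mu.
by apply/funext => x; rewrite asboolb.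
Qed.

Lemma levels_dist Q (u : T -> R) x y : (forall z, 0 <= u z <= Q%:R) ->
  levels Q u x = levels Q u y -> `|u x - u y| <= 1.
Proof.
move=> u0Q; wlog : x y / u x <= u y.
  move=> h; have [le|/ltW le] := leP (u x) (u y); first exact: h.
  by move=> /esym e; rewrite distrC; exact: h.
move=> le /ffunP e; rewrite distrC ger0_norm ?subr_ge0// leNgt; apply/negP => lt.
have [x0 _] := andP (u0Q x); have [_ yQ] := andP (u0Q y).
have tx : (Num.truncn (u x))%:R <= u x by rewrite truncn_le.
have tQ : (Num.truncn (u x) < Q)%N by rewrite -(ltr_nat R); lra.
have := e (Ordinal tQ); rewrite !ffunE/= -natr1.
have -> : (Num.truncn (u x))%:R + 1 <= u x = false.
  by apply/negbTE; rewrite -ltNge natr1 truncnS_gt.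
by move=> /esym/negbT; rewrite -ltNge; lra.
Qed.

Lemma ent_word_le_mul (f : T -> T) (P : probability T R) (I : finType) (l : T -> I) n :
  measurable_fun [set: T] f -> mlabel l ->
  (forall A, measurable A -> P (f @^-1` A) = P A) ->
  ent P (word f l 0 n) <= n%:R * ent P l.
Proof.
move=> mf ml inv; elim: n => [|n IH].
  by rewrite (le_trans (ent_word_le mf P ml 0 0))// !mul0r.
have h := ent_wordD mf P ml 0 n 1; rewrite addn1 in h; apply: (le_trans h).
rewrite -natr1 mulrDl mul1r lerD// add0n.
rewrite /ent (law_word mf ml inv); apply: ent_factor => // x y xy.
by apply/ffunP => i; rewrite !ffunE/= (ord1 i).
Qed.

End more_labels.

(** * Bowen balls and the entropy of partitions *)

Section dynamics.
Context {R : realType} {X : pmetricType R}.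
Notation B := (@borel R X).
Notation PM := (probability B R).
Notation bword := (@word _ B).
Implicit Types (x y : X) (mu nu m : PM) (g phi : X -> R) (f : X -> X).
Hypothesis cX : compact [set: X].

Lemma bowen_closed f n x (e : R) : continuous f -> closed (bowen f n x e).
Proof.
move=> cf.
have -> : bowen f n x e =
    \bigcap_(j in [set j | (j < n)%N]) [set y | mdist (iter j f x) (iter j f y) <= e].
  by apply/seteqP; split => y h j /=; exact: h.
apply: closed_bigI => j _.
apply: (preimage_closed (f := fun y => mdist (iter j f x) (iter j f y)) (D := [set r | r <= e])).
  move=> y _; apply: (continuous_compf _ (@continuous_iter R X f j cf)) => {}y.
  apply/cvgrPdist_le => r r0; apply: filterS (mball_nbhs y r0) => z /= yz.
  have := metric_triangle (iter j f x) y z; have := metric_triangle (iter j f x) z y.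
  by rewrite (metric_sym z y) ler_norml; lra.
exact: closed_le.
Qed.

Lemma fin_PM m (A : set B) : measurable A -> m A = (fine (m A))%:E.
Proof. by move=> mA; rewrite fineK// fin_num_measure. Qed.

(** Reads a uniform bound off [A.2] at a single scale, kept below [r] because gluing asks for a
    precision of its own. *)
Lemma lower_bowen_ball f m phi (d r : R) : continuous f ->
  (exists l : \bar R, lower_bowen f m phi eps @[eps --> 0^'+] --> l /\ (0 <= l)%E) ->
  0 < d -> 0 < r ->
  exists2 e : R, 0 < e < r & exists N, forall n x, (N <= n)%N ->
    expR (- bsum f phi n x - n%:R * d) <= fine (m (bowen f n x e)).
Proof.
move=> cf [l [cl l0]] d0 r0.
have nl : nbhs l [set y | ((- d)%:E < y)%E].
  apply: open_nbhs_nbhs; split; first exact: open_ereal_gt_ereal.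
  by rewrite /= (lt_le_trans _ l0)// lte_fin oppr_lt0.
have : \forall e \near 0^'+, [/\ 0 < e, e < r & ((- d)%:E < lower_bowen f m phi e)%E].
  near=> e; split; [near: e; exact: nbhs_right_gt|near: e; exact: nbhs_right_lt|].
  near: e; exact: (cl _ nl).
move=> /filter_ex[e [e0 er]] /limn_einf_gt[N NP].
exists e; first by rewrite e0.
exists N.+1 => n x Nn; have := NP n (ltnW Nn) => /lt_le_trans/(_ (ereal_inf_lbound _)).
move=> /(_ (bowen_term f m phi n e x)); have n0 : 0 < n%:R :> R by rewrite ltr0n (leq_trans _ Nn).
move=> /(_ _)/wrap[]; first by exists x.
have mB : measurable (bowen f n x e : set B) by apply: closed_borel; exact: bowen_closed.
rewrite /bowen_term (fin_PM m mB); set c := fine _.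
(* A null ball would make the term minus infinity, against the lower bound. *)
rewrite /lne; case: ifPn => [_|]; first by rewrite gt0_muleNy ?lte_fin ?invr_gt0.
rewrite -ltNge => c0; rewrite -EFinM -EFinD lte_fin -mulrDr mulrC ltr_pdivlMr// => h.
rewrite -[leRHS]lnK ?posrE// ler_expR; rewrite /bsum; lra.
Unshelve. all: by end_near. Qed.

Lemma upper_bowen_ball f m phi (d : R) : continuous f ->
  (exists l : \bar R, upper_bowen f m phi eps @[eps --> 0^'+] --> l /\ (l <= 0)%E) ->
  0 < d ->
  exists2 e : R, 0 < e & exists N, forall n x, (N <= n)%N ->
    fine (m (bowen f n x e)) <= expR (- bsum f phi n x + n%:R * d).
Proof.
move=> cf [l [cl l0]] d0.
have nl : nbhs l [set y | (y < d%:E)%E].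
  apply: open_nbhs_nbhs; split; first exact: open_ereal_lt_ereal.
  by rewrite /= (le_lt_trans l0)// lte_fin.
have : \forall e \near 0^'+, 0 < e /\ (upper_bowen f m phi e < d%:E)%E.
  near=> e; split; [near: e; exact: nbhs_right_gt|].
  near: e; exact: (cl _ nl).
move=> /filter_ex[e [e0]] /limn_esup_lt[N NP].
exists e => //; exists N.+1 => n x Nn.
have := NP n (ltnW Nn) => /(le_lt_trans (ereal_sup_ubound _)).
move=> /(_ (bowen_term f m phi n e x)); have n0 : 0 < n%:R :> R by rewrite ltr0n (leq_trans _ Nn).
move=> /(_ _)/wrap[]; first by exists x.
have mB : measurable (bowen f n x e : set B) by apply: closed_borel; exact: bowen_closed.
rewrite /bowen_term (fin_PM m mB); set c := fine _.
rewrite /lne; case: ifPn => [cle _|]; first by rewrite (le_trans cle)// expR_ge0.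
rewrite -ltNge => c0; rewrite -EFinM -EFinD lte_fin -mulrDr mulrC ltr_pdivrMr// => h.
rewrite -[leLHS]lnK ?posrE// ler_expR; rewrite /bsum; lra.
Unshelve. all: by end_near. Qed.

Section partition_labels.
Variables (f : X -> X) (mu : PM).
Hypotheses (cf : continuous f) (inv : Defs.invariant f mu).

Let mf := continuous_borel cf.

(** Together the clauses characterise [hpart] as the largest [c] such that [c * n] bounds from below
    the entropy of words of every length n; later arguments work with this form. *)
Lemma hpart_label k (l : B -> 'I_k) (xi : 'I_k -> set X) : mlabel l ->
  (forall i, xi i = l @^-1` [set i]) ->
  (forall n, (0 < n)%N -> hpart f mu xi * n%:R <= ent mu (bword f l 0 n)) /\
  (forall c : R, (forall n, (0 < n)%N -> c * n%:R <= ent mu (bword f l 0 n)) -> c <= hpart f mu xi).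
Proof.
move=> ml xil.
have HE n : Hjoin f mu xi n = ent mu (bword f l 0 n).
  rewrite /Hjoin /ent /fent -sumrN; apply: eq_bigr => w _; rewrite /nlnx /law.
  congr (- (fine (mu _) * ln (fine (mu _)))); apply/seteqP; split => x /=.
  - by move=> h; apply/ffunP => i; rewrite ffunE; have := h i; rewrite xil.
  - by move=> /ffunP h i; rewrite xil/=; have := h i; rewrite ffunE.
  - by move=> h; apply/ffunP => i; rewrite ffunE; have := h i; rewrite xil.
  - by move=> /ffunP h i; rewrite xil/=; have := h i; rewrite ffunE.
have [h hc hle] := ent_rate mf ml inv.
have hcv : Hjoin f mu xi n.+1 / n.+1%:R @[n --> \oo] --> h.
  by under eq_fun do rewrite HE.
have hE : hpart f mu xi = h by exact: (cvg_lim (@Rhausdorff R) hcv).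
rewrite hE; split => // c cP; rewrite -(cvg_lim (@Rhausdorff R) hcv).
apply: limr_ge; first by apply/cvg_ex; exists h.
by apply: nearW => n; rewrite HE ler_pdivlMr ?ltr0n// cP.
Qed.

Lemma ks_entropy_ge (I : finType) (l : B -> I) (c : R) : mlabel l ->
  (forall n, (0 < n)%N -> c * n%:R <= ent mu (bword f l 0 n)) -> (c%:E <= ks_entropy f mu)%E.
Proof.
move=> ml cP; pose l' (x : B) : 'I_#|I| := enum_rank (l x).
have ml' : mlabel l' by exact: (mlabel_comp enum_rank ml).
pose xi i : set X := l' @^-1` [set i].
have [_ h] := @hpart_label #|I| l' xi ml' (fun=> erefl).
apply: (@le_trans _ _ (hpart f mu xi)%:E); last first.
  apply: ereal_sup_ubound; exists #|I|, xi; split => //; split => //.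
  - by move=> i j ij; apply/seteqP; split => // x [/= xi1 xj1]; move: ij; rewrite -xi1 -xj1 eqxx.
  - by apply/seteqP; split => // x _; exists (l' x).
rewrite lee_fin; apply: h => n n0; apply: (le_trans (cP n n0)).
apply: ent_factor; first exact: mlabel_word.
move=> x y /ffunP xy; apply/ffunP => i; have := xy i; rewrite !ffunE.
exact: enum_rank_inj.
Qed.

Lemma mpartition_label k (xi : 'I_k -> set X) : mpartition xi ->
  exists2 l : B -> 'I_k, mlabel l & forall i, xi i = l @^-1` [set i].
Proof.
move=> [mxi dxi cxi].
have /choice[l lP] (x : B) : exists i, xi i x.
  have : (\bigcup_i xi i) x by rewrite cxi.
  by move=> [i _ xix]; exists i.
have E i : xi i = l @^-1` [set i].
  apply/seteqP; split => x /=; last by move=> <-; exact: lP.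
  move=> xix; apply: contrapT => /eqP/dxi e.
  by have : (xi (l x) `&` xi i) x by []; rewrite e.
by exists l => // i; rewrite -E.
Qed.

End partition_labels.
End dynamics.

(** The reciprocal of 1 plus the sum of the reciprocals replaces a minimum, and is positive for
    empty [T] as well. *)
Lemma finite_lower_bound (R : realType) (T : finType) (F : T -> R) :
  (forall t, 0 < F t) -> exists2 r, 0 < r & forall t, r <= F t.
Proof.
move=> F0; have S0 : 0 <= \sum_t (F t)^-1.
  by apply: sumr_ge0 => t _; rewrite invr_ge0 ltW.
exists (1 + \sum_t (F t)^-1)^-1; first by rewrite invr_gt0; lra.
move=> t; rewrite invf_ple ?posrE//; last by lra.
suff : (F t)^-1 <= \sum_t (F t)^-1 by lra.
by rewrite (bigD1 t)//= lerDl sumr_ge0// => i _; rewrite invr_ge0 ltW.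
Qed.

(** * Coding of orbit segments *)

Section block_code.
Context {R : realType} {X : pmetricType R}.
Notation B := (@borel R X).
Notation PM := (probability B R).
Notation bword := (@word _ B).
Variables (f : X -> X) (mu : PM) (J I : finType) (G : J -> X -> R) (l : B -> I) (h : R).
Variables (q : nat) (Xs : 'I_q -> set X).
Hypotheses (cX : compact [set: X]) (cf : continuous f) (inv : Defs.invariant f mu).
Hypotheses (cG : forall j, continuous (G j)) (ml : mlabel l).
Hypothesis hle : forall n, (0 < n)%N -> h * n%:R <= ent mu (bword f l 0 n).
Hypotheses (cXs : forall i, compact (Xs i)) (nwXs : nonwandering f = \bigcup_i Xs i).

Let mf := continuous_borel cf.

Let bounded : exists2 Bd : R, 0 < Bd & forall j x, `|G j x| <= Bd.
Proof.
have /choice[M MP] j := continuous_bounded cX (@cG j).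
exists (1 + \sum_j `|M j|); first by rewrite ltr_pwDl// sumr_ge0.
move=> j x; rewrite (le_trans (MP j x))// (le_trans (ler_norm _))//.
by rewrite (bigD1 j)//= addrCA lerDl addr_ge0// sumr_ge0.
Qed.

Let nw_full : mu (~` nonwandering f) = 0%E.
Proof. exact: (nonwandering_full cX cf inv). Qed.

Let nw_meas : measurable (nonwandering f : set B).
Proof. by apply: closed_borel; exact: nonwandering_closed. Qed.

Let nw_point (A : set B) : measurable A -> 0 < fine (mu A) -> exists2 x, A x & nonwandering f x.
Proof.
move=> mA A0; apply: contrapT => nA; move: A0.
suff -> : mu A = 0%E by rewrite ltxx.
apply/eqP; rewrite eq_le measure_ge0 andbT -nw_full; apply: le_measure; rewrite ?inE//.
  exact: measurableC.
by move=> x Ax nx; apply: nA; exists x.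
Qed.

Let q_pos : exists i : 'I_q, True.
Proof.
have [||x _] := @nw_point setT => //; last by rewrite nwXs => -[i _ _]; exists i.
by rewrite probability_setT.
Qed.

Let inner_sets (k : R) : 0 < k -> exists C : I -> set X,
  [/\ forall i, closed (C i), forall i, C i `<=` l @^-1` [set i] &
      fine (mu (~` \bigcup_i C i)) <= k].
Proof.
move=> k0.
have I0 : 0 < #|I|%:R :> R by rewrite ltr0n; apply/card_gt0P; exists (l point).
have /choice[C CP] i : exists C : set X, [/\ closed C, C `<=` l @^-1` [set i] &
    fine (mu (l @^-1` [set i] `\` C)) <= k / #|I|%:R].
  have [C [U [cC oU CA AU le]]] := borel_regular mu (ml i) (divr_gt0 k0 I0).
  have mD : measurable (l @^-1` [set i] `\` C : set B).
    by apply: measurableD; [exact: ml|exact: closed_borel].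
  exists C; split => //; rewrite -lee_fin -fin_PM//; apply: le_trans le.
  apply: le_measure; rewrite ?inE//; last exact: setSD.
  by apply: measurableD; [exact: open_borel|exact: closed_borel].
have cC i : closed (C i) by have [] := CP i.
exists C; split => // [i|]; first by have [] := CP i.
have mD i : measurable (l @^-1` [set i] `\` C i : set B).
  by apply: measurableD; [exact: ml|exact: closed_borel].
have mU : measurable (~` \bigcup_i C i : set B).
  by apply: measurableC; apply: fin_bigcup_measurable => // i _; exact: closed_borel.
rewrite -(RI_indic mu mU).
have bD i : bmeas (\1_(l @^-1` [set i] `\` C i) : B -> R) by exact: bmeas_indic.
apply: (@le_trans _ _ (RI mu (fun x => \sum_i \1_(l @^-1` [set i] `\` C i) x))).
  apply: RI_le; first exact: bmeas_indic.
    exact: bmeas_sum.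
  move=> x; rewrite indicE; have [|nU] := boolP (x \in _); last first.
    by apply: sumr_ge0 => i _; rewrite indicE.
  rewrite inE => nU; rewrite (bigD1 (l x))//= indicE mem_set; last first.
    by split => // Cx; apply: nU; exists (l x).
  by rewrite lerDl sumr_ge0// => i _; rewrite indicE.
rewrite RI_sum//.
apply: (@le_trans _ _ (\sum_(i : I) k / #|I|%:R)).
  by apply: ler_sum => i _; rewrite RI_indic//; have [] := CP i.
by rewrite sumr_const -[X in X <= _]mulr_natr divfK// gt_eqF.
Qed.

(* A code word lists the partition labels along an orbit of length [L]; [th] hides
   exactly the labels at times when the orbit lies in compact inner approximations of
   the atoms. Hence [th] has small entropy, and since these approximations are
   [r]-separated, the hidden labels can be read off an [r]-approximation of the orbit. *)
Lemma block_code (e : R) : 0 < e -> exists2 r : R, 0 < r & exists Zc : R, forall L, (0 < L)%N ->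
  exists (T Th : finType) (p : T -> R) (th : T -> Th) (ind : T -> 'I_q) (xt : T -> X),
  [/\ (forall t, 0 <= p t) /\ \sum_t p t = 1,
      h * L%:R <= fent p, fent (marg th p) <= L%:R * e + Zc,
      (forall t, 0 < p t -> Xs (ind t) (xt t)) /\
      (forall t t', th t = th t' -> ind t = ind t') /\
      (forall t t', 0 < p t -> 0 < p t' -> th t = th t' ->
        (forall i, (i < L)%N -> mdist (iter i f (xt t)) (iter i f (xt t')) <= r) -> t = t') &
      forall j, `|\sum_t p t * bsum f (G j) L (xt t) - L%:R * RI mu (G j)| <= L%:R * e].
Proof.
move=> e0; have [Bd Bd0 GB] := bounded; have [i0 _] := q_pos.
(* [None] stands for a hidden label: a law giving it mass at least [1 - k] has entropy at most
   [e]. *)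
have [k k0 kP] := @fent_small R (option I) None e e0.
have [C [cC Cl muC]] := inner_sets k0.
have /choice[rr rrP] (ij : I * I) : exists r : R, 0 < r /\
    (ij.1 != ij.2 -> forall x y, C ij.1 x -> C ij.2 y -> r < mdist x y).
  have [e1|ne] := eqVneq ij.1 ij.2; first by exists 1.
  have [|r r0 rP] := @closed_separated _ _ (C ij.1) (C ij.2) cX (cC _) (cC _).
    apply/seteqP; split => // x [/Cl/= c1 /Cl/= c2].
    by move: ne; rewrite -c1 -c2 eqxx.
  by exists r; split => // _ x y; exact: rP.
have [r r0 rle] := finite_lower_bound (fun ij => (rrP ij).1).
have sep i i' x y : C i x -> C i' y -> mdist x y <= r -> i = i'.
  move=> Cx Cy xy; apply/eqP; apply/negPn/negP => ne.
  have := (rrP (i, i')).2 ne x y Cx Cy; have := rle (i, i'); lra.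
exists r => //.
(* The averages of [G j], shifted by [Bd] and divided by [e], lie in [0, 2 Bd / e], so [Q] unit
   levels cover them. *)
pose Q := (Num.truncn (2 * Bd / e)).+1.
have mXs i : measurable (Xs i : set B).
  by apply: closed_borel; apply: compact_closed; [exact: metric_hausdorff|exact: cXs].
(* The pieces may overlap, so one containing [x] is selected; [i0] is the default outside all of
   them. *)
pose ix (x : B) : 'I_q := odflt i0 [pick i | `[< Xs i x >]].
have ixP x : nonwandering f x -> Xs (ix x) x.
  rewrite nwXs => -[i _ Xx]; rewrite /ix; case: pickP => [j /asboolP//|/(_ i)].
  by move/asboolPn.
have mix : mlabel ix.
  apply: (@mlabel_factor _ _ _ _ ix (fun x => [ffun i => `[< Xs i x >]])).
    by apply: mlabel_ffun => i; exact: mlabel_bool.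
  move=> x y /ffunP xy; rewrite /ix; congr odflt; apply: eq_pick => i.
  by have := xy i; rewrite !ffunE.
pose bb (x : B) : bool := `[< (\bigcup_i C i) x >].
have mbb : mlabel bb.
  by apply: mlabel_bool; apply: fin_bigcup_measurable => // i _; exact: closed_borel.
pose l2 (x : B) : I * bool := (l x, bb x).
have ml2 : mlabel l2 by exact: mlabel_pair.
pose th1 (s : I * bool) : option I := if s.2 then None else Some s.1.
have mth : mlabel (th1 \o l2) by exact: mlabel_comp.
have entth : ent mu (th1 \o l2) <= e.
  apply: kP => [t||]; [exact: law_ge0|exact: law_sum1|].
  rewrite /law (_ : _ @^-1` _ = \bigcup_i C i); last first.
    apply/seteqP; split => x /=; rewrite /th1 /l2/=.
      by case: ifP => // /asboolP.
    by move=> Cx; rewrite /bb asboolT.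
  have mU : measurable (\bigcup_i C i : set B).
    by apply: fin_bigcup_measurable => // i _; exact: closed_borel.
  have : mu (~` \bigcup_i C i) = (1 - mu (\bigcup_i C i))%E by exact: probability_setC.
  by rewrite (fin_PM mu mU) => E; move: muC; rewrite E/=; lra.
(* Averages rather than sums are quantised, so the number of values of [zl] does not grow with [L];
   this is what makes [Zc] independent of [L]. *)
exists (ln #|{: {ffun J -> {ffun 'I_Q -> bool}} * 'I_q}|%:R) => L L0.
have L0' : 0 < L%:R :> R by rewrite ltr0n.
pose u j (x : B) : R := (bsum f (G j) L x / L%:R + Bd) / e.
have bsB j x : `|bsum f (G j) L x| <= L%:R * Bd.
  rewrite (le_trans (ler_norm_sum _ _ _))//.
  rewrite -[L in L%:R](card_ord L) -sum1_card natr_sum mulr_suml.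
  by apply: ler_sum => i _; rewrite mul1r.
have u0Q j x : 0 <= u j x <= Q%:R.
  have : `|bsum f (G j) L x / L%:R| <= Bd.
    by rewrite normrM normfV (gtr0_norm L0') ler_pdivrMr// mulrC.
  rewrite ler_norml => /andP[b1 b2].
  rewrite /u divr_ge0 ?(ltW e0)//=; last by lra.
  have : 2 * Bd / e < Q%:R by rewrite truncnS_gt.
  move=> /ltW; apply: le_trans; rewrite ler_pM2r ?invr_gt0//; lra.
have mu_ j : measurable_fun [set: B] (u j).
  apply: continuous_mfun => x; apply: cvgM; last exact: cvg_cst.
  apply: cvgD; last exact: cvg_cst.
  by apply: cvgM; [exact: bsum_continuous|exact: cvg_cst].
pose cells (x : B) := [ffun j => levels Q (u j) x].
have mcells : mlabel cells by apply: mlabel_ffun => j; exact: mlabel_levels.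
pose zl (x : B) := (cells x, ix x).
have mzl : mlabel zl by exact: mlabel_pair.
pose blk (x : B) := (bword f l2 0 L x, zl x).
have mblk : mlabel blk by apply: mlabel_pair => //; exact: mlabel_word.
pose th (t : {ffun 'I_L -> I * bool} * ({ffun J -> {ffun 'I_Q -> bool}} * 'I_q)) :=
  ([ffun i => th1 (t.1 i)], t.2).
(* One representative per atom: in the atom whenever it is nonempty, and nonwandering when the atom
   has positive mass. *)
have /choice[xt xtP] t : exists x, ((exists y, blk y = t) -> blk x = t) /\
    (0 < law mu blk t -> nonwandering f x).
  have [/(nw_point (mblk t))[x xt nx]|le] := pselect (0 < law mu blk t).
    by exists x.
  have [[y yt]|ny] := pselect (exists y, blk y = t); last by exists point.
  by exists y.
have xtblk t : 0 < law mu blk t -> blk (xt t) = t.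
  by move=> /[dup] t0 /(nw_point (mblk t))[x xt0 _]; apply: (xtP t).1; exists x.
exists _, _, (law mu blk), th, (fun t => t.2.2), xt; split.
- by split; [exact: law_ge0|exact: law_sum1].
- rewrite (le_trans (hle L0))//; apply: ent_factor => //.
  move=> x y [/ffunP xy _ _]; apply/ffunP => i; have := xy i; rewrite !ffunE.
  by case.
- rewrite -law_comp//.
  have mw : mlabel (bword f (th1 \o l2) 0 L) by exact: mlabel_word.
  apply: (@le_trans _ _ (ent mu (fun x => (bword f (th1 \o l2) 0 L x, zl x)))).
    apply: ent_factor; first exact: mlabel_pair.
    move=> x y [/ffunP xy xz yz]; rewrite /= /th /= /zl xz yz; congr pair.
    by apply/ffunP => i; have := xy i; rewrite !ffunE.
  apply: (le_trans (ent_pair mu mw mzl)); apply: lerD; last exact: ent_le_card.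
  apply: (le_trans (ent_word_le_mul L mf mth inv)).
  by rewrite ler_pM2l.
- split => [t t0|].
    have -> : t.2.2 = ix (xt t) by rewrite -{1}(xtblk t t0).
    exact: ixP _ ((xtP t).2 t0).
  split => [t t' [_ ->]//|t t' t0 t0' [/ffunP e1 e2] close].
  have bt := xtblk t t0; have bt' := xtblk t' t0'.
  rewrite [t]surjective_pairing [t']surjective_pairing e2; congr pair.
  apply/ffunP => i; have := e1 i; rewrite !ffunE -bt -bt' /blk/= !ffunE/= add0n.
  rewrite /th1 /l2/=.
  have := close i (ltn_ord i).
  set x := iter i f (xt t); set y := iter i f (xt t') => xy.
  (* Equality of [th] excludes mixed cases. If both labels are hidden, the two points are [r]-close
     in sets [C], hence in the same one; otherwise [th] displays both labels. *)
  rewrite /bb; case: asboolP => [[c _ Cx]|nx]; case: asboolP => [[c' _ Cy]|ny]//.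
    move=> _; congr pair.
    have /= -> := Cl c x Cx; have /= -> := Cl c' y Cy; exact: sep Cx Cy xy.
  by move=> [->].
- move=> j; rewrite -(RI_bsum cX L cf (@cG j) inv).
  have := @RI_label _ _ B mu _ blk (fun t => bsum f (G j) L (xt t)) mblk => <-.
  apply: RI_dist.
  + exact: (bmeas_label (fun t => bsum f (G j) L (xt t)) mblk).
  + by apply: continuous_bmeas => //; exact: bsum_continuous.
  (* A point and the representative of its atom have the same levels, so their averages differ by at
     most [e]. *)
  + move=> x; have : blk (xt (blk x)) = blk x by apply: (xtP _).1; exists x.
    move=> [_ /ffunP/(_ j)]; rewrite !ffunE => /(levels_dist (u0Q j)) + _.
    rewrite /u -mulrBl opprD addrACA subrr addr0 -mulrBl.
    rewrite normrM normfV (gtr0_norm e0) ler_pdivrMr// mul1r.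
    by rewrite normrM normfV (gtr0_norm L0') ler_pdivrMr// mulrC.
Qed.

End block_code.

Lemma block_sums_ord (R : realType) (c : nat -> R) K (d : 'I_K -> nat -> R) (L : nat)
    (Ms : 'I_K -> nat) (n : nat) (M e : R) :
  (forall i, `|c i| <= M) -> (\sum_t (L + Ms t) <= n)%N ->
  (forall (j : 'I_K) i, (i < L)%N ->
     `|c (i + \sum_(t < K | (t < j)%N) (L + Ms t))%N - d j i| <= e) ->
  `|\sum_(i < n) c i - \sum_(j < K) \sum_(i < L) d j i|
    <= K%:R * L%:R * e + (n%:R - K%:R * L%:R) * M.
Proof.
case: K d Ms => [|K] d Ms cM Mn h.
  have := @block_sums R c (fun _ _ => 0) L (fun=> 0%N) 0 n M e cM.
  by rewrite !big_ord0; apply.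
pose Ms' t := Ms (inord t); pose d' j := d (inord j).
have := @block_sums R c d' L Ms' K.+1 n M e cM.
have E j : (j <= K.+1)%N ->
    (\sum_(t < j) (L + Ms' t) = \sum_(t < K.+1 | (t < j)%N) (L + Ms t))%N.
  move=> jK; rewrite (big_ord_widen K.+1 (fun t => L + Ms' t)%N jK).
  by apply: eq_bigr => t _; rewrite /Ms' inord_val.
have -> : \sum_(j < K.+1) \sum_(i < L) d j i = \sum_(j < K.+1) \sum_(i < L) d' j i.
  by apply: eq_bigr => j _; rewrite /d' inord_val.
apply.
  rewrite E// (eq_bigl xpredT)// => t; exact: ltn_ord.
move=> j i jK iL; rewrite E ?(ltnW jK)//.
by have := h (inord j) i iL; rewrite inordK.
Qed.

(** * Error budgets of the lower bound *)

Section lower_bound_arithmetic.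
Context {R : realType}.
Implicit Types (n K L d rho M : R).

(** [S] is the Birkhoff sum of the glued orbit, [F] the sum over its blocks, [a] the mean over one
    block, [rho] the integral. There are four errors of at most n d / 20 each: shadowing, times
    outside the blocks, typicality, coding. *)
Lemma deviation_arith n K L d rho M S F a :
  0 <= K -> 0 <= d -> 1 <= L -> K * L <= n -> (n - K * L) * (2 * M) <= n * (d / 20) ->
  `|rho| <= M -> `|S - F| <= K * L * (d / 20) + (n - K * L) * M ->
  `|F - K * a| <= K * (d / 20) -> `|a - L * rho| <= L * (d / 20) ->
  `|S - n * rho| <= n * (d / 5).
Proof.
move=> K0 d0 L1 KLn loss rhoM SF Fa aL.
have e1 : `|K * a - K * (L * rho)| <= K * (L * (d / 20)).
  by rewrite -mulrBr normrM ger0_norm// ler_wpM2l.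
have e2 : `|(n - K * L) * rho| <= (n - K * L) * M.
  by rewrite normrM ger0_norm ?subr_ge0// ler_wpM2l// subr_ge0.
have e3 : K * L * d <= n * d by rewrite ler_wpM2r.
have e4 : K * d <= K * L * d by rewrite ler_wpM2r// ler_peMr.
move: SF Fa e1 e2; rewrite !ler_norml; lra.
Qed.

(** [Hp] and [Hth] are the entropies of a block and of its side information, [lM] the logarithm of
    the number of gap lengths, [l2] that of 2. The right side is the exponent of the number of
    typical sequences times the measure of a ball, divided by the multiplicity. The losses add up to
    at most 11 n d / 20. *)
Lemma exponent_arith n K L d h rho M Hp Hth Zc lM l2 :
  0 <= n -> 0 <= K -> 0 <= d -> 1 <= L -> K * L <= n -> 0 <= h -> h <= 2 * M ->
  (n - K * L) * (2 * M) <= n * (d / 20) -> h * L <= Hp -> Hth <= L * (d / 20) + Zc ->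
  20 * (`|Zc| + lM) <= L * d -> 20 * l2 <= n * d ->
  n * (h - rho - d) <=
    - (K * lM + K * (Hth + d / 20)) + (K * (Hp - d / 20) - l2 + (- (n * rho) - n * (d / 4))).
Proof.
move=> n0 K0 d0 L1 KLn h0 hM loss Hph Hthle ZL l2n.
have k1 : K * (h * L) <= K * Hp by rewrite ler_wpM2l.
have k2 : K * Hth <= K * (L * (d / 20) + Zc) by rewrite ler_wpM2l.
have k3 : K * (20 * (`|Zc| + lM)) <= K * (L * d) by rewrite ler_wpM2l.
have k4 : K * Zc <= K * `|Zc| by rewrite ler_wpM2l// ler_norm.
have k5 : K * L * d <= n * d by rewrite ler_wpM2r.
have k6 : K * d <= K * L * d by rewrite ler_wpM2r// ler_peMr.
have k7 : (n - K * L) * h <= n * (d / 20).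
  by apply: le_trans loss; rewrite ler_wpM2l ?subr_ge0.
have k8 : 0 <= n * d by rewrite mulr_ge0.
lra.
Qed.

End lower_bound_arithmetic.

(** * Lower bound for one partition *)

Section lower_bound.
Context {R : realType} {X : pmetricType R}.
Notation B := (@borel R X).
Notation PM := (probability B R).
Notation bword := (@word _ B).
Variables (f : X -> X) (m mu : PM) (phi : X -> R).
Variables (J I : finType) (G : J -> X -> R) (l : B -> I) (j0 : J).
Hypotheses (cX : compact [set: X]) (cf : continuous f) (invmu : Defs.invariant f mu).
Hypotheses (cG : forall j, continuous (G j)) (Gphi : forall x, G j0 x = phi x) (ml : mlabel l).
Hypothesis spec : W_specification f.
Hypothesis A2 :
  exists l : \bar R, lower_bowen f m phi eps @[eps --> 0^'+] --> l /\ (0 <= l)%E.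

Let bounded (h : R) : 0 <= h -> exists2 Bd : R, h <= Bd & forall j x, `|G j x| <= Bd.
Proof.
move=> h0; have /choice[M MP] j := continuous_bounded cX (@cG j).
exists (h + \sum_j `|M j|); first by rewrite lerDl sumr_ge0.
move=> j x; rewrite (le_trans (MP j x))// (le_trans (ler_norm _))//.
by rewrite (bigD1 j)//= addrCA lerDl addr_ge0// sumr_ge0.
Qed.

Let unif (d : R) : 0 < d -> exists2 r : R, 0 < r & forall j x y, mdist x y <= r -> `|G j x - G j y| <= d / 20.
Proof.
move=> d0; have d20 : 0 < d / 20 by rewrite divr_gt0.
have /choice[r rP] j : exists r : R, 0 < r /\
    forall x y, mdist x y <= r -> `|G j x - G j y| <= d / 20.
  by have [r r0 rP] := unif_continuous_compact cX (@cG j) d20; exists r.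
have [r0 r00 rle] := finite_lower_bound (fun j => (rP j).1).
by exists r0 => // j x y xy; apply: (rP j).2; exact: le_trans (rle j).
Qed.

(* Blocks of length L drawn independently from the block code are glued by
   specification after sorting them by the index of the piece [Xs]; a point lies in
   few of the resulting Bowen balls because it determines the blocks up to the gap
   lengths and the side information [th]. *)
Lemma lower_bound_main (h d : R) : 0 <= h -> 0 < d ->
  (forall n, (0 < n)%N -> h * n%:R <= ent mu (bword f l 0 n)) -> exists N, forall n (A : set B), (N <= n)%N -> measurable A ->
  (forall x, (forall j, `|bsum f (G j) n x - n%:R * RI mu (G j)| <= n%:R * d) -> A x) ->
  expR (n%:R * (h - RI mu phi - d)) <= fine (m A).
Proof.
move=> h0 d0 hle; have d20 : 0 < d / 20 by lra.
have [q [Xs [cXs _ nwXs sp]]] := spec.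
have [r r0 [Zc code]] := block_code cX cf invmu cG ml hle cXs nwXs d20.
have [ru ru0 ruP] := unif d0; have [Bd hBd GB] := bounded h0.
have Bd0 : 0 <= Bd := le_trans h0 hBd.
have hBd2 : h <= 2 * Bd by lra.
have d5 : d / 5 <= d by lra.
(* Two blocks tracked by one point are within 2 eps + 2 eps, which must not exceed [r]; [ru]
   controls the observables at distance 2 eps. *)
have rr0 : 0 < Num.min (r / 4) (ru / 2) by rewrite lt_min !divr_gt0.
have [eps /andP[eps0 epsr] [N0 ball]] := lower_bowen_ball cf A2 d20 rr0.
have {epsr} [eps4 eps2] : eps < r / 4 /\ eps < ru / 2.
  by move: epsr; rewrite lt_min => /andP.
have {}eps4 : 2 * eps + 2 * eps <= r by lra.
have {}eps2 : 2 * eps <= ru by lra.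
have [M {}sp] := sp eps eps0.
pose lM : R := ln M.+1%:R.
have lM0 : 0 <= lM by rewrite ln_ge0// ler1n.
(* [L] is so large that, per block, a gap of length at most [M] and the fixed cost [|Zc| + lM] are
   small fractions of [L * d]. *)
pose L := (Num.truncn ((80 * Bd * M%:R + 20 * (`|Zc| + lM)) / d)).+1.
have L1 : 1 <= L%:R :> R by rewrite ler1n.
have BM0 : 0 <= Bd * M%:R by rewrite mulr_ge0.
have Zc0 := normr_ge0 Zc.
have Lbig : 80 * Bd * M%:R + 20 * (`|Zc| + lM) <= L%:R * d.
  by rewrite -ler_pdivrMr// ltW// truncnS_gt.
have LM : 80 * Bd * M%:R <= L%:R * d by lra.
have LZ : 20 * (`|Zc| + lM) <= L%:R * d by lra.
(* The loss d/4 is the deviation d/5 of the Birkhoff sum plus the d/20 of [ball]. *)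
have ball_arith (N S rho : R) : S <= N * (d / 5) + N * rho ->
    - (N * rho) - N * (d / 4) <= - S - N * (d / 20) by lra.
have [T [Th [p [th [ind [xt [[p0 p1] pH pth [xtX [thind thsep]] pG]]]]]]] := code L (ltn0Sn _).
have [K0 typ] := typical_sequences th (fun j t => bsum f (G j) L (xt t)) p0 p1 d20.
(* [n] has to absorb the leftover times, fewer than [L + M], and the factor 1/2 in the number of
   typical sequences. *)
pose N3 := (Num.truncn ((80 * Bd * (L + M)%:R + 20 * ln 2) / d)).+1.
exists (maxn N0 (maxn (K0.+1 * (L + M)) N3)) => n A.
rewrite !geq_max => /and3P[nN0 nK0 nN3] mA AP.
have n0 : 0 <= n%:R :> R by [].
have l20 : 0 <= ln 2 :> R by rewrite ln_ge0// ler1n.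
have LM0 : 0 <= Bd * (L + M)%:R by rewrite mulr_ge0.
have nbig : 80 * Bd * (L + M)%:R + 20 * ln 2 <= n%:R * d.
  rewrite -ler_pdivrMr// ltW// (lt_le_trans (truncnS_gt _))//.
  by rewrite ler_nat.
have n2 : 20 * ln 2 <= n%:R * d by lra.
pose K := (n %/ (L + M))%N.
have KK0 : (K0 < K)%N by rewrite leq_divRL// addSn.
have KLMn : (K * (L + M) <= n)%N by exact: leq_divM.
have nKLM : (n < K.+1 * (L + M))%N by rewrite ltn_ceil.
have KLn : K%:R * L%:R <= n%:R :> R.
  by rewrite -natrM ler_nat (leq_trans _ KLMn)// leq_mul2l leq_addr orbT.
have K0' : 0 <= K%:R :> R by [].
have KleKL : K%:R <= K%:R * L%:R :> R by rewrite ler_peMr.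
have loss : (n%:R - K%:R * L%:R) * (2 * Bd) <= n%:R * (d / 20).
  have e1 : n%:R - K%:R * L%:R <= K%:R * M%:R + (L + M)%:R :> R.
    move: (ltnW nKLM); rewrite -(ler_nat R) mulSn natrD natrM natrD; lra.
  have e2 : (n%:R - K%:R * L%:R) * (2 * Bd) <= (K%:R * M%:R + (L + M)%:R) * (2 * Bd).
    by rewrite ler_wpM2r// mulr_ge0.
  have e3 : K%:R * (80 * Bd * M%:R) <= K%:R * (L%:R * d) by rewrite ler_wpM2l.
  have e4 : K%:R * L%:R * d <= n%:R * d by rewrite ler_wpM2r// ltW.
  lra.
have [S [Sp SF Scard thcard]] := typ K (ltnW KK0) (leq_ltn_trans (leq0n _) KK0).
have /choice[sgf sgfP] (a : {ffun 'I_K -> 'I_q}) : exists sg : 'I_K -> 'I_K, injective sg /\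
    forall i j : 'I_K, (i <= j)%N -> (a (sg i) <= a (sg j))%N.
  by have [sg sgi sgm] := sorting_perm a; exists sg.
(* The permutation depends on the index sequence only, so sequences with the same side information
   are sorted alike. *)
pose sg (s : {ffun 'I_K -> T}) := sgf [ffun j => ind (s j)].
have sgi s : injective (sg s) by exact: (sgfP _).1.
pose pos (Ms : {ffun 'I_K -> 'I_M.+1}) (j : 'I_K) :=
  (\sum_(t < K | (t < j)%N) (L + Ms t))%N.
have /choice[yM yMP] (s : {ffun 'I_K -> T}) : exists yM : X * {ffun 'I_K -> 'I_M.+1},
    s \in S -> forall (j : 'I_K) i, (i < L)%N ->
    mdist (iter i f (xt (s (sg s j)))) (iter (i + pos yM.2 j) f yM.1) <= eps.
  have [sS|] := boolP (s \in S); last by exists (point, [ffun=> ord0]).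
  have [||||y [Ms [MsM yP]]] := sp K (fun j => ind (s (sg s j))) (fun j => xt (s (sg s j)))
      (fun=> L).
  - exact: leq_ltn_trans (leq0n _) KK0.
  - move=> i j ij; have := (sgfP [ffun j => ind (s j)]).2 i j ij; rewrite !ffunE; exact.
  - by move=> j; apply: xtX; exact: Sp.
  - by [].
  exists (y, [ffun t => inord (Ms t)]) => _ j i iL; have := yP j i iL.
  have -> // : pos [ffun t => inord (Ms t)] j = (\sum_(t < K | (t < j)%N) (L + Ms t))%N.
  by apply: eq_bigr => t _; rewrite ffunE inordK// ltnS.
have posn (Ms : {ffun 'I_K -> 'I_M.+1}) : (\sum_t (L + Ms t) <= n)%N.
  apply: leq_trans KLMn; rewrite -[K in (K * _)%N]card_ord -sum_nat_const.
  by apply: leq_sum => t _; rewrite leq_add2l -ltnS ltn_ord.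
have posj Ms j i : (i < L)%N -> (i + pos Ms j < n)%N.
  move=> iL; apply: (leq_trans _ (posn Ms)); rewrite (bigID (fun t : 'I_K => (t < j)%N))/=.
  rewrite addnC -/(pos Ms j) -addnS leq_add2l (bigD1 j)/= ?ltnn//.
  by rewrite -addnA (leq_trans iL)// leq_addr.
pose BB s := bowen f n (yM s).1 eps.
have track s z j i : s \in S -> BB s z -> (i < L)%N ->
    mdist (iter i f (xt (s (sg s j)))) (iter (i + pos (yM s).2 j) f z) <= 2 * eps.
  move=> sS Bz iL; have := yMP s sS j i iL; have := Bz _ (posj (yM s).2 j i iL).
  set a := iter i f _; set b := iter _ f (yM s).1; set c := iter _ f z.
  move=> bc ab; rewrite (le_trans (metric_triangle a b c))// mulr_natl mulr2n.
  exact: lerD.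
have dev s z : s \in S -> BB s z -> forall j,
    `|bsum f (G j) n z - n%:R * RI mu (G j)| <= n%:R * (d / 5).
  move=> sS Bz j.
  have hh : `|bsum f (G j) n z - \sum_(jj < K) bsum f (G j) L (xt (s jj))| <=
       K%:R * L%:R * (d / 20) + (n%:R - K%:R * L%:R) * Bd.
    rewrite [X in _ - X](reindex_inj (sgi s))/=.
    apply: (@block_sums_ord R (fun i => G j (iter i f z)) K
      (fun jj i => G j (iter i f (xt (s (sg s jj))))) L (fun t => (yM s).2 t) n) => //.
    move=> jj i iL; rewrite distrC; apply: ruP.
    exact: le_trans (track s z jj i sS Bz iL) eps2.
  have rhoB : `|RI mu (G j)| <= Bd.
    by apply: pos_functional_le => //; exact: pos_functional_RI.
  exact: deviation_arith K0' (ltW d0) L1 KLn loss rhoB hh (SF s sS j) (pG j).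
have BBA s : s \in S -> BB s `<=` A.
  move=> sS z Bz; apply: AP => j; apply: (le_trans (dev s z sS Bz j)).
  exact: ler_wpM2l.
have mBB s : measurable (BB s : set B) by apply: closed_borel; exact: bowen_closed.
have ballBB s : s \in S -> expR (- (n%:R * RI mu phi) - n%:R * (d / 4)) <= fine (m (BB s)).
  move=> sS; apply: le_trans (ball n (yM s).1 nN0); rewrite ler_expR.
  have : BB s (yM s).1 by move=> j _; rewrite mdistxx ltW.
  move=> /(dev s _ sS)/(_ j0); rewrite (funext Gphi) ler_norml => /andP[_].
  by rewrite lerBlDr => /ball_arith.
pose E := [set [ffun j => th (s j)] | s : {ffun 'I_K -> T} in S].
pose mult := (M.+1 ^ K * #|E|)%N.
have multP z : (#|[set s in S | `[< BB s z >]]| <= mult)%N.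
  (* Among sequences whose balls contain [z], gaps and side information determine the blocks: equal
     gaps put corresponding blocks at the same times, both are then within 2 eps of the orbit of
     [z], and [thsep] identifies them. *)
  pose enc (s : {ffun 'I_K -> T}) := ((yM s).2, [ffun j => th (s j)]).
  rewrite -(@card_in_imset _ _ enc); last first.
    move=> s s'; rewrite !inE => /andP[sS /asboolP Bs] /andP[sS' /asboolP Bs'] [eM eth].
    have eths j : th (s j) = th (s' j) by move/ffunP/(_ j): eth; rewrite !ffunE.
    have esg : sg s = sg s'.
      by rewrite /sg; congr sgf; apply/ffunP => j; rewrite !ffunE; exact: thind.
    have ssg j : s (sg s j) = s' (sg s j).
      apply: thsep; rewrite ?Sp//.
      move=> i iL; have := track s z j i sS Bs iL; have := track s' z j i sS' Bs' iL.
      rewrite -eM -esg; set a := iter i f _; set b := iter _ f z; set c := iter i f _.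
      move=> ba bc; rewrite (le_trans (metric_triangle c b a))//.
      by rewrite (metric_sym b a) (le_trans (lerD bc ba)).
    apply/ffunP => j; have [k kK skj] := injF_bij (sgi s).
    by rewrite -(skj j) ssg.
  have -> : mult = #|finset.setX [set: {ffun 'I_K -> 'I_M.+1}] E|.
    by rewrite cardsX cardsT card_ffun !card_ord.
  apply/subset_leq_card/fintype.subsetP => w /imsetP[s sV ->]; move: sV; rewrite !inE => /andP[sS _].
  by apply: imset_f.
(* Integrating the pointwise multiplicity bound controls the sum of the measures of overlapping
   balls. *)
have sumB : \sum_(s in S) fine (m (BB s)) <= mult%:R * fine (m A).
  rewrite -(RI_indic m mA) -RIZ; last exact: bmeas_indic.
  rewrite (eq_bigr (fun s => RI m (\1_(BB s)))) => [|s _]; last by rewrite RI_indic.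
  rewrite -big_enum/= -(@RI_sum _ _ B m _ (enum S) (fun s => \1_(BB s) : B -> R)); last first.
    by move=> s; exact: bmeas_indic.
  apply: RI_le.
  - by apply: bmeas_sum => s; exact: bmeas_indic.
  - by apply: bmeasZ; exact: bmeas_indic.
  move=> z; rewrite big_enum/=.
  have -> : \sum_(s in S) (\1_(BB s) z : R) = #|[set s in S | `[< BB s z >]]|%:R.
    rewrite -sum1_card natr_sum big_mkcond [RHS]big_mkcond/=; apply: eq_bigr => s _.
    rewrite !inE indicE; case: ifP => //= _.
    have -> : (z \in BB s) = `[< BB s z >] by apply/idP/asboolP; rewrite inE.
    by case: asboolP.
  have [->|] := eqVneq [set s in S | `[< BB s z >]] finset.set0.
    by rewrite cards0 mulr_ge0// indicE.
  move=> /set0Pn[s]; rewrite inE => /andP[sS /asboolP Bs].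
  by rewrite indicE mem_set ?mulr1 ?ler_nat//; exact: BBA Bs.
have low : #|S|%:R * expR (- (n%:R * RI mu phi) - n%:R * (d / 4)) <= mult%:R * fine (m A).
  apply: le_trans sumB; rewrite -sum1_card natr_sum mulr_suml.
  by apply: ler_sum => s sS; rewrite mul1r; exact: ballBB.
have A0 : 0 <= fine (m A) by rewrite fine_ge0.
have up : mult%:R * fine (m A) <=
    expR (K%:R * lM) * expR (K%:R * (fent (marg th p) + d / 20)) * fine (m A).
  rewrite ler_wpM2r// natrM ler_pM//.
  by rewrite natrX -[in leLHS](@lnK _ M.+1%:R) ?posrE// -expRM_natl.
have {low up} := le_trans low up.
have : expR (K%:R * (fent p - d / 20)) / 2 * expR (- (n%:R * RI mu phi) - n%:R * (d / 4)) <=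
    #|S|%:R * expR (- (n%:R * RI mu phi) - n%:R * (d / 4)).
  by rewrite ler_wpM2r ?expR_ge0.
move=> /le_trans h1 /h1.
have e2 : 2 = expR (ln 2) :> R by rewrite lnK ?posrE.
rewrite [X in _ / X * _ <= _ -> _]e2 -expRN -!expRD -ler_pdivrMl ?expR_gt0//.
rewrite -expRN -expRD; apply: le_trans; rewrite ler_expR.
exact: exponent_arith n0 K0' (ltW d0) L1 KLn h0 hBd2 loss pH pth LZ n2.
Qed.

End lower_bound.

(** * Partitions with null boundaries *)

Section null_boundaries.
Context {R : realType} {X : pmetricType R}.
Notation B := (@borel R X).
Notation PM := (probability B R).
Notation bword := (@word _ B).
Implicit Types (nu : PM) (A O D : set X) (x y : X) (f : X -> X).
Hypothesis cX : compact [set: X].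

Lemma mdist_continuous x : continuous (mdist x).
Proof.
apply: continuous_dist => y e e0; exists e => // z yz.
have := metric_triangle x y z; have := metric_triangle x z y.
by rewrite (metric_sym z y) ler_norml; lra.
Qed.

Lemma open_mball x (r : R) : open [set y | mdist x y < r].
Proof.
apply: (open_comp (f := mdist x) (D := [set s | s < r])).
  by move=> y _; exact: mdist_continuous.
exact: open_lt.
Qed.

Lemma closed_mball x (r : R) : closed [set y | mdist x y <= r].
Proof.
apply: (preimage_closed (f := mdist x) (D := [set s | s <= r])).
  by move=> y _; exact: mdist_continuous.
exact: closed_le.
Qed.

(* Distinct spheres of positive measure give disjoint nonempty open intervals
   ]nu(open ball), nu(closed ball)[ of the line, so there are countably many. *)
Lemma null_sphere nu x (a b : R) : a < b ->
  exists2 r, a < r < b & nu [set y | mdist x y = r] = 0%E.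
Proof.
move=> ab; apply: contrapT => nr.
pose F r := fine (nu [set y | mdist x y < r]).
pose F' r := fine (nu [set y | mdist x y <= r]).
have mo r : measurable ([set y | mdist x y < r] : set B) by apply: open_borel; exact: open_mball.
have mc r : measurable ([set y | mdist x y <= r] : set B) by apply: closed_borel; exact: closed_mball.
have FF' r r' : r < r' -> F' r <= F r'.
  move=> rr'; rewrite -lee_fin -!fin_PM//; apply: le_measure; rewrite ?inE//.
  by move=> y /= /le_lt_trans; apply.
have ltF r : a < r < b -> F r < F' r.
  move=> rab; rewrite lt_neqAle -lee_fin -!fin_PM//; apply/andP; split; last first.
    by apply: le_measure; rewrite ?inE// => y /= /ltW.
  apply/eqP => e; apply: nr; exists r => //.
  have -> : [set y | mdist x y = r] = [set y | mdist x y <= r] `\` [set y | mdist x y < r].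
    apply/seteqP; split => y /=; first by move=> ->; rewrite ltxx.
    by move=> [le /negP]; rewrite -leNgt => ge; apply/eqP; rewrite eq_le le.
  have sub : [set y | mdist x y < r] `<=` [set y | mdist x y <= r] by move=> y /= /ltW.
  have h : nu ([set y | mdist x y <= r] `\` [set y | mdist x y < r]) =
     adde (nu [set y | mdist x y <= r]) (oppe (nu [set y | mdist x y < r])).
    rewrite measureD//; last by rewrite (le_lt_trans (probability_le1 nu (mc r)))// ltry.
    by rewrite setIC (setIidl sub).
  by rewrite h (fin_PM nu (mc r)) (fin_PM nu (mo r)) -/(F r) -/(F' r) e; apply: (congr1 EFin); exact: subrr.
pose S := [set r | a < r < b].
pose Bi r := if pselect (a < r < b) then `]F r, F' r[%classic else setT.
have : countable S.
  apply: (@separated_open_countable R R Bi S).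
  - by move=> r; rewrite /Bi; case: pselect => ?; [exact: interval_open|exact: openT].
  - move=> r; rewrite /Bi; case: pselect => [rab|?]; last by exists 0.
    exists ((F r + F' r) / 2); have := ltF r rab; rewrite /= in_itv/=; lra.
  - apply/trivIsetP => r r' Sr Sr' rr'; apply/seteqP; split => // s.
    rewrite /Bi; case: pselect => // ?; case: pselect => // ?; rewrite /= !in_itv/=.
    move: rr'; rewrite neq_lt => /orP[] /FF' le [/andP[s1 s2] /andP[s3 s4]]; lra.
(* The radii in ]a, b[ would be countably many, against the positive length of the interval. *)
move=> /countable_lebesgue_measure0.
have -> : S = `]a, b[%classic by apply/seteqP; split => r /=; rewrite in_itv.
rewrite lebesgue_measure_itv/= lte_fin ab => -[]; lra.
Qed.

(** A form of null boundary that passes to finite intersections and to preimages without computing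
    any boundary. *)
Definition Jset nu A := exists O D,
  [/\ open O, closed D, O `<=` A, A `<=` D & nu (D `\` O) = 0%E].

Lemma Jset_bigcap nu (T : finType) (A : T -> set X) : (forall t, Jset nu (A t)) ->
  Jset nu (\bigcap_(t in [set: T]) A t).
Proof.
move=> /choice[V /choice[D VD]].
have oV t : open (V t) by have [] := VD t.
have cD t : closed (D t) by have [] := VD t.
exists (\bigcap_(t in [set: T]) V t), (\bigcap_(t in [set: T]) D t); split.
- rewrite -[X in open X]setCK; apply: closed_openC; rewrite setC_bigcap.
  apply: closed_bigcup => [|t _]; [exact: finite_finset|exact: open_closedC].
- by apply: closed_bigI => t _.
- by move=> x h t _; have [_ _ + _ _] := VD t; apply; exact: h.
- by move=> x h t _; have [_ _ _ + _] := VD t; apply; exact: h.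
- have mDO t : measurable (D t `\` V t : set B).
    by apply: measurableD; [exact: closed_borel|exact: open_borel].
  have mcap : measurable (\bigcap_(t in [set: T]) D t `\` \bigcap_(t in [set: T]) V t : set B).
    by apply: measurableD; apply: fin_bigcap_measurable => // t _;
       [exact: closed_borel|exact: open_borel].
  apply/eqP; rewrite eq_le measure_ge0 andbT.
  have sub : \bigcap_(t in [set: T]) D t `\` \bigcap_(t in [set: T]) V t `<=`
      \bigcup_(t in [set: T]) (D t `\` V t).
    move=> x [Dx nOx]; apply: contrapT => h; apply: nOx => t _; apply: contrapT => nO.
    by apply: h; exists t => //; split => //; exact: Dx.
  have fT : finite_set [set: T] by exact: finite_finset.
  apply: (le_trans (content_sub_fsum nu fT (fun t _ => mDO t) mcap sub)).
  by rewrite fsbig1// => t _; have [_ _ _ _ h] := VD t; exact: h.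
Qed.

Lemma Jset_iter nu f n A : continuous f -> Defs.invariant f nu -> Jset nu A ->
  Jset nu (iter n f @^-1` A).
Proof.
move=> cf iv [V [D [oV cD VA AD DV]]].
have ci := @continuous_iter R X f n cf.
exists (iter n f @^-1` V), (iter n f @^-1` D); split.
- by apply: open_comp => // x _; exact: ci.
- by apply: preimage_closed => // x _; exact: ci.
- by move=> x /VA.
- by move=> x /AD.
- rewrite -DV; apply: (invariant_iter (continuous_borel cf) iv).
  by apply: measurableD; [exact: closed_borel|exact: open_borel].
Qed.

(** Finitely many balls with null spheres and radii below e/2 cover the space; the label of a point
    tells which of them contain it. *)
Lemma small_label nu (e : R) : 0 < e -> exists (I : finType) (l : B -> I),
  [/\ mlabel l, forall x y, l x = l y -> mdist x y <= e & forall i, Jset nu (l @^-1` [set i])].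
Proof.
move=> e0.
have e24 : e / 4 < e / 2 by lra.
have /choice[r rP] x : exists r : R, e / 4 < r < e / 2 /\ nu [set y | mdist x y = r] = 0%E.
  by have [r ? ?] := null_sphere nu x e24; exists r.
have : compact [set: X] by [].
rewrite compact_cover => /(_ X setT (fun x => [set y | mdist x y < r x]))[].
- by move=> x _; exact: open_mball.
- by move=> x _; exists x => //=; rewrite mdistxx; have [/andP[]] := rP x; lra.
move=> D _ cov.
pose N := size (finmap.enum_fset D); pose c (i : 'I_N) := nth point (finmap.enum_fset D) i.
have covc x : exists i, mdist (c i) x < r (c i).
  have [y /= yD yx] := cov x I.
  have iN : (index y (finmap.enum_fset D) < N)%N by rewrite index_mem.
  by exists (Ordinal iN); rewrite /c/= nth_index.
pose b i (x : B) : bool := mdist (c i) x < r (c i).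
have mo i : measurable ([set y | mdist (c i) y < r (c i)] : set B).
  by apply: open_borel; exact: open_mball.
have mb i : mlabel (b i).
  have := mlabel_bool (mo i).
  by rewrite (_ : (fun x => _) = b i)//; apply/funext => x; rewrite asboolb.
pose l (x : B) := [ffun i => b i x].
exists _, l; split.
- exact: mlabel_ffun.
- move=> x y /ffunP xy; have [i ix] := covc x.
  have := xy i; rewrite !ffunE /b ix => /esym iy.
  have {}iy : mdist (c i) y < r (c i) by [].
  have := metric_triangle x (c i) y; rewrite (metric_sym x (c i)).
  have [/andP[_]] := rP (c i); lra.
- move=> w; rewrite (_ : _ @^-1` _ = \bigcap_(i in [set: 'I_N]) (b i @^-1` [set w i])); last first.
    apply/seteqP; split => [x /= <- i _ /=|x xw /=]; first by rewrite ffunE.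
    by apply/ffunP => i; rewrite ffunE; exact: xw.
  apply: Jset_bigcap => i; have sph := (rP (c i)).2.
  have [] := boolP (w i) => wi.
    exists [set y | mdist (c i) y < r (c i)], [set y | mdist (c i) y <= r (c i)]; split.
    + exact: open_mball.
    + exact: closed_mball.
    + by move=> x /= xr; rewrite /b xr.
    + by move=> x /=; rewrite /b => /ltW.
    + rewrite -sph; congr (nu _); apply/seteqP; split => x /=.
        by move=> [le /negP]; rewrite -leNgt => ge; apply/eqP; rewrite eq_le le.
      by move=> ->; rewrite ltxx.
  exists (~` [set y | mdist (c i) y <= r (c i)]), (~` [set y | mdist (c i) y < r (c i)]); split.
  + by apply: closed_openC; exact: closed_mball.
  + by apply: open_closedC; exact: open_mball.
  + move=> x /= /negP; rewrite -ltNge /b => lt.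
    by apply/negbTE; rewrite -leNgt ltW.
  + by move=> x /=; rewrite /b => ->.
  + rewrite -sph; congr (nu _); apply/seteqP; split => x /=.
      move=> [/negP + /contrapT le]; rewrite -leNgt => ge.
      by apply/eqP; rewrite eq_le le.
    by move=> ->; rewrite ltxx lexx; split.
Qed.

Lemma Jset_word nu f (I : finType) (l : B -> I) n w : continuous f -> Defs.invariant f nu ->
  (forall i, Jset nu (l @^-1` [set i])) -> Jset nu (bword f l 0 n @^-1` [set w]).
Proof.
move=> cf iv lJ.
rewrite (_ : _ @^-1` _ = \bigcap_(i in [set: 'I_n]) (iter i f @^-1` (l @^-1` [set w i]))).
  by apply: Jset_bigcap => i; exact: Jset_iter.
apply/seteqP; split => [x /= <- i _ /=|x xw /=]; first by rewrite ffunE.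
by apply/ffunP => i; rewrite ffunE; exact: xw.
Qed.

End null_boundaries.

(** * Entropy of limits of orbit averages *)

Section limit_entropy.
Context {R : realType} {X : pmetricType R}.
Notation B := (@borel R X).
Notation PM := (probability B R).
Notation bword := (@word _ B).
Variables (f : X -> X) (V : set_system nat) (sg : nat -> PM) (nu : PM).
Hypotheses (cX : compact [set: X]) (cf : continuous f) (UV : UltraFilter V).
Hypothesis Voo : forall N, V [set n | (N <= n)%N].
Hypothesis cvnu : forall g, continuous g ->
  n%:R^-1 * RI (sg n) (bsum f g n) @[n --> V] --> RI nu g.
Hypothesis ivnu : Defs.invariant f nu.

Let mf := continuous_borel cf.

Let PV : ProperFilter V. Proof. exact: ultra_proper. Qed.

(** The orbit average of [sg n] evaluated at [S]; only this number is needed, so the averaged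
    measure is not built. *)
Let ms n (S : set X) : R := n%:R^-1 * \sum_(j < n) fine (sg n (iter j f @^-1` S)).

Let mit j (S : set X) : measurable (S : set B) -> measurable (iter j f @^-1` S : set B).
Proof. by move=> mS; exact: (measurable_iter mf j mS). Qed.

Let ms_le n (S S' : set X) : measurable (S : set B) -> measurable (S' : set B) ->
  S `<=` S' -> ms n S <= ms n S'.
Proof.
move=> mS mS' SS'; rewrite ler_wpM2l ?invr_ge0//; apply: ler_sum => j _.
rewrite -lee_fin -!fin_PM; [|exact: mit|exact: mit].
by apply: le_measure; rewrite ?inE; [exact: mit|exact: mit|move=> x; exact: SS'].
Qed.

Let ms_setC n (S : set X) : (0 < n)%N -> measurable (S : set B) -> ms n (~` S) = 1 - ms n S.
Proof.
move=> n0 mS.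
have E j : fine (sg n (iter j f @^-1` ~` S)) = 1 - fine (sg n (iter j f @^-1` S)).
  have h : sg n (iter j f @^-1` ~` S) = (1 - sg n (iter j f @^-1` S))%E.
    by rewrite preimage_setC; apply: probability_setC; exact: mit.
  by rewrite h (fin_PM (sg n) (mit j mS)).
rewrite /ms (eq_bigr (fun j : 'I_n => 1 - fine (sg n (iter j f @^-1` S)))) => [|j _]; last exact: E.
rewrite sumrB sumr_const card_ord mulrBr.
by rewrite mulVf// pnatr_eq0 -lt0n.
Qed.

(** Half of the portmanteau theorem: some continuous [urys D i] above the indicator of [D] has
    integral close to [nu D]. *)
Let ms_closed (D : set X) (k : R) : closed D -> 0 < k ->
  \forall n \near V, ms n D <= fine (nu D) + k.
Proof.
move=> cD k0; have k20 : 0 < k / 2 by lra.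
have := @RI_urys _ _ cX nu _ cD => /cvgrPdist_le/(_ _ k20)/filter_ex[i].
rewrite ler_norml => /andP[hi _].
have cu := @urys_continuous R X D i.
have := cvnu cu => /cvgrPdist_le/(_ _ k20); apply: filterS => n.
rewrite ler_norml => /andP[hn _].
suff : ms n D <= n%:R^-1 * RI (sg n) (bsum f (urys D i) n) by lra.
rewrite ler_wpM2l ?invr_ge0//.
have bj (j : 'I_n) : bmeas (fun x : B => urys D i (iter j f x)).
  apply: continuous_bmeas => //; apply: continuous_compf => //.
  exact: continuous_iter.
have -> : RI (sg n) (bsum f (urys D i) n) = \sum_(j < n) RI (sg n) (fun x => urys D i (iter j f x)).
  exact: (@RI_sum _ _ B (sg n) 'I_n _ (fun j x => urys D i (iter j f x)) bj).
apply: ler_sum => j _.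
have mD := mit j (closed_borel cD).
rewrite -(RI_indic (sg n) mD); apply: RI_le => //; first exact: bmeas_indic.
move=> x; rewrite indicE; have [|nD] := boolP (x \in _); last exact: urys_ge0.
by rewrite inE => /= Dx; rewrite urys1.
Qed.

(** The bound for closed sets is used for [D] and for the complement of [W], whose masses under [nu]
    add up to 1. *)
Let ms_Jset (A : set X) (k : R) : measurable (A : set B) -> Jset nu A -> 0 < k ->
  \forall n \near V, `|ms n A - fine (nu A)| <= k.
Proof.
move=> mA [W [D [oW cD WA AD DW]]] k0.
have mW := open_borel oW; have mD := closed_borel cD.
have le1 (S S' : set X) : measurable (S : set B) -> measurable (S' : set B) -> S `<=` S' ->
    fine (nu S) <= fine (nu S').
  by move=> mS mS' SS'; rewrite -lee_fin -!fin_PM//; apply: le_measure; rewrite ?inE.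
have nuWD : fine (nu D) <= fine (nu W).
  have : (nu (W `|` (D `\` W)) <= nu W + nu (D `\` W))%E.
    by apply: measureU2 => //; exact: measurableD.
  have -> : W `|` (D `\` W) = D by apply: setDUK => x /WA/AD.
  by rewrite DW adde0 (fin_PM nu mW) (fin_PM nu mD) lee_fin.
have nuC : fine (nu (~` W)) = 1 - fine (nu W).
  have h : nu (~` W) = (1 - nu W)%E by exact: probability_setC.
  by rewrite h (fin_PM nu mW).
near=> n.
have n0 : (0 < n)%N by near: n; exact: Voo.
have h1 : ms n D <= fine (nu D) + k by near: n; exact: ms_closed.
have h2 : ms n (~` W) <= fine (nu (~` W)) + k.
  by near: n; apply: ms_closed => //; exact: open_closedC.
rewrite ms_setC// nuC in h2.
have := ms_le n mA mD AD; have := ms_le n mW mA WA.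
have := le1 _ _ mA mD AD; have := le1 _ _ mW mA WA.
by rewrite ler_norml; lra.
Unshelve. all: by end_near. Qed.

(** At fixed [q], Misiurewicz' inequality leads from words of length n to the mean of the entropies
    at times j < n, concavity to the entropy of the orbit average, and null boundaries to that of
    [nu]. Only upper semicontinuity of [nlnx] enters. *)
Lemma limit_entropy (I : finType) (l : B -> I) (b : R) : mlabel l ->
  (forall i, Jset nu (l @^-1` [set i])) ->
  (\forall n \near V, n%:R * b <= ent (sg n) (bword f l 0 n)) ->
  forall q, (0 < q)%N -> b * q%:R <= ent nu (bword f l 0 q).
Proof.
move=> ml lJ bent q q0; apply/ler_addgt0Pr => e e0.
have q0' : 0 < q%:R :> R by rewrite ltr0n.
have mw : mlabel (bword f l 0 q) by exact: mlabel_word.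
pose W := {ffun 'I_q -> I}.
have W0 : 0 < #|{: W}|%:R :> R.
  by rewrite ltr0n; apply/card_gt0P; exists (bword f l 0 q point).
have e20 : 0 < e / 2 / #|{: W}|%:R by rewrite !divr_gt0.
have : \forall n \near V, forall w : W,
    nlnx (ms n (bword f l 0 q @^-1` [set w])) <= nlnx (law nu (bword f l 0 q) w) + e / 2 / #|{: W}|%:R.
  apply: filter_forall => w.
  have [k k0 kP] := nlnx_usc (law_ge0 nu (bword f l 0 q) w) e20.
  have := ms_Jset (mw w) (Jset_word w cf ivnu lJ) k0.
  apply: filterS => n le; apply: kP; last exact: le.
  by rewrite mulr_ge0 ?invr_ge0// sumr_ge0// => j _; rewrite fine_ge0.
move=> hW.
pose lI : R := ln #|I|%:R.
have lI0 : 0 <= lI by rewrite ln_ge0// ler1n; apply/card_gt0P; exists (l point).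
have arith (n' q' b' E0 C SE EN : R) : q' * E0 <= C + SE -> SE <= n' * (EN + e / 2) ->
    C <= n' * (e / 2) -> q' * (n' * b') <= q' * E0 -> n' * (b' * q') <= n' * (EN + e).
  by lra.
have : \forall n \near V, b * q%:R <= ent nu (bword f l 0 q) + e.
  near=> n.
  have nN : ((Num.truncn (q%:R ^+ 2 * lI / (e / 2))).+1 <= n)%N by near: n; exact: Voo.
  have n0 : 0 < n%:R :> R by rewrite ltr0n (leq_trans _ nN).
  have qn : q%:R ^+ 2 * lI <= n%:R * (e / 2).
    rewrite -ler_pdivrMr ?divr_gt0// ltW// (lt_le_trans (truncnS_gt _))//.
    by rewrite ler_nat.
  have hb : n%:R * b <= ent (sg n) (bword f l 0 n) by near: n.
  have hw : forall w : W, nlnx (ms n (bword f l 0 q @^-1` [set w])) <=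
      nlnx (law nu (bword f l 0 q) w) + e / 2 / #|{: W}|%:R by near: n.
  have mis := misiurewicz mf (sg n) ml q n; rewrite -/lI in mis.
  have conc := @fent_concave R W n (fun=> n%:R^-1) (fun j => law (sg n) (bword f l j q)).
  have : n%:R^-1 * (\sum_(j < n) ent (sg n) (bword f l j q)) <=
      \sum_w nlnx (ms n (bword f l 0 q @^-1` [set w])).
    rewrite mulr_sumr; apply: le_trans (conc _ _ _) _.
    - by move=> _; rewrite invr_ge0 ltW.
    - by rewrite sumr_const card_ord -[_ *+ n]mulr_natl divff// gt_eqF.
    - by move=> j w; exact: law_ge0.
    - rewrite /fent; apply: ler_sum => w _; rewrite -mulr_sumr /ms.
      suff -> : \sum_(j < n) law (sg n) (bword f l j q) w =
          \sum_(j < n) fine (sg n (iter j f @^-1` (bword f l 0 q @^-1` [set w]))) by [].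
      apply: eq_bigr => j _; rewrite /law; congr (fine (sg n _)).
      apply/seteqP; split => x /= <-; apply/ffunP => i; rewrite !ffunE add0n addnC iterD//.
  have : \sum_w nlnx (ms n (bword f l 0 q @^-1` [set w])) <= ent nu (bword f l 0 q) + e / 2.
    apply: (@le_trans _ _ (\sum_(w : W) (nlnx (law nu (bword f l 0 q) w) + e / 2 / #|{: W}|%:R))).
      by apply: ler_sum => w _; exact: hw.
    rewrite big_split/= sumr_const -[X in _ + X <= _]mulr_natr divfK//.
    by rewrite gt_eqF.
  move=> h1 h2; have := le_trans h2 h1; rewrite ler_pdivrMl// => h3.
  have h4 : q%:R * (n%:R * b) <= q%:R * ent (sg n) (bword f l 0 n) by rewrite ler_pM2l.
  by have := arith _ _ _ _ _ _ _ mis h3 qn h4; rewrite ler_pM2l.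
by move=> /filter_ex[].
Unshelve. all: by end_near. Qed.

End limit_entropy.

(** * Noninvariant measures and conditioning on deviation sets *)

Section upper_bound.
Context {R : realType} {X : pmetricType R}.
Notation B := (@borel R X).
Notation PM := (probability B R).
Variables (f : X -> X) (m : PM).
Hypotheses (cX : compact [set: X]) (cf : continuous f).

Lemma closed_deviation k (g : 'I_k -> X -> R) c (e : R) n : (forall i, continuous (g i)) ->
  closed [set x | forall i, `|n%:R^-1 * bsum f (g i) n x - c i| <= e].
Proof.
move=> cg.
rewrite (_ : mkset _ = \bigcap_(i in [set: 'I_k])
    [set x | `|n%:R^-1 * bsum f (g i) n x - c i| <= e]); last first.
  by apply/seteqP; split => x h i //=; exact: h.
apply: closed_bigI => i _.
apply: (preimage_closed (f := fun x => `|n%:R^-1 * bsum f (g i) n x - c i|) (D := [set r | r <= e])).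
  move=> x _; apply: cvg_norm; apply: cvgB; last exact: cvg_cst.
  by apply: cvgM; [exact: cvg_cst|exact: bsum_continuous].
exact: closed_le.
Qed.

Lemma noninvariantP (mu : PM) : ~ Defs.invariant f mu ->
  exists2 g : X -> R, continuous g & RI mu (fun x => g (f x)) != RI mu g.
Proof.
move=> ninv; apply: contrapT => h; apply: ninv; apply: invariant_of_RI => // g cg.
by apply/eqP; apply: contrapT => /negP ne; apply: h; exists g.
Qed.

(** For a noninvariant measure some coboundary [g \o f - g] has nonzero integral, while its Birkhoff
    sums telescope, so its averages tend to 0 uniformly. *)
Lemma upper_noninvariant (mu : PM) : ~ Defs.invariant f mu ->
  exists (g : X -> R) (e : R), [/\ 0 < e, continuous g & exists N, forall n x, (N <= n)%N ->
    ~ `|n%:R^-1 * bsum f g n x - RI mu g| <= e].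
Proof.
move=> /noninvariantP[g cg gne].
have cgf := continuous_compf cg cf.
have cng : continuous (fun x => -1 * g x).
  by move=> x; apply: cvgM; [exact: cvg_cst|exact: cg].
pose h x := g (f x) + -1 * g x.
have ch : continuous h by move=> x; apply: cvgD; [exact: cgf|exact: cng].
pose a := RI mu h.
have a0 : 0 < `|a|.
  have pR := pos_functional_RI cX mu.
  by rewrite normr_gt0 /a (pfD pR)// (pfZ pR)// mulN1r subr_eq0.
have [M MP] := continuous_bounded cX cg.
have M0 : 0 <= M by rewrite (le_trans _ (MP point)).
exists h, (`|a| / 2); split => //; first by lra.
exists (Num.truncn (4 * M / `|a|)).+1 => n x Nn.
have n0 : 0 < n%:R :> R by rewrite ltr0n (leq_trans _ Nn).
have Mn : 4 * M < n%:R * `|a|.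
  rewrite -ltr_pdivrMr// (lt_le_trans (truncnS_gt _))// ler_nat//.
have E : bsum f h n x = g (iter n f x) - g x.
  rewrite /bsum -(big_mkord xpredT (fun j => h (iter j f x))).
  rewrite (eq_bigr (fun j => g (iter j.+1 f x) - g (iter j f x))) => [|j _].
    by rewrite telescope_sumr.
  by rewrite /h mulN1r.
have : `|bsum f h n x| <= 2 * M.
  have := MP (iter n f x); have := MP x; rewrite E !ler_norml; lra.
move=> h1; have h2 : `|n%:R^-1 * bsum f h n x| * n%:R <= 2 * M.
  by rewrite normrM normfV (gtr0_norm n0) mulrAC mulVf ?mul1r// gt_eqF.
have h3 : `|n%:R^-1 * bsum f h n x| < `|a| / 2.
  rewrite -(ltr_pM2r n0); lra.
move=> h4; have := ler_normB (n%:R^-1 * bsum f h n x) (n%:R^-1 * bsum f h n x - a).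
by rewrite opprB addrC subrK; lra.
Qed.

Section conditioned.
Variables (A : nat -> set X).
Hypothesis cA : forall n, closed (A n).

Let mA n : measurable (A n : set B). Proof. exact: closed_borel. Qed.

(* Conditional measure given [A n]; it is [m] itself when [A n] is null. *)
Definition condm n : PM := mnormalize (mrestr m (mA n)) m.

Lemma condmE n (S : set B) : 0 < fine (m (A n)) -> measurable S ->
  fine (condm n S) = fine (m (S `&` A n)) / fine (m (A n)).
Proof.
move=> A0 mS.
have mT : mrestr m (mA n) setT = (fine (m (A n)))%:E.
  by rewrite /= /mrestr setTI; exact: fin_PM.
have -> : condm n S = (m (S `&` A n) * (fine (m (A n)))^-1%:E)%E.
  exact: (mnormalizeE m S mT A0).
by rewrite (fin_PM m (measurableI _ _ mS (mA n))).
Qed.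

Lemma condm_avg n (h : X -> R) (c e : R) : 0 < fine (m (A n)) -> continuous h ->
  (forall x, A n x -> `|h x - c| <= e) -> `|RI (condm n) h - c| <= e.
Proof.
move=> A0 ch hc.
have [M MP] := continuous_bounded cX ch.
have mC : measurable (~` A n : set B) by exact: measurableC.
have C0 : RI (condm n) \1_(~` A n) = 0.
  by rewrite RI_indic// condmE// setICl measure0 mul0r.
have e0 : 0 <= e.
  have [x Ax] : A n !=set0.
    apply: contrapT => /nonemptyPn An; move: A0; rewrite An.
    by rewrite (_ : m set0 = 0%E) ?ltxx//; exact: measure0.
  by rewrite (le_trans _ (hc x Ax)).
pose K := M + `|c|.
have bh : bmeas (h : B -> R) by exact: continuous_bmeas.
have bI : bmeas (\1_(~` A n) : B -> R) by exact: bmeas_indic.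
(* The assumed bound holds on [A n] only; off it a multiple of a function with conditional integral
   0 is added. *)
have bound x : `|h x - c| <= e + K * \1_(~` A n) x.
  rewrite indicE; have [|] := boolP (x \in ~` A n); rewrite ?inE => Ax.
    rewrite mulr1 (le_trans (ler_normB _ _))//; have := MP x; rewrite /K; lra.
  rewrite mulr0 addr0; apply: hc; apply: contrapT => nA; move/negP: Ax; apply.
  by rewrite inE.
have bK : bmeas (fun x : B => K * \1_(~` A n) x) by exact: bmeasZ.
have IK : RI (condm n) (fun x => K * \1_(~` A n) x) = 0 by rewrite RIZ// C0 mulr0.
have be c' : bmeas (fun x : B => c' + K * \1_(~` A n) x).
  by apply: bmeasD => //; exact: bmeas_cst.
have Ie c' : RI (condm n) (fun x => c' + K * \1_(~` A n) x) = c'.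
  by rewrite RID ?RI_cst ?IK ?addr0//; exact: bmeas_cst.
have up : RI (condm n) h <= c + e.
  rewrite -[leRHS]Ie; apply: RI_le => // x; have := bound x; rewrite ler_norml; lra.
have lo : c - e <= RI (condm n) h.
  have bh' : bmeas (fun x : B => h x + K * \1_(~` A n) x) by exact: bmeasD.
  have -> : RI (condm n) h = RI (condm n) (fun x => h x + K * \1_(~` A n) x).
    by rewrite RID// IK addr0.
  rewrite -[leLHS](RI_cst (condm n)); apply: RI_le => //; first exact: bmeas_cst.
  by move=> x; have := bound x; rewrite ler_norml; lra.
by rewrite ler_norml; lra.
Qed.

End conditioned.
End upper_bound.

(** * Limits of conditioned orbit averages *)

Section upper_local.
Context {R : realType} {X : pmetricType R}.
Notation B := (@borel R X).
Notation PM := (probability B R).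
Notation bword := (@word _ B).
Variables (f : X -> X) (m : PM).
Hypotheses (cX : compact [set: X]) (cf : continuous f).

Lemma pos_functional_avg (sg : PM) n : (0 < n)%N ->
  pos_functional (fun g => n%:R^-1 * RI sg (bsum f g n)).
Proof.
move=> n0; have n0' : n%:R != 0 :> R by rewrite pnatr_eq0 -lt0n.
have pR := pos_functional_RI cX sg.
split => [g h cg ch|c g cg|g cg g0|].
- have -> : bsum f (fun x => g x + h x) n = (fun x => bsum f g n x + bsum f h n x).
    by apply/funext => x; rewrite /bsum big_split.
  by rewrite (pfD pR) ?mulrDr//; exact: bsum_continuous.
- have -> : bsum f (fun x => c * g x) n = (fun x => c * bsum f g n x).
    by apply/funext => x; rewrite /bsum mulr_sumr.
  by rewrite (pfZ pR); [rewrite mulrCA|exact: bsum_continuous].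
- rewrite mulr_ge0 ?invr_ge0//; apply: (pf_ge0 pR); first exact: bsum_continuous.
  by move=> x; exact: sumr_ge0.
- have -> : bsum f (fun=> 1) n = (fun=> n%:R).
    by apply/funext => x; rewrite /bsum sumr_const card_ord.
  by rewrite RI_cst mulVf.
Qed.

(* If the deviation sets A n had measure above exp(n t) infinitely often, a limit of the
   orbit averages of m conditioned on A n would have entropy at least b. *)
Lemma conditioned_limit k (g : 'I_k -> X -> R) (c : 'I_k -> R) (e t b r : R) :
  (forall i, continuous (g i)) -> 0 < r ->
  (exists N, forall n x, (N <= n)%N ->
     (forall i, `|n%:R^-1 * bsum f (g i) n x - c i| <= e) ->
     fine (m (bowen f n x r)) <= expR (n%:R * (t - b))) ->
  (forall N, exists n, [/\ (N <= n)%N, (0 < n)%N & expR (n%:R * t) <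
     fine (m [set x | forall i, `|n%:R^-1 * bsum f (g i) n x - c i| <= e])]) ->
  exists nu : PM, [/\ Defs.invariant f nu, forall i, `|RI nu (g i) - c i| <= e &
     (b%:E <= ks_entropy f nu)%E].
Proof.
move=> cg r0 [N1 ball] big.
pose A n : set X := [set x | forall i, `|n%:R^-1 * bsum f (g i) n x - c i| <= e].
have cA n : closed (A n) by exact: closed_deviation.
pose P n := (0 < n)%N && (expR (n%:R * t) < fine (m (A n))).
(* Tails of the set of times at which the deviation is too likely; a finer ultrafilter runs along
   these times. *)
pose Fi : set_system nat := filter_from setT (fun N => [set n | (N <= n)%N /\ P n]).
have FiP : ProperFilter Fi.
  apply: filter_from_proper => [|N _].
    apply: filter_from_filter; first by exists 0%N.
    move=> i j _ _; exists (maxn i j) => // n /= [+ Pn].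
    by rewrite geq_max => /andP[].
  by have [n [Nn n0 lt]] := big N; exists n; split => //; rewrite /P n0.
have [V [UV FiV]] := ultraFilterLemma FiP.
have PV : ProperFilter V by exact: ultra_proper.
have VP : V [set n | P n] by apply: FiV; exists 0%N => // n [].
have VN N : V [set n | (N <= n)%N] by apply: FiV; exists N => // n [].
pose sg n := condm m cA n.
(* The index [n.-1.+1] makes the functional well normalised also at [n = 0]; it equals [n] for
   positive [n]. *)
have [nu nuP] := @ultra_measure R X cX nat V
  (fun n g => n.-1.+1%:R^-1 * RI (sg n) (bsum f g n.-1.+1)) UV
  (fun n => pos_functional_avg (sg n) (ltn0Sn _)).
have cvnu h : continuous h -> n%:R^-1 * RI (sg n) (bsum f h n) @[n --> V] --> RI nu h.
  move=> ch; apply: cvg_trans (nuP h ch); apply: near_eq_cvg.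
  by apply: filterS (VN 1%N) => n /= n0; rewrite prednK.
have Apos n : P n -> 0 < fine (m (A n)).
  by move=> /andP[_]; apply: lt_trans; exact: expR_gt0.
have ivnu : Defs.invariant f nu.
  apply: invariant_of_RI => // h ch.
  have chf := continuous_compf ch cf.
  have [M MP] := continuous_bounded cX ch.
  have M0 : 0 <= M by rewrite (le_trans _ (MP point)).
  apply/eqP; rewrite -subr_eq0 -normr_le0; apply/ler_addgt0Pr => d d0; rewrite add0r.
  have d30 : 0 < d / 3 by lra.
  have : \forall n \near V, `|RI nu (fun x => h (f x)) - RI nu h| <= d.
    near=> n.
    have nN : ((Num.truncn (2 * M / (d / 3))).+1 <= n)%N by near: n; exact: VN.
    have n0 : 0 < n%:R :> R by rewrite ltr0n (leq_trans _ nN).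
    have Mn : 2 * M <= n%:R * (d / 3).
      rewrite -ler_pdivrMr// ltW// (lt_le_trans (truncnS_gt _))//.
      by rewrite ler_nat.
    have h1 : `|RI nu (fun x => h (f x)) - n%:R^-1 * RI (sg n) (bsum f (fun x => h (f x)) n)| <= d / 3.
      by near: n; have := cvnu _ chf => /cvgrPdist_le; apply.
    have h2 : `|RI nu h - n%:R^-1 * RI (sg n) (bsum f h n)| <= d / 3.
      by near: n; have := cvnu _ ch => /cvgrPdist_le; apply.
    have h3 : `|RI (sg n) (bsum f (fun x => h (f x)) n) - RI (sg n) (bsum f h n)| <= 2 * M.
      apply: RI_dist => [||x].
      - by apply: continuous_bmeas => //; exact: bsum_continuous.
      - by apply: continuous_bmeas => //; exact: bsum_continuous.
      rewrite /bsum -sumrB -(big_mkord xpredT (fun j => h (f (iter j f x)) - h (iter j f x))).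
      rewrite (@telescope_sumr _ 0 n (fun j => h (iter j f x)))//=.
      have := MP (iter n f x); have := MP x; rewrite !ler_norml.
      by move=> /andP[? ?] /andP[? ?]; apply/andP; split; lra.
    have h4 : `|n%:R^-1 * RI (sg n) (bsum f (fun x => h (f x)) n) - n%:R^-1 * RI (sg n) (bsum f h n)| <= d / 3.
      rewrite -mulrBr normrM normfV (gtr0_norm n0) mulrC ler_pdivrMr//.
      by rewrite (le_trans h3)// [leRHS]mulrC.
    move: h1 h2 h4; set a1 := n%:R^-1 * _; set a2 := n%:R^-1 * _.
    set b1 := RI nu _; set b2 := RI nu h; clearbody a1 a2 b1 b2 => h1 h2 h4.
    have -> : b1 - b2 = (b1 - a1) + (a1 - a2) - (b2 - a2) by ring.
    rewrite (le_trans (ler_normB _ _))// [leRHS](_ : d = d / 3 + d / 3 + d / 3); last by field.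
    by rewrite lerD// (le_trans (ler_normD _ _))// lerD.
  by move=> /filter_ex[].
exists nu; split => // [i|].
  apply/ler_addgt0Pr => d d0.
  have : \forall n \near V, `|RI nu (g i) - c i| <= e + d.
    near=> n.
    have Pn : P n by near: n; exact: VP.
    have n0 : 0 < n%:R :> R by rewrite ltr0n; have /andP[] := Pn.
    have h1 : `|RI nu (g i) - n%:R^-1 * RI (sg n) (bsum f (g i) n)| <= d.
      by near: n; have := cvnu _ (@cg i) => /cvgrPdist_le; apply.
    have cb : continuous (fun x => n%:R^-1 * bsum f (g i) n x).
      by move=> x; apply: cvgM; [exact: cvg_cst|exact: bsum_continuous].
    have h2 : `|n%:R^-1 * RI (sg n) (bsum f (g i) n) - c i| <= e.
      have bb : bmeas (bsum f (g i) n : B -> R).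
        by apply: continuous_bmeas => //; exact: bsum_continuous.
      rewrite -(RIZ (sg n) _ bb); apply: (condm_avg cX cA (Apos n Pn) cb) => x Ax.
      exact: Ax.
    rewrite [leRHS]addrC (le_trans _ (lerD h1 h2))// (le_trans _ (ler_normD _ _))//.
    by rewrite addrA subrK.
  by move=> /filter_ex[].
have [I [l [ml lr lJ]]] := small_label cX nu r0.
apply: (ks_entropy_ge cf ivnu ml) => q q0.
apply: (@limit_entropy R X f V sg nu cX cf UV VN cvnu ivnu I l b ml lJ _ q q0).
near=> n.
have Pn : P n by near: n; exact: VP.
have nN : (N1 <= n)%N by near: n; exact: VN.
have mw : mlabel (bword f l 0 n) by apply: mlabel_word => //; exact: continuous_borel.
have mA : measurable (A n : set B) by exact: closed_borel.
have [_ ltA] := andP Pn.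
(* It suffices that each atom of positive conditional mass has mass at most exp(-n b): averaging its
   information [- ln] then yields n b. *)
rewrite -[leLHS]mulr1 -[X in _ * X <= _](law_sum1 (sg n) mw) mulr_sumr /ent /fent.
apply: ler_sum => w _; have := law_ge0 (sg n) (bword f l 0 n) w.
rewrite le_eqVlt => /predU1P[<-|p0]; first by rewrite nlnx0 mulr0.
rewrite /nlnx -mulrN mulrC ler_pM2l// lerNr.
rewrite -[leRHS]expRK ler_ln ?posrE ?expR_gt0//.
have pE : law (sg n) (bword f l 0 n) w =
    fine (m ((bword f l 0 n @^-1` [set w]) `&` A n)) / fine (m (A n)).
  exact: (condmE cA (Apos n Pn) (mw w)).
rewrite pE ler_pdivrMr ?Apos//.
have [x [xw Ax]] : ((bword f l 0 n @^-1` [set w]) `&` A n) !=set0.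
  apply: contrapT => /nonemptyPn e0; move: p0; rewrite pE e0.
  by rewrite (_ : m set0 = 0%E) ?mul0r ?ltxx//; exact: measure0.
(* A word atom lies in the Bowen ball of any of its points, since equal labels mean distance at most
   [r]. Dividing exp(n (t - b)) by the mass of [A n], which exceeds exp(n t), leaves exp(-n b). *)
apply: (@le_trans _ _ (fine (m (bowen f n x r)))).
  rewrite -lee_fin -!fin_PM.
  - apply: le_measure; rewrite ?inE; first exact: measurableI (mw w) mA.
      by apply: closed_borel; exact: bowen_closed.
    move=> y [/= yw _] j jn; apply: lr.
    have := xw; rewrite /= -yw => /ffunP/(_ (Ordinal jn)); rewrite !ffunE/= add0n.
    exact.
  - by apply: closed_borel; exact: bowen_closed.
  - exact: measurableI (mw w) mA.
apply: (le_trans (ball n x nN Ax)).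
by rewrite mulrBr addrC expRD ler_pM ?expR_ge0//; exact: ltW.
Unshelve. all: by end_near. Qed.

End upper_local.

(** * The large deviation principle *)

Section large_deviations.
Context {R : realType} {X : pmetricType R}.
Notation B := (@borel R X).
Notation PM := (probability B R).
Variables (f : X -> X) (m : PM) (phi : X -> R).
Hypotheses (cX : compact [set: X]) (cf : continuous f) (cphi : continuous phi).

Lemma free_energy_invariant (mu : PM) : Defs.invariant f mu ->
  free_energy f phi mu = (ks_entropy f mu - (RI mu phi)%:E)%E.
Proof. by move=> iv; rewrite /free_energy asboolT// integ_RI. Qed.

Lemma free_energy_noninvariant (mu : PM) : ~ Defs.invariant f mu ->
  free_energy f phi mu = -oo%E.
Proof. by move=> niv; rewrite /free_energy asboolF. Qed.

Lemma free_energy_lt (mu : PM) (t : R) : Defs.invariant f mu ->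
  (free_energy f phi mu < t%:E)%E ->
  exists2 s0 : R, (ks_entropy f mu < s0%:E)%E & s0 < t + RI mu phi.
Proof.
move=> iv; rewrite free_energy_invariant// lteBlDr// -EFinD.
case: (ks_entropy f mu) => [r| |] //.
- rewrite lte_fin => lt; exists ((r + (t + RI mu phi)) / 2); rewrite ?lte_fin; lra.
- by move=> _; exists (t + RI mu phi - 1); rewrite ?ltNyr//; lra.
Qed.

(** With [phi] among the test functions, a weak neighbourhood also controls the potential term of
    the free energy. *)
Let extend k (g : 'I_k -> X -> R) (i : 'I_k.+1) : X -> R :=
  if unlift ord0 i is Some j then g j else phi.

Let extend0 k (g : 'I_k -> X -> R) : extend g ord0 = phi.
Proof. by rewrite /extend unlift_none. Qed.

Let extendS k (g : 'I_k -> X -> R) j : extend g (lift ord0 j) = g j.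
Proof. by rewrite /extend liftK. Qed.

Let extend_continuous k (g : 'I_k -> X -> R) : (forall i, continuous (g i)) ->
  forall i, continuous (extend g i).
Proof. by move=> cg i; rewrite /extend; case: unliftP => [j _|_]//; exact: cg. Qed.

Lemma usc_free_energy (t : R) : entropy_usc f ->
  weak_open [set mu | (free_energy f phi mu < t%:E)%E].
Proof.
move=> A3 mu /= qt.
have [iv|niv] := pselect (Defs.invariant f mu).
  have [s0 ks s0t] := free_energy_lt iv qt.
  have [W [/(weak_nbhs_RI cX)[k [g [e [e0 cg gW]]]] WP]] := A3 mu s0 iv ks.
  pose d := t + RI mu phi - s0; have d0 : 0 < d by rewrite /d; lra.
  apply: (@RI_weak_nbhs _ _ cX mu _ _ (extend g) (Num.min e d)).
  - by rewrite lt_min e0.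
  - exact: extend_continuous.
  move=> nu nuP /=.
  have [ivn|nivn] := pselect (Defs.invariant f nu); last first.
    by rewrite free_energy_noninvariant// ltNyr.
  have Wnu : W nu.
    by apply: gW => i; have := nuP (lift ord0 i); rewrite extendS lt_min => /andP[].
  have := nuP ord0; rewrite extend0 lt_min => /andP[_]; rewrite ltr_norml => /andP[p1 _].
  rewrite free_energy_invariant// lteBlDr// -EFinD (lt_trans (WP nu Wnu ivn))//.
  by rewrite lte_fin; move: p1; rewrite /d; lra.
(* Noninvariant measures form an open set: the integrals of [g \o f] and [g] are [|a|] apart at
   [mu], and moving each by less than half of this keeps them distinct. *)
have [g cg gne] := noninvariantP cX cf niv.
pose a := RI mu (fun x => g (f x)) - RI mu g.
have a0 : 0 < `|a| by rewrite normr_gt0 subr_eq0.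
apply: (@RI_weak_nbhs _ _ cX mu _ 2 (fun i x => if i == ord0 then g (f x) else g x) (`|a| / 2)).
- by lra.
- by move=> i; case: (i == ord0) => //; exact: continuous_compf.
move=> nu nuP /=; rewrite free_energy_noninvariant ?ltNyr// => ivn.
have := nuP ord0; have := nuP (@Ordinal 2 1 isT); rewrite /=.
rewrite (RI_comp_invariant cX cf cg ivn) !ltr_norml.
move=> /andP[? ?] /andP[? ?]; suff : `|a| < `|a| by rewrite ltxx.
by rewrite {1}/a ltr_norml; apply/andP; split; lra.
Qed.

(** The supremum over partitions is opened before any estimate, so only the finite number [hpart]
    appears and infinite entropy is no separate case. *)
Lemma lower_bound (G : set PM) : W_specification f ->
  (exists l : \bar R, lower_bowen f m phi eps @[eps --> 0^'+] --> l /\ (0 <= l)%E) ->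
  weak_open G ->
  (ereal_sup (free_energy f phi @` G) <=
     limn_einf (fun n : nat => (n%:R^-1)%:E * lne (m [set x | G (empirical f n x)])))%E.
Proof.
move=> A1 A2 oG; apply: ge_ereal_sup => _ [mu Gmu <-].
have [iv|niv] := pselect (Defs.invariant f mu); last first.
  by rewrite free_energy_noninvariant// leNye.
have [k [g [e [e0 cg gG]]]] := weak_nbhs_RI cX (oG mu Gmu).
rewrite free_energy_invariant// leeBlDr//; apply: ge_ereal_sup => _ [j [xi [mxi ->]]].
rewrite -leeBlDr// -EFinB; apply/lee_addgt0Pr => d d0; rewrite -leeBlDr// -EFinB.
have [l ml xil] := mpartition_label mxi.
have [hle hge] := hpart_label cf iv ml xil.
have h0 : 0 <= hpart f mu xi.
  apply: hge => n n0; rewrite mul0r; apply: ent_ge0; apply: mlabel_word => //.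
  exact: continuous_borel.
(* Half of [e] turns the weak deviation inequality into the strict one of the neighbourhood. *)
pose d' := Num.min d (e / 2).
have d'0 : 0 < d' by rewrite lt_min d0/=; lra.
pose J := fun i : option 'I_k => if i is Some i then g i else phi.
have cJ i : continuous (J i) by case: i => [i|] //; exact: cg.
have [N NP] := @lower_bound_main R X f m mu phi _ _ J l None cX cf iv cJ (fun=> erefl) ml A1 A2
  _ _ h0 d'0 hle.
apply: (@limn_einf_ge _ _ _ N.+1) => n Nn.
have n0 : (0 < n)%N by rewrite (leq_trans _ Nn).
have n0' : 0 < n%:R :> R by rewrite ltr0n.
have mG : measurable ([set x | G (empirical f n x)] : set B).
  by apply: open_borel; exact: open_empirical.
have := NP n _ (ltnW Nn) mG.
move=> /(_ _)/wrap[].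
  move=> x dev; apply: gG => i; rewrite RI_empirical//.
  have := dev (Some i); rewrite /= => h.
  have : n%:R * `|n%:R^-1 * bsum f (g i) n x - RI mu (g i)| <= n%:R * d'.
    by rewrite -[X in X * `|_|](gtr0_norm n0') -normrM mulrBr mulrA mulfV ?mul1r ?gt_eqF.
  rewrite ler_pM2l// => /le_lt_trans; apply.
  rewrite (@le_lt_trans _ _ (e / 2))//; last by lra.
  by rewrite ge_min lexx orbT.
move=> low; have c0 : 0 < fine (m [set x | G (empirical f n x)]) by exact: lt_le_trans (expR_gt0 _) low.
rewrite (fin_PM m mG) /lne (lt_geF c0) -EFinM lee_fin.
rewrite mulrC ler_pdivlMr// mulrC.
rewrite -[leLHS]expRK ler_ln ?posrE ?expR_gt0//; apply: le_trans low.
rewrite ler_expR ler_pM2l// lerB//.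
by rewrite ge_min lexx.
Qed.

Lemma free_energy_le0 : W_specification f ->
  (exists l : \bar R, lower_bowen f m phi eps @[eps --> 0^'+] --> l /\ (0 <= l)%E) ->
  forall mu, (free_energy f phi mu <= 0)%E.
Proof.
move=> A1 A2 mu.
have oT : weak_open [set: PM].
  by move=> nu _; apply: (@RI_weak_nbhs _ _ cX nu _ 0 (fun i => phi) 1) => // -[].
apply: (@le_trans _ _ (ereal_sup (free_energy f phi @` setT))).
  by apply: ereal_sup_ubound; exists mu.
apply: (le_trans (lower_bound A1 A2 oT)); rewrite leNgt; apply/negP => /limn_einf_gt[N].
move=> /(_ N (leqnn N)).
have -> : m [set x | setT (empirical f N x)] = 1%E.
  by rewrite (_ : mkset _ = setT); [exact: probability_setT|apply/seteqP].
by rewrite lne1 mule0 ltxx.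
Qed.

Lemma upper_local (mu : PM) (t : R) : entropy_usc f ->
  (exists l : \bar R, upper_bowen f m phi eps @[eps --> 0^'+] --> l /\ (l <= 0)%E) ->
  (free_energy f phi mu < t%:E)%E ->
  exists k (g : 'I_k -> X -> R) (e : R), [/\ 0 < e, forall i, continuous (g i) &
    exists N, forall n, (N <= n)%N -> (0 < n)%N ->
      fine (m [set x | forall i, `|n%:R^-1 * bsum f (g i) n x - RI mu (g i)| <= e])
        <= expR (n%:R * t)].
Proof.
move=> A3 A4 qt.
have [iv|niv] := pselect (Defs.invariant f mu); last first.
  have [g [e [e0 cg [N NP]]]] := upper_noninvariant cX cf niv.
  exists 1%N, (fun=> g), e; split => //; exists N => n Nn n0.
  rewrite (_ : mkset _ = set0); first by rewrite (_ : m set0 = 0%E) ?expR_ge0//; exact: measure0.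
  by apply/seteqP; split => // x /(_ ord0)/(NP n x Nn).
have [s0 ks s0t] := free_energy_lt iv qt.
have [W [/(weak_nbhs_RI cX)[k [g [e [e0 cg gW]]]] WP]] := A3 mu s0 iv ks.
pose d := (t + RI mu phi - s0) / 2; have d0 : 0 < d by rewrite /d; lra.
have [r r0 [N1 ball]] := upper_bowen_ball cf A4 d0.
pose e' := Num.min (e / 2) d.
have e'0 : 0 < e' by rewrite lt_min d0 andbT; lra.
have e'e : e' < e by rewrite (@le_lt_trans _ _ (e / 2))//; [rewrite ge_min lexx|lra].
have e'd : e' <= d by rewrite ge_min lexx orbT.
have cg' := extend_continuous cg.
exists k.+1, (extend g), e'; split => //.
apply: contrapT => nN.
(* On the deviation sets averages of [phi] are within [e'] of its integral, so [A.4] bounds balls by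
   exp(n (t - b)) for this [b]. As [e' <= d] and 2 d = t + RI mu phi - s0, [b] is at least [s0], and
   a limit of entropy at least [b] contradicts semicontinuity. *)
have [||nu [ivn nuP hnu]] := @conditioned_limit R X f m cX cf _ (extend g)
    (fun i => RI mu (extend g i)) e' t (RI mu phi - e' - d + t) r cg' r0.
- exists N1.+1 => n x Nn dev; apply: (le_trans (ball n x (ltnW Nn))).
  have n0 : 0 < n%:R :> R by rewrite ltr0n (leq_trans _ Nn).
  have := dev ord0; rewrite extend0 ler_norml => /andP[+ _].
  rewrite lerBrDr addrC mulrC ler_pdivlMr// => h.
  rewrite ler_expR; lra.
- move=> N; apply: contrapT => nn; apply: nN; exists N => n Nn n0.
  by rewrite leNgt; apply/negP => lt; apply: nn; exists n.
have Wnu : W nu.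
  apply: gW => i; apply: le_lt_trans e'e.
  by have := nuP (lift ord0 i); rewrite extendS.
have := le_lt_trans hnu (WP nu Wnu ivn); rewrite lte_fin.
move: e'd; rewrite /d; lra.
Qed.

Lemma weak_closed_dev k (g : 'I_k -> X -> R) (c : 'I_k -> R) (e : R) :
  (forall i, continuous (g i)) -> weak_closed [set nu : PM | forall i, `|RI nu (g i) - c i| <= e].
Proof.
move=> cg nu /= /existsNP[i /negP]; rewrite -ltNge => lt.
apply: (@RI_weak_nbhs _ _ cX nu _ k g (`|RI nu (g i) - c i| - e)) => //.
  by rewrite subr_gt0.
move=> nu' /(_ i) h1 /(_ i) h2.
have := ler_distD (RI nu' (g i)) (RI nu (g i)) (c i).
by rewrite distrC in h1; lra.
Qed.

(** Compactness enters through an ultrafilter instead of finite covers. The sets [V] such that the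
    part of [F] outside [V] decays at rate [t] form a filter [GG]; if the bound failed, [GG] would
    be proper, and the limit of a finer ultrafilter would lie in [F] and contradict
    [upper_local]. *)
Lemma upper_bound (F : set PM) : entropy_usc f ->
  (exists l : \bar R, upper_bowen f m phi eps @[eps --> 0^'+] --> l /\ (l <= 0)%E) ->
  weak_closed F ->
  (limn_esup (fun n : nat => (n%:R^-1)%:E * lne (m [set x | F (empirical f n x)]))
     <= ereal_sup (free_energy f phi @` F))%E.
Proof.
move=> A3 A4 cF; rewrite leNgt; apply/negP => lt.
set s := ereal_sup _ in lt; set u := limn_esup _ in lt.
have [t st tu] : exists2 t : R, (s < t%:E)%E & (t%:E < u)%E.
  move: lt; case: (s) => [a| |]; case: (u) => [b| |] //=.
  - by rewrite lte_fin => ab; exists ((a + b) / 2); rewrite lte_fin; lra.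
  - by move=> _; exists (a + 1); rewrite ?ltry// lte_fin; lra.
  - by move=> _; exists (b - 1); rewrite ?ltNyr// lte_fin; lra.
  - by move=> _; exists 0; rewrite ?ltry ?ltNyr.
have Ft mu : F mu -> (free_energy f phi mu < t%:E)%E.
  by move=> Fmu; apply: le_lt_trans st; apply: ereal_sup_ubound; exists mu.
pose bd (D : set PM) := exists (C : R) N, 0 <= C /\ forall n, (N <= n)%N -> (0 < n)%N ->
  fine (m [set x | D (empirical f n x)]) <= C * expR (n%:R * t).
have mE n D : (0 < n)%N -> weak_closed D -> measurable ([set x | D (empirical f n x)] : set B).
  by move=> n0 cD; apply: closed_borel; exact: closed_empirical.
have lem n (D D' : set PM) : (0 < n)%N -> weak_closed D -> weak_closed D' -> D `<=` D' ->
    fine (m [set x | D (empirical f n x)]) <= fine (m [set x | D' (empirical f n x)]).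
  move=> n0 cD cD' DD'; rewrite -lee_fin -!fin_PM; [|exact: mE|exact: mE].
  by apply: le_measure; rewrite ?inE; [exact: mE|exact: mE|move=> x /DD'].
have cU (D D' : set PM) : weak_closed D -> weak_closed D' -> weak_closed (D `|` D').
  move=> cD cD' nu; rewrite setCU => -[nD nD'].
  have [k [g [e [e0 cg gP]]]] := weak_nbhs_RI cX (cD nu nD).
  have [k' [g' [e' [e'0 cg' gP']]]] := weak_nbhs_RI cX (cD' nu nD').
  pose gg (i : 'I_(k + k')) := match fintype.split i with inl i => g i | inr i => g' i end.
  apply: (@RI_weak_nbhs _ _ cX nu _ _ gg (Num.min e e')).
  - by rewrite lt_min e0.
  - by move=> i; rewrite /gg; case: (fintype.split i) => j; [exact: cg|exact: cg'].
  move=> nu' h; split.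
    apply: gP => i; have := h (unsplit (inl i)); rewrite /gg unsplitK lt_min => /andP[]//.
  apply: gP' => i; have := h (unsplit (inr i)); rewrite /gg unsplitK lt_min => /andP[]//.
(* The closed [D] is interposed so that the sets of points involved are measurable. *)
pose GG : set_system PM := [set V | exists D, [/\ weak_closed D, F `\` V `<=` D & bd D]].
have c0 : weak_closed (set0 : set PM).
  rewrite /weak_closed setC0 => nu _.
  by apply: (@RI_weak_nbhs _ _ cX nu _ 0 (fun i => phi) 1) => // -[].
have b0 : bd set0.
  exists 0, 0%N; split => // n _ _; rewrite mul0r.
  by rewrite (_ : m _ = 0%E)//; exact: measure0.
have FGG : Filter GG.
  split.
  - by exists set0; split => //; rewrite setDT.
  - move=> V V' [D [cD FV [C [N [C0 NP]]]]] [D' [cD' FV' [C' [N' [C0' NP']]]]].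
    exists (D `|` D'); split; first exact: cU.
      move=> nu [Fnu nV]; have [Vn|nVn] := pselect (V nu); last by left; apply: FV.
      by right; apply: FV'; split => // V'n; apply: nV.
    exists (C + C'), (maxn N N'); split; first exact: addr_ge0.
    move=> n; rewrite geq_max => /andP[nN nN'] n0.
    rewrite mulrDl (le_trans _ (lerD (NP n nN n0) (NP' n nN' n0)))//.
    have h : (m ([set x | D (empirical f n x)] `|` [set x | D' (empirical f n x)]) <=
       m [set x | D (empirical f n x)] + m [set x | D' (empirical f n x)])%E.
      by apply: measureU2; exact: mE.
    rewrite -lee_fin EFinD -!fin_PM; [exact: h|exact: mE|exact: mE|].
    by apply: mE => //; exact: cU.
  - move=> V V' VV' [D [cD FV bD]]; exists D; split => // nu [Fnu nV'].
    by apply: FV; split => // /VV'.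
have PGG : ProperFilter GG.
  (* If the empty set belonged to [GG], all of [F] would decay at rate [t], below the upper limit
     [u]; the factor [C] disappears in the rate, and [C + 1] makes its logarithm meaningful. *)
  apply: Build_ProperFilter => -[D [cD FV [C [N [C0 NP]]]]].
  move: tu; rewrite ltNge => /negP; apply.
  apply/lee_addgt0Pr => d d0.
  pose C1 := C + 1; have C10 : 0 < C1 by rewrite /C1; lra.
  apply: (@limn_esup_le _ _ _ (maxn N (Num.truncn (`|ln C1| / d)).+1)) => n.
  rewrite geq_max => /andP[nN nC].
  have n0 : (0 < n)%N by rewrite (leq_trans _ nC).
  have n0' : 0 < n%:R :> R by rewrite ltr0n.
  have FD : F `<=` D by move=> nu Fnu; apply: FV; split.
  have le1 := le_trans (lem n F D n0 cF cD FD) (NP n nN n0).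
  rewrite (fin_PM m (mE n F n0 cF)); set c := fine _ in le1 *.
  rewrite /lne; case: ifPn => [_|]; first by rewrite gt0_muleNy ?leNye// lte_fin invr_gt0.
  rewrite -ltNge => c0'; rewrite -EFinM -EFinD lee_fin mulrC ler_pdivrMr//.
  have le2 : c <= C1 * expR (n%:R * t).
    by rewrite (le_trans le1)// ler_wpM2r ?expR_ge0// /C1; lra.
  have : ln c <= ln (C1 * expR (n%:R * t)).
    by rewrite ler_ln ?posrE// mulr_gt0// expR_gt0.
  rewrite lnM ?posrE ?expR_gt0// expRK.
  have : `|ln C1| <= n%:R * d.
    rewrite -ler_pdivrMr// ltW// (lt_le_trans (truncnS_gt _))//.
    by rewrite ler_nat.
  have := ler_norm (ln C1); lra.
have [U [UU GGU]] := ultraFilterLemma PGG.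
have PU : ProperFilter U by exact: ultra_proper.
have [nu nuP] := @ultra_measure R X cX PM U (@RI R _ B) UU (pos_functional_RI cX).
have Unbhs k (g : 'I_k -> X -> R) (e : R) : 0 < e -> (forall i, continuous (g i)) ->
    U [set nu' : PM | forall i, `|RI nu' (g i) - RI nu (g i)| < e].
  move=> e0 cg; apply: filter_forall => i.
  have := nuP _ (cg i) => /cvgrPdist_lt/(_ e e0).
  by apply: filterS => nu' /=; rewrite distrC.
have UF : U F by apply: GGU; exists set0; split => //; rewrite setDv.
have Fnu : F nu.
  apply: contrapT => nF.
  have [k [g [e [e0 cg gP]]]] := weak_nbhs_RI cX (cF nu nF).
  have [nu' [F' /gP]] := filter_ex (filterI UF (Unbhs k g e e0 cg)).
  exact.
have [k [g [e [e0 cg [N NP]]]]] := upper_local A3 A4 (Ft nu Fnu).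
(* By [upper_local] the complement of a neighbourhood of [nu] belongs to [U], although [U] converges
   to [nu]. *)
have UV : U (~` [set nu' : PM | forall i, `|RI nu' (g i) - RI nu (g i)| <= e]).
  apply: GGU; exists [set nu' : PM | forall i, `|RI nu' (g i) - RI nu (g i)| <= e].
  split; first exact: weak_closed_dev.
    by move=> nu' [_ /contrapT].
  exists 1, N; split => // n nN n0; rewrite mul1r; apply: le_trans (NP n nN n0).
  rewrite le_eqVlt; apply/orP; left; apply/eqP; congr (fine (m _)).
  by apply/seteqP; split => x h i; have := h i; rewrite RI_empirical.
have [nu' [h1 h2]] := filter_ex (filterI UV (Unbhs k g e e0 cg)).
by apply: h1 => i; apply: ltW; exact: h2.
Qed.

End large_deviations.

Theorem theoremA (R : realType) (X : pmetricType R) (f : X -> X)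
  (m : probability (@borel R X) R) (phi : X -> R) :
  compact [set: X] -> continuous f -> continuous phi ->
  (* [A.1] *) W_specification f ->
  (* [A.2] *) (exists l : \bar R,
                 lower_bowen f m phi eps @[eps --> 0^'+] --> l /\ (0 <= l)%E) ->
  (* [A.3] *) entropy_usc f ->
  (* [A.4] *) (exists l : \bar R,
                 upper_bowen f m phi eps @[eps --> 0^'+] --> l /\ (l <= 0)%E) ->
  LDP2 f m (free_energy f phi).
Proof.
move=> cX cf cphi A1 A2 A3 A4; split.
- exact: (free_energy_le0 cX cf cphi A1 A2).
- by move=> t; exact: usc_free_energy.
- by move=> G oG; exact: lower_bound.
- by move=> F cF; exact: upper_bound.
Qed.
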